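(* Let $(b,c)$ be a connected graph over $(X,m)$. The following statements are equivalent: (i) The Neumann semigroup $P^{(N)}_t$ is Feller. (ii) The Dirichlet semigroup $P^{(D)}_t$ is Feller and $Q^{(D)}=Q^{(N)}$. In particular, in this case, the restricted Neumann semigroups $P^{(N)}_{t,k}$ converge strongly to the Dirichlet semigroup $P^{(D)}_t$ in $\ell^2(X,m)$ as $k\to\infty$ for any exhaustion $(X_k)$.
   Context: Graphs: $X$ is a countable discrete set and $m:X\to(0,\infty)$. A graph $(b,c)$ over $(X,m)$ consists of $b:X\times X\to[0,\infty)$ with $b(x,y)=b(y,x)$, $b(x,x)=0$, $\sum_{y\in X}b(x,y)<\infty$ for all $x$, and a killing term $c:X\to[0,\infty)$. It is connected if any two vertices $x,y$ are joined by a path $x=x_0,\dots,x_n=y$ with $b(x_k,x_{k+1})>0$. $C_c(X)$ denotes the finitely supported functions. Forms: $\ell^2(X,m)$ is the space of $f:X\to\mathbb R$ with $\|f\|^2=\sum_x f(x)^2m(x)<\infty$. Let $\mathcal D$ be the set of all $f:X\to\mathbb R$ with $\sum_{x,y}b(x,y)(f(x)-f(y))^2+\sum_x c(x)f(x)^2<\infty$, and for $f\in\mathcal D$ let $\mathcal Q(f)=\frac12\sum_{x,y}b(x,y)(f(x)-f(y))^2+\sum_xc(x)f(x)^2$. $Q^{(N)}$ is the restriction of $\mathcal Q$ to $D(Q^{(N)})=\mathcal D\cap\ell^2(X,m)$, and $Q^{(D)}$ is the restriction of $\mathcal Q$ to $D(Q^{(D)})$, the closure of $C_c(X)$ with respect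 to the norm $(\mathcal Q(f)+\|f\|^2)^{1/2}$. Both are Dirichlet forms; $Q^{(D)}=Q^{(N)}$ means the domains coincide. $L^{(D)},L^{(N)}$ are the associated nonnegative self-adjoint operators on $\ell^2(X,m)$, and $P^{(D)}_t=e^{-tL^{(D)}}$, $P^{(N)}_t=e^{-tL^{(N)}}$ are the Dirichlet and Neumann semigroups. Feller property: $C_0(X)$ is the closure of $C_c(X)$ in the supremum norm. A semigroup $P_t$, where $P_t$ is either the Dirichlet semigroup $P^{(D)}_t$ or the Neumann semigroup $P^{(N)}_t$, is Feller if $P_t(C_c(X))\subseteq C_0(X)$ for some (equivalently, all) $t>0$. Exhaustions: an exhaustion is a sequence of finite sets $X_k\subseteq X$ with $X_k\subseteq X_{k+1}$ and $X=\bigcup_kX_k$, such that for each $k$ the graph obtained by restricting $b$ to $X_k\times X_k$ is connected. On $\ell^2(X_k,m)$ let $L^{(N)}_kf(x)=\frac1{m(x)}\sum_{y\in X_k}b(x,y)(f(x)-f(y))+\frac{c(x)}{m(x)}f(x)$, and $P^{(N)}_{t,k}=e^{-tL^{(N)}_k}$, regarded as an operator on $\ell^2(X,m)$ by restricting functions to $X_k$, applying the operator, and extending by $0$. *)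

(* Defs.v *)
From HB Require Import structures.
From mathcomp Require Import all_boot all_order all_algebra.
From mathcomp Require Import all_classical all_reals all_analysis.
Set Implicit Arguments.
Unset Strict Implicit.
Unset Printing Implicit Defensive.
Import Order.TTheory GRing.Theory Num.Theory.
Import numFieldNormedType.Exports.
Local Open Scope classical_set_scope.
Local Open Scope ring_scope.

Record graph (R : realType) (X : countType) := Graph {
  edge : X -> X -> R;
  killing : X -> R;
  edge_ge0 : forall x y, 0 <= edge x y;
  edge_sym : forall x y, edge x y = edge y x;
  edge_diag : forall x, edge x x = 0;
  edge_summable : forall x, (\esum_(y in [set: X]) (edge x y)%:E < +oo)%E;
  killing_ge0 : forall x, 0 <= killing x }.

Section Graphs.
Context {R : realType} {X : countType}.
Implicit Types (G : graph R X) (m f g : X -> R) (A : set X).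

(* Paths stay inside [A]: this is connectedness of the graph with edge weight
   restricted to [A] x [A]. *)
Definition connected_on G A :=
  forall x y, A x -> A y -> exists p : seq X,
    [/\ path (fun u v => 0 < edge G u v) x p, last x p = y &
        forall z, z \in p -> A z].

Definition connected_graph G := connected_on G [set: X].

Definition Cc : set (X -> R) := [set f | finite_set [set x | f x != 0]].

Definition C0 : set (X -> R) :=
  [set f | forall e : R, 0 < e ->
     exists2 g, Cc g & forall x, `|f x - g x| <= e].

Definition sqnorm_ereal m f : \bar R :=
  \esum_(x in [set: X]) ((f x) ^+ 2 * m x)%:E.

Definition ell2 m : set (X -> R) := [set f | (sqnorm_ereal m f < +oo)%E].

Definition sqnorm m f : R := fine (sqnorm_ereal m f).

Definition ell2norm m f : R := Num.sqrt (sqnorm m f).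

Definition edge_energy G f : \bar R :=
  \esum_(p in [set: X * X]) (edge G p.1 p.2 * (f p.1 - f p.2) ^+ 2)%:E.

Definition killing_energy G f : \bar R :=
  \esum_(x in [set: X]) (killing G x * (f x) ^+ 2)%:E.

Definition finite_energy G : set (X -> R) :=
  [set f | (edge_energy G f + killing_energy G f < +oo)%E].

(* The value of the form; meaningful on [finite_energy G] only, since [fine]
   sends +oo to 0. *)
Definition energy G f : R :=
  2^-1 * fine (edge_energy G f) + fine (killing_energy G f).

Definition form_norm G m f : R := Num.sqrt (energy G f + sqnorm m f).

Definition domN G m : set (X -> R) := finite_energy G `&` ell2 m.

Definition domD G m : set (X -> R) :=
  [set f | domN G m f /\
     forall e : R, 0 < e -> exists2 g, Cc g & form_norm G m (f \- g) < e].

(* The symmetric bilinear form of a quadratic form.  For [sqnorm m] on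
   [ell2 m] it is the inner product \sum_x f x * g x * m x, and for [energy G]
   on [finite_energy G] it is
   1/2 \sum_(x, y) b x y * (f x - f y) * (g x - g y) + \sum_x c x * f x * g x. *)
Definition polar (q : (X -> R) -> R) f g : R := (q (f \+ g) - q (f \- g)) / 4.

(* The graph of the self-adjoint operator [L] associated with the restriction
   of [energy G] to [D]: [form_operator G m D f g] says that f lies in the
   domain of [L] and L f = g. *)
Definition form_operator G m (D : set (X -> R)) f g : Prop :=
  [/\ D f, ell2 m g &
      forall h, D h -> polar (energy G) f h = polar (sqnorm m) g h].

Definition dirichlet_operator G m := form_operator G m (domD G m).

Definition neumann_operator G m := form_operator G m (domN G m).

(* P_t = exp (- t L) for an operator [L] given by its graph: the strongly
   continuous semigroup of bounded operators on l^2(X, m) whose generator is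
   -L, domain included.  It is unique.  [P t f] is unconstrained for t < 0 or
   f outside l^2(X, m). *)
Record exp_semigroup m (L : (X -> R) -> (X -> R) -> Prop)
    (P : R -> (X -> R) -> (X -> R)) : Prop := ExpSemigroup {
  semigroup_ell2 : forall t f, 0 <= t -> ell2 m f -> ell2 m (P t f);
  semigroup_linear : forall t (a : R) f g, 0 <= t -> ell2 m f -> ell2 m g ->
    P t (fun x => a * f x + g x) = (fun x => a * P t f x + P t g x);
  semigroup_bounded : forall t, 0 <= t ->
    exists C : R, forall f, ell2 m f -> ell2norm m (P t f) <= C * ell2norm m f;
  semigroup0 : forall f, ell2 m f -> P 0 f = f;
  semigroupD : forall s t f, 0 <= s -> 0 <= t -> ell2 m f ->
    P (s + t) f = P s (P t f);
  semigroup_continuous : forall f, ell2 m f ->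
    ell2norm m (P t f \- f) @[t --> 0^'+] --> (0 : R);
  semigroup_generator : forall f g, L f g <->
    [/\ ell2 m f, ell2 m g &
        ell2norm m (fun x => t^-1 * (f x - P t f x) - g x) @[t --> 0^'+]
          --> (0 : R)] }.

Definition feller (P : R -> (X -> R) -> (X -> R)) :=
  exists2 t : R, 0 < t & forall f, Cc f -> C0 (P t f).

Definition exhaustion G (A : nat -> set X) :=
  [/\ forall k, finite_set (A k), forall k, A k `<=` A k.+1,
      \bigcup_k A k = [set: X] & forall k, connected_on G (A k)].

(* Functions on the finite set [A] are represented by their extension by 0. *)
Definition restricted_operator G m A f : X -> R :=
  patch (fun=> 0) A (fun x =>
    (m x)^-1 * (\sum_(y \in A) edge G x y * (f x - f y))
    + killing G x / m x * f x).

(* Exponential series of the operator on the finite-dimensional space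
   l^2(A, m), applied to f restricted to [A] and extended by 0. *)
Definition restricted_semigroup G m A (t : R) f : X -> R := fun x =>
  limn (series (fun n =>
    exp_coeff (- t) n *
      iter n (restricted_operator G m A) (patch (fun=> 0) A f) x)).

End Graphs.

(* Main.v *)
Require Import Defs.
From mathcomp Require Import all_boot all_order all_algebra.
From mathcomp Require Import finmap.
From mathcomp Require Import all_classical all_reals all_analysis.
From mathcomp Require Import ring lra.
Set Implicit Arguments.
Unset Strict Implicit.
Unset Printing Implicit Defensive.
Import Order.TTheory GRing.Theory Num.Theory.
Import numFieldNormedType.Exports.
Local Open Scope classical_set_scope.
Local Open Scope ring_scope.

(** Let [L] be the Neumann operator and [P t] its semigroup.  If [P t] is Feller
    and [f] is finitely supported, then [P t f] has finite energy and vanishes at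
    infinity.  Subtracting from it its truncation at a small height leaves a
    finitely supported function, and the truncation is a normal contraction with
    small values, hence has small form norm; so [P t f] lies in the Dirichlet
    domain ([C0_domN_domD]).  The estimate [2 t * energy (P t f) <= sqnorm f]
    and density extend this to all [f] in l^2(X, m) ([semigroup_Cc_domD]).  A
    vector [h] of the Neumann domain that is form-orthogonal to the Dirichlet
    domain then satisfies [<P t (1 + L) f, h> = 0] for all [f] in the domain of
    [L], that is [<P t k, h> = 0] for all [k]; taking [k = h], symmetry gives
    [P (t / 2) h = 0], and after repeated halving strong continuity gives
    [h = 0].  By Riesz representation the two domains agree
    ([feller_domN_sub_domD]).  Once they agree the two operators are the same, so
    both semigroups coincide ([exp_semigroup_unique]), which settles the
    equivalence.

    What is needed about semigroups comes from the implicit Euler scheme instead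
    of the spectral theorem.  The resolvents [(1 + s L)^-1] exist by Riesz
    representation and are contractions; [semigroup_euler_limit] shows that
    [P t f] is the limit of [(1 + (t / 2^j) L)^-(2^j) f].  Uniqueness,
    contractivity, symmetry and the energy estimate pass from the resolvents to
    the limit.  A semigroup is only assumed to consist of bounded operators and
    to be strongly continuous at 0; the uniform boundedness principle turns this
    into a bound on compact time intervals ([semigroup_bounded_near0]).

    For the convergence along an exhaustion, the graphs restricted to the finite
    sets increase to the whole graph, so that the minimizers of
    [s * energy v + sqnorm (v \- f)], which are the resolvents of [f], converge
    ([monotone_resolvent_cvg]).  On the domain of [L ^ 2] the Euler scheme
    converges at a rate that depends on [L] only through the norm of
    [L ^ 2 f] ([euler_limit_rate]), so convergence of resolvents gives
    convergence of semigroups ([trotter_kato]).  The restricted semigroup is the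
    exponential series of a bounded operator; its Taylor remainder shows that it
    is the limit of the Euler scheme too ([restricted_euler_limit]). *)

Lemma ler_norm_sqr (R : realDomainType) (x y : R) :
  `|x| <= `|y| -> x ^+ 2 <= y ^+ 2.
Proof.
by move=> xy; rewrite -(real_normK (num_real x)) -(real_normK (num_real y)) lerXn2r ?nnegrE.
Qed.

(** * Sums of nonnegative families *)

Section Sums.
Context {R : realType} {T : choiceType}.
Implicit Types (a b : T -> R) (C : R).

Lemma fsum_EFin_fset a (F : set T) : finite_set F ->
  (\sum_(i \in F) (a i)%:E)%E = (\sum_(i <- fset_set F) a i)%:E.
Proof. by move=> finF; rewrite fsbig_finite//= sumEFin. Qed.

Lemma esum_leP a C :
  (\esum_(i in [set: T]) (a i)%:E <= C%:E)%E <->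
  forall F : set T, finite_set F -> \sum_(i <- fset_set F) a i <= C.
Proof.
split=> [aC F finF|aC].
  rewrite -lee_fin -fsum_EFin_fset//; apply: le_trans aC.
  by apply: ereal_sup_ubound; exists F.
by apply: ge_ereal_sup => _ [F [finF _] <-]; rewrite fsum_EFin_fset// lee_fin aC.
Qed.

Lemma esumZ a C : 0 <= C -> (forall i, 0 <= a i) ->
  \esum_(i in [set: T]) (C * a i)%:E = (C%:E * \esum_(i in [set: T]) (a i)%:E)%E.
Proof.
move=> C0 a0.
have half (r : R) b : 0 <= r -> (forall i, 0 <= b i) ->
    (\esum_(i in [set: T]) (r * b i)%:E <= r%:E * \esum_(i in [set: T]) (b i)%:E)%E.
  move=> r0 b0; apply: ge_ereal_sup => _ [F [finF _] <-].
  rewrite fsum_EFin_fset// -mulr_sumr EFinM; apply: lee_pmul => //.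
    by rewrite lee_fin sumr_ge0.
  by rewrite -fsum_EFin_fset//; apply: ereal_sup_ubound; exists F.
apply/eqP; rewrite eq_le half//=.
have [->|Cn0] := eqVneq C 0.
  by rewrite mul0e; apply: esum_ge0 => i _; rewrite mul0r.
have Cp : 0 < C by rewrite lt_neqAle eq_sym Cn0.
rewrite -lee_pdivlMl// -[X in (X <= _)%E]
  (_ : \esum_(i in [set: T]) (C^-1 * (C * a i))%:E = _)%E.
  by apply: half; rewrite ?invr_ge0// => i; rewrite mulr_ge0.
by apply: eq_esum => i _; rewrite mulKf.
Qed.

(** Fatou's lemma for the counting measure. *)
Lemma esum_fatou (a : nat -> T -> R) b C :
  (forall i, (fun n => a n i) @ \oo --> b i) ->
  (exists N, forall n, (N <= n)%N -> (\esum_(i in [set: T]) (a n i)%:E <= C%:E)%E) ->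
  (\esum_(i in [set: T]) (b i)%:E <= C%:E)%E.
Proof.
move=> ab [N aC]; apply/esum_leP => F finF.
have cvF : (fun n => \sum_(i <- fset_set F) a n i) @ \oo --> \sum_(i <- fset_set F) b i.
  elim: (enum_fset (fset_set F)) => [|i s IH].
    rewrite big_nil; under eq_fun do rewrite big_nil; exact: cvg_cst.
  rewrite big_cons; under eq_fun do rewrite big_cons; exact: cvgD.
rewrite -(cvg_lim _ cvF)//; apply: limr_le; first by apply/cvg_ex; eexists; exact: cvF.
by exists N => // n /= Nn; exact: (esum_leP _ _).1 (aC _ Nn) _ finF.
Qed.

(** Phrased for families dominated by [a]: this one estimate controls both
    cut-offs, which vanish on [F], and truncations, which are small on [F]. *)
Lemma esum_tail a e : (forall i, 0 <= a i) ->
  (\esum_(i in [set: T]) (a i)%:E < +oo)%E -> 0 < e ->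
  exists2 F, finite_set F &
    forall b, (forall i, 0 <= b i <= a i) -> (forall i, F i -> b i = 0) ->
      (\esum_(i in [set: T]) (b i)%:E <= e%:E)%E.
Proof.
move=> a0 afin e0.
have sa0 : (0 <= \esum_(i in [set: T]) (a i)%:E)%E.
  by apply: esum_ge0 => i _; rewrite lee_fin.
have sfin : (\esum_(i in [set: T]) (a i)%:E \is a fin_num)%E.
  by rewrite ge0_fin_numE.
have [_ [F [finF _] <-]] := ub_ereal_sup_adherent e0 sfin.
rewrite -/(esum _ _) => Fe; exists F => // b ba bF.
pose c i := if i \in F then a i else 0.
have cF : \esum_(i in [set: T]) (c i)%:E = (\sum_(i \in F) (a i)%:E)%E.
  rewrite -esum_fset//; last by move=> i _; rewrite lee_fin.
  by rewrite [RHS]esum_mkcond; apply: eq_esum => i _; rewrite /c; case: ifP.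
have : (\esum_(i in [set: T]) (c i)%:E + \esum_(i in [set: T]) (b i)%:E <=
        \esum_(i in [set: T]) (a i)%:E)%E.
  rewrite -esumD; last 2 first.
  - by move=> i _; rewrite lee_fin /c; case: ifP.
  - by move=> i _; rewrite lee_fin; case/andP: (ba i).
  apply: le_esum => i _; rewrite -EFinD lee_fin /c; case: ifPn.
    by rewrite inE => /bF ->; rewrite addr0.
  by rewrite add0r; case/andP: (ba i).
move: Fe sa0; rewrite cF fsum_EFin_fset// -(fineK sfin).
case: (\esum_(i in [set: T]) (b i)%:E)%E => [r||] //=;
  rewrite -?EFinN -?EFinD ?lte_fin ?lee_fin => ? ? ?.
  lra.
exact: leNye.
Qed.

End Sums.

(** * Weighted sums of squares *)

Section WeightedSquares.
Context {R : realType} {T : choiceType} (w : T -> R).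
Hypothesis w_ge0 : forall i, 0 <= w i.
Implicit Types (a b c : T -> R).

Definition wsq a : \bar R := \esum_(i in [set: T]) (w i * a i ^+ 2)%:E.

Lemma wterm_ge0 i (u : R) : 0 <= w i * u ^+ 2.
Proof. by rewrite mulr_ge0 ?sqr_ge0. Qed.
Hint Resolve wterm_ge0 : core.

Lemma wsq_ge0 a : (0 <= wsq a)%E.
Proof. by apply: esum_ge0 => i _; rewrite lee_fin. Qed.

Lemma wsq_fine a : (wsq a < +oo)%E -> wsq a = (fine (wsq a))%:E.
Proof. by move=> afin; rewrite fineK// ge0_fin_numE// wsq_ge0. Qed.

Lemma le_wsq a b : (forall i, `|a i| <= `|b i|) -> (wsq a <= wsq b)%E.
Proof.
by move=> ab; apply: le_esum => i _; rewrite lee_fin ler_wpM2l// ler_norm_sqr.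
Qed.

Lemma wsqZ (r : R) a : wsq (fun i => r * a i) = ((r ^+ 2)%:E * wsq a)%E.
Proof.
rewrite /wsq -esumZ ?sqr_ge0//; apply: eq_esum => i _.
by rewrite exprMn mulrCA.
Qed.

Lemma wsqD a b :
  (wsq (fun i => a i + b i)%R <= 2%:E * wsq a + 2%:E * wsq b)%E.
Proof.
rewrite /wsq -!esumZ// -esumD;
  try by move=> i _; rewrite lee_fin mulr_ge0.
apply: le_esum => i _; rewrite -EFinD lee_fin.
have := w_ge0 i; have := sqr_ge0 (a i - b i); nra.
Qed.

Lemma wsq_lin_fin (r : R) a b : (wsq a < +oo)%E -> (wsq b < +oo)%E ->
  (wsq (fun i => r * a i + b i)%R < +oo)%E.
Proof.
move=> afin bfin; apply: le_lt_trans (wsqD _ _) _.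
rewrite wsqZ (wsq_fine afin) (wsq_fine bfin) -!EFinM -EFinD; exact: ltry.
Qed.

(** Additivity of the polar form in its first argument, written so that both
    sides are sums of squares and no subtraction of infinite sums occurs;
    [wsq_polarZ] does the same for positive homogeneity. *)
Lemma wsq_polarD a b c :
  (wsq (fun i => a i + b i + c i)%R + wsq (fun i => a i - c i)%R
     + wsq (fun i => b i - c i)%R =
   wsq (fun i => a i + b i - c i)%R + wsq (fun i => a i + c i)%R
     + wsq (fun i => b i + c i)%R)%E.
Proof.
rewrite /wsq -!esumD; try by move=> i _; rewrite -?EFinD lee_fin ?addr_ge0.
by apply: eq_esum => i _; rewrite -!EFinD; congr EFin; ring.
Qed.

Lemma wsq_polarZ (r : R) a b : 0 <= r ->
  (wsq (fun i => r * a i + b i)%R + r%:E * wsq (fun i => a i - b i)%R =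
   wsq (fun i => r * a i - b i)%R + r%:E * wsq (fun i => a i + b i)%R)%E.
Proof.
move=> r0; rewrite /wsq -!esumZ//.
rewrite -!esumD; try by move=> i _; rewrite lee_fin ?(mulr_ge0 r0).
by apply: eq_esum => i _; rewrite -!EFinD; congr EFin; ring.
Qed.

(** Dominated convergence: functions below [a] that are uniformly small have
    small weighted norm, although the weights need not be summable. *)
Lemma wsq_small a (e : R) : (wsq a < +oo)%E -> 0 < e ->
  exists2 d : R, 0 < d & forall b, (forall i, `|b i| <= `|a i|) ->
    (forall i, `|b i| <= d) -> (wsq b <= e%:E)%E.
Proof.
move=> afin e0; have e20 : 0 < e / 2 by rewrite divr_gt0.
have [F finF Fe] := esum_tail (fun i => wterm_ge0 i (a i)) afin e20.
pose W := \sum_(i <- fset_set F) w i.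
have W0 : 0 <= W by rewrite sumr_ge0.
pose d2 := e / 2 / (W + 1).
have d20 : 0 < d2 by rewrite divr_gt0// ltr_wpDl.
exists (Num.sqrt d2); first by rewrite sqrtr_gt0.
move=> b ba bd.
pose b1 i := if i \in F then w i * b i ^+ 2 else 0.
pose b2 i := if i \in F then 0 else w i * b i ^+ 2.
have -> : wsq b = (\esum_(i in [set: T]) (b1 i)%:E + \esum_(i in [set: T]) (b2 i)%:E)%E.
  rewrite -esumD; try by move=> i _; rewrite lee_fin /b1 /b2; case: ifP.
  by apply: eq_esum => i _; rewrite -EFinD /b1 /b2; case: ifP; rewrite (addr0, add0r).
have -> : e = e / 2 + e / 2 by lra.
rewrite EFinD; apply: leeD; last first.
  apply: Fe => [i|i Fi]; rewrite /b2; last by rewrite mem_set.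
  case: ifP => _; first by rewrite lexx wterm_ge0.
  by rewrite wterm_ge0/= ler_wpM2l// ler_norm_sqr.
have -> : \esum_(i in [set: T]) (b1 i)%:E = (\sum_(i \in F) (w i * b i ^+ 2)%:E)%E.
  rewrite -esum_fset//; last by move=> i _; rewrite lee_fin.
  by rewrite [RHS]esum_mkcond; apply: eq_esum => i _; rewrite /b1; case: ifP.
rewrite fsum_EFin_fset// lee_fin.
apply: (@le_trans _ _ (d2 * W)).
  rewrite mulr_sumr; apply: ler_sum => i _; rewrite [leRHS]mulrC ler_wpM2l//.
  by rewrite -(sqr_sqrtr (ltW d20)) ler_norm_sqr// [leRHS]ger0_norm ?sqrtr_ge0.
by rewrite /d2 -mulrA ler_piMr ?(ltW e20)// mulrC ler_pdivrMr ?mul1r ?lerDl ?ltr_wpDl.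
Qed.

End WeightedSquares.

(** * Quadratic forms on spaces of functions *)

Lemma discriminant_le (R : realFieldType) (a b c : R) : 0 <= a -> 0 <= c ->
  (forall t, 0 <= a + 2 * t * b + t ^+ 2 * c) -> b ^+ 2 <= a * c.
Proof.
move=> a0 c0 H; have [c_eq0|c_neq0] := eqVneq c 0.
  have [->|b0] := eqVneq b 0; first by rewrite c_eq0 expr0n mulr0.
  have := H (- (a + 1) / (2 * b)); rewrite c_eq0.
  rewrite [X in 0 <= X -> _](_ : _ = -1); last by field.
  by move=> ?; lra.
have cp : 0 < c by rewrite lt_neqAle eq_sym c_neq0.
have := H (- b / c).
rewrite [X in 0 <= X -> _](_ : _ = (a * c - b ^+ 2) / c); last by field.
by rewrite pmulr_lge0 ?invr_gt0// subr_ge0.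
Qed.

Ltac fext := apply/funext => ? /=; ring.

Section QuadraticForms.
Context {R : realType} {X : countType}.
Implicit Types (V : set (X -> R)) (q : (X -> R) -> R) (f g h : X -> R).

(** A nonnegative quadratic form [q] on a linear space [V] of functions.  The
    last two axioms are additivity and positive homogeneity of [polar q]; an
    infinite sum of squares satisfies them termwise. *)
Record quadform V q : Prop := QuadForm {
  qf_lin : forall (r : R) f g, V f -> V g -> V (fun x => r * f x + g x);
  qf_ge0 : forall f, V f -> 0 <= q f;
  qf_scale : forall (r : R) f, V f -> q (fun x => r * f x) = r ^+ 2 * q f;
  qf_polarD : forall f g h, V f -> V g -> V h ->
    q (f \+ g \+ h) + q (f \- h) + q (g \- h) =
    q (f \+ g \- h) + q (f \+ h) + q (g \+ h);
  qf_polarZ : forall (r : R) f g, 0 <= r -> V f -> V g ->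
    q (fun x => r * f x + g x) + r * q (f \- g) =
    q (fun x => r * f x - g x) + r * q (f \+ g) }.

Definition qnorm q f := Num.sqrt (q f).

Definition qcomplete V q := forall u : nat -> X -> R, (forall n, V (u n)) ->
  (forall e : R, 0 < e -> exists N, forall n k, (N <= n)%N -> (N <= k)%N ->
     q (u n \- u k) <= e) ->
  exists2 v, V v & forall e : R, 0 < e -> exists N, forall n, (N <= n)%N ->
    q (u n \- v) <= e.

Lemma quadform_sub V V' q : quadform V q -> V' `<=` V ->
  (forall (r : R) f g, V' f -> V' g -> V' (fun x => r * f x + g x)) ->
  quadform V' q.
Proof.
by case=> ? q0 qs qD qZ sub lin; split=> // *; [apply: q0|apply: qs|apply: qD|apply: qZ]; auto.
Qed.

Lemma quadform_comb V q q' (s : R) : 0 <= s -> quadform V q -> quadform V q' ->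
  quadform V (fun f => s * q f + q' f).
Proof.
move=> s0 Q Q'; split.
- exact: (qf_lin Q).
- by move=> f Vf; rewrite addr_ge0 ?mulr_ge0 ?(qf_ge0 Q) ?(qf_ge0 Q').
- by move=> r f Vf; rewrite (qf_scale Q)// (qf_scale Q')//; ring.
- move=> f g h Vf Vg Vh; have := qf_polarD Q Vf Vg Vh.
  have := qf_polarD Q' Vf Vg Vh; move=> e1 e2.
  rewrite [LHS](_ : _ = s * (q (f \+ g \+ h) + q (f \- h) + q (g \- h)) +
    (q' (f \+ g \+ h) + q' (f \- h) + q' (g \- h))); last by ring.
  by rewrite e1 e2; ring.
- move=> r f g r0 Vf Vg; have := qf_polarZ Q r0 Vf Vg.
  have := qf_polarZ Q' r0 Vf Vg; move=> e1 e2.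
  rewrite [LHS](_ : _ = s * (q (fun x => r * f x + g x) + r * q (f \- g)) +
    (q' (fun x => r * f x + g x) + r * q' (f \- g))); last by ring.
  by rewrite e1 e2; ring.
Qed.

Lemma polar_comb q q' (s : R) f g :
  polar (fun f => s * q f + q' f) f g = s * polar q f g + polar q' f g.
Proof. by rewrite /polar; field. Qed.

Context V q (Q : quadform V q).

Lemma qfD f g : V f -> V g -> V (f \+ g).
Proof.
move=> Vf Vg; have -> : f \+ g = (fun x => 1 * f x + g x) by fext.
exact: (qf_lin Q).
Qed.

Lemma qfB f g : V f -> V g -> V (f \- g).
Proof.
move=> Vf Vg; have -> : f \- g = (fun x => (-1) * g x + f x) by fext.
exact: (qf_lin Q).
Qed.

Lemma qfZ (r : R) f : V f -> V (fun x => r * f x).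
Proof.
move=> Vf; have -> : (fun x => r * f x) = (fun x => (r - 1) * f x + f x) by fext.
exact: (qf_lin Q).
Qed.

Lemma qf0 f : V f -> q (fun=> 0) = 0.
Proof.
move=> Vf; have -> : (fun=> 0) = (fun x => 0 * f x) by fext.
by rewrite (qf_scale Q)// expr0n mul0r.
Qed.

Lemma qfN f g : V f -> V g -> q (f \- g) = q (g \- f).
Proof.
move=> Vf Vg; have -> : f \- g = (fun x => (-1) * (g \- f) x) by fext.
by rewrite (qf_scale Q) ?sqrrN ?expr1n ?mul1r//; exact: qfB.
Qed.

Lemma polarC f g : V f -> V g -> polar q f g = polar q g f.
Proof.
move=> Vf Vg; rewrite /polar qfN//; congr ((q _ - _) / _); fext.
Qed.

Lemma polarxx f : V f -> polar q f f = q f.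
Proof.
move=> Vf; rewrite /polar.
have -> : f \+ f = (fun x => 2 * f x) by fext.
have -> : f \- f = (fun=> 0) by fext.
by rewrite (qf0 Vf) (qf_scale Q)//; field.
Qed.

Lemma polar_linl (r : R) f g h : V f -> V g -> V h ->
  polar q (fun x => r * f x + g x) h = r * polar q f h + polar q g h.
Proof.
have posZ (s : R) k : 0 <= s -> V k -> V h ->
    polar q (fun x => s * k x) h = s * polar q k h.
  move=> s0 Vk Vh; rewrite /polar.
  have := qf_polarZ Q s0 Vk Vh.
  have -> : (fun x => s * k x) \+ h = (fun x => s * k x + h x) by [].
  have -> : (fun x => s * k x) \- h = (fun x => s * k x - h x) by [].
  lra.
have Z (s : R) k : V k -> V h -> polar q (fun x => s * k x) h = s * polar q k h.
  move=> Vk Vh; have [s0|/ltW s0] := leP 0 s; first exact: posZ.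
  rewrite -[in RHS](opprK s) mulNr -posZ ?oppr_ge0//.
  have sk := qfZ (- s) Vk.
  rewrite /polar.
  have -> : (fun x => s * k x) \+ h = h \- (fun x => - s * k x) by fext.
  have -> : (fun x => s * k x) \- h =
    (fun x => (-1) * ((fun x => - s * k x) \+ h) x) by fext.
  rewrite (qf_scale Q) ?sqrrN ?expr1n; last exact: qfD.
  by rewrite (qfN Vh sk); ring.
move=> Vf Vg Vh; have rf := qfZ r Vf.
rewrite -Z//; have := qf_polarD Q rf Vg Vh; rewrite /polar.
have -> : (fun x => r * f x + g x) \+ h = (fun x => r * f x) \+ g \+ h by [].
have -> : (fun x => r * f x + g x) \- h = (fun x => r * f x) \+ g \- h by [].
lra.
Qed.

Lemma polar_linr (r : R) f g h : V f -> V g -> V h ->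
  polar q h (fun x => r * f x + g x) = r * polar q h f + polar q h g.
Proof.
move=> Vf Vg Vh; rewrite polarC//; last exact: (qf_lin Q).
by rewrite polar_linl// [polar q h f]polarC// [polar q h g]polarC.
Qed.

Lemma polarBl f g h : V f -> V g -> V h ->
  polar q (f \- g) h = polar q f h - polar q g h.
Proof.
move=> Vf Vg Vh; have -> : f \- g = (fun x => (-1) * g x + f x) by fext.
by rewrite polar_linl//; ring.
Qed.

Lemma polarBr f g h : V f -> V g -> V h ->
  polar q h (f \- g) = polar q h f - polar q h g.
Proof.
by move=> Vf Vg Vh; rewrite polarC ?polarBl//; [rewrite polarC// (polarC Vg)|exact: qfB].
Qed.

Lemma polarZl (r : R) f h : V f -> V h ->
  polar q (fun x => r * f x) h = r * polar q f h.
Proof.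
move=> Vf Vh; have -> : (fun x => r * f x) = (fun x => (r - 1) * f x + f x) by fext.
by rewrite polar_linl//; ring.
Qed.

Lemma qf_expand (t : R) f h : V f -> V h ->
  q (fun x => t * h x + f x) = q f + 2 * t * polar q f h + t ^+ 2 * q h.
Proof.
move=> Vf Vh; have Vth : V (fun x => t * h x + f x) by exact: (qf_lin Q).
rewrite -[LHS]polarxx// polar_linl// polar_linr// polar_linr//.
by rewrite !polarxx// (polarC Vh Vf); ring.
Qed.

Lemma qf_expandB f h : V f -> V h -> q (f \- h) = q f - 2 * polar q f h + q h.
Proof.
move=> Vf Vh; have -> : f \- h = (fun x => (-1) * h x + f x) by fext.
by rewrite qf_expand//; ring.
Qed.

Lemma polar_cs f h : V f -> V h -> polar q f h ^+ 2 <= q f * q h.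
Proof.
move=> Vf Vh; apply: discriminant_le; rewrite ?(qf_ge0 Q)// => t.
by rewrite -qf_expand//; apply: (qf_ge0 Q); exact: (qf_lin Q).
Qed.

Lemma qnorm_ge0 f : 0 <= qnorm q f.
Proof. exact: sqrtr_ge0. Qed.

Lemma sqr_qnorm f : V f -> qnorm q f ^+ 2 = q f.
Proof. by move=> Vf; rewrite sqr_sqrtr// (qf_ge0 Q). Qed.

Lemma polar_le_qnorm f h : V f -> V h -> `|polar q f h| <= qnorm q f * qnorm q h.
Proof.
move=> Vf Vh; rewrite -ler_sqr ?nnegrE ?mulr_ge0 ?qnorm_ge0//.
by rewrite exprMn !sqr_qnorm// real_normK ?num_real// polar_cs.
Qed.

Lemma qnormD f g : V f -> V g -> qnorm q (f \+ g) <= qnorm q f + qnorm q g.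
Proof.
move=> Vf Vg; rewrite -ler_sqr ?nnegrE ?addr_ge0 ?qnorm_ge0//.
rewrite sqrrD !sqr_qnorm//; last exact: qfD.
have -> : f \+ g = (fun x => 1 * g x + f x) by fext.
rewrite qf_expand//; have := polar_le_qnorm Vf Vg.
by move=> /(le_trans (ler_norm _)); rewrite -mulr_natr; lra.
Qed.

Lemma qnormZ (r : R) f : V f -> qnorm q (fun x => r * f x) = `|r| * qnorm q f.
Proof.
by move=> Vf; rewrite /qnorm (qf_scale Q)// sqrtrM ?sqr_ge0// sqrtr_sqr.
Qed.

Lemma qnormBC f g : V f -> V g -> qnorm q (f \- g) = qnorm q (g \- f).
Proof. by move=> Vf Vg; rewrite /qnorm qfN. Qed.

Lemma qnormB f g h : V f -> V g -> V h ->
  qnorm q (f \- h) <= qnorm q (f \- g) + qnorm q (g \- h).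
Proof.
move=> Vf Vg Vh; have -> : f \- h = (f \- g) \+ (g \- h) by fext.
by apply: qnormD; exact: qfB.
Qed.

Lemma qnorm_leD f g : V f -> V g -> qnorm q f <= qnorm q g + qnorm q (f \- g).
Proof.
move=> Vf Vg; have {1}-> : f = g \+ (f \- g) by fext.
by apply: qnormD => //; exact: qfB.
Qed.

(** The representing vector minimizes [q u - 2 * l u].  A vector that misses
    the infimum by [d] represents [l] up to an error [Num.sqrt (d * q h)] at
    [h]; this gives both the Cauchy property of a minimizing sequence and the
    representation by its limit. *)
Lemma riesz_representation (l : (X -> R) -> R) (C : R) f0 :
  V f0 -> qcomplete V q ->
  (forall (r : R) f g, V f -> V g -> l (fun x => r * f x + g x) = r * l f + l g) ->
  0 <= C -> (forall h, V h -> l h ^+ 2 <= C * q h) ->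
  exists2 u, V u & forall h, V h -> polar q u h = l h.
Proof.
move=> Vf0 comp llin C0 lC.
pose J u := q u - 2 * l u.
have JC u : V u -> - C <= J u.
  move=> Vu; have := lC _ Vu; have := qf_ge0 Q Vu; rewrite /J => q0 lq.
  rewrite leNgt; apply/negP => ?.
  have h1 : 0 < 2 * l u - (q u + C) by lra.
  have h2 : 0 < 2 * l u + (q u + C) by lra.
  have := mulr_gt0 h1 h2; have := sqr_ge0 (q u - C); nra.
pose E := [set J u | u in V].
have Einf : has_inf E.
  split; first by exists (J f0); exists f0.
  by exists (- C) => _ [u Vu <-]; exact: JC.
have infJ u : V u -> inf E <= J u by move=> Vu; apply: ge_inf; [case: Einf|exists u].
have near_min (d : R) u h : 0 <= d -> V u -> J u <= inf E + d -> V h ->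
    (polar q u h - l h) ^+ 2 <= d * q h.
  move=> d0 Vu Ju Vh; apply: discriminant_le; rewrite ?(qf_ge0 Q)// => t.
  have := infJ _ (qf_lin Q t Vh Vu); rewrite /J qf_expand// llin//.
  move: Ju; rewrite /J; lra.
have ex n : exists u, V u /\ J u <= inf E + n.+1%:R^-1.
  have n0 : (0 : R) < n.+1%:R^-1 by rewrite invr_gt0.
  have [_ [u Vu <-] Ju] := inf_adherent n0 Einf.
  by exists u; split=> //; exact: ltW.
pose u n := sval (cid (ex n)).
have Vu n : V (u n) by rewrite /u; case: cid => ? [].
have Ju n : J (u n) <= inf E + n.+1%:R^-1 by rewrite /u; case: cid => ? [].
have small (e : R) : 0 < e -> exists N, forall n, (N <= n)%N -> n.+1%:R^-1 <= e.
  move=> e0; have [N _ HN] := near_infty_natSinv_lt (PosNum e0).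
  by exists N => n Nn; apply/ltW/HN.
have [//|v Vv vu] := comp u Vu.
  move=> e e0; have e4 : 0 < e / 4 by rewrite divr_gt0.
  have [N HN] := small _ e4; exists N => n k Nn Nk.
  set h := u n \- u k; have Vh : V h by exact: qfB.
  have n0 j : (0 : R) <= j.+1%:R^-1 by rewrite invr_ge0.
  have q0 := qf_ge0 Q Vh.
  have A := near_min _ _ _ (n0 n) (Vu n) (Ju n) Vh.
  have B := near_min _ _ _ (n0 k) (Vu k) (Ju k) Vh.
  have qh : q h = (polar q (u n) h - l h) - (polar q (u k) h - l h).
    by rewrite -polarxx// {1}/h polarBl//; ring.
  set a := polar q (u n) h - l h in A qh; set b := polar q (u k) h - l h in B qh.
  have {}A := le_trans A (ler_wpM2r q0 (HN _ Nn)).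
  have {}B := le_trans B (ler_wpM2r q0 (HN _ Nk)).
  have ab : (a - b) ^+ 2 + (a + b) ^+ 2 = 2 * a ^+ 2 + 2 * b ^+ 2 by ring.
  have : q h ^+ 2 <= e * q h.
    rewrite {1}qh; have := sqr_ge0 (a + b); lra.
  have [->|qn0] := eqVneq (q h) 0; first by rewrite (ltW e0).
  by rewrite expr2 ler_pM2r// lt_neqAle eq_sym qn0.
exists v => // h Vh.
apply/eqP; rewrite -subr_eq0 -sqrf_eq0 eq_le sqr_ge0 andbT.
apply/ler_addgt0Pr => e e0; rewrite add0r.
have q0 := qf_ge0 Q Vh.
pose d := e / 4 / (q h + 1).
have d0 : 0 < d by rewrite !divr_gt0// ltr_wpDl.
have dq : d * q h <= e / 4.
  rewrite /d -mulrA ler_piMr ?divr_ge0 ?(ltW e0)//.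
  by rewrite mulrC ler_pdivrMr ?mul1r ?lerDl ?ltr_wpDl.
have [N1 HN1] := small _ d0; have [N2 HN2] := vu _ d0.
set n := maxn N1 N2.
have A : (polar q (u n) h - l h) ^+ 2 <= d * q h.
  apply: near_min => //; first exact: ltW.
  by apply: le_trans (Ju n) _; rewrite lerD2l HN1// leq_maxl.
have B : polar q (u n \- v) h ^+ 2 <= d * q h.
  apply: le_trans (polar_cs _ Vh) _; first exact: qfB.
  by rewrite ler_wpM2r// HN2// leq_maxr.
rewrite polarBl// in B.
set a := polar q (u n) h - l h in A.
have -> : polar q v h - l h = a - (polar q (u n) h - polar q v h) by rewrite /a; ring.
by have := sqr_ge0 (a + (polar q (u n) h - polar q v h)); nra.
Qed.

End QuadraticForms.

(*BEGIN*)
(** * Weighted l^2 spaces *)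

Section Limits.
Context {R : realType}.
Implicit Types (u : nat -> R) (l : R).

Lemma cvg_eps u l : u @ \oo --> l <->
  forall e : R, 0 < e -> exists N, forall n, (N <= n)%N -> `|u n - l| <= e.
Proof.
split=> [ul e e0|H].
  by move/cvgrPdistC_le : ul => /(_ _ e0)[N _ HN]; exists N => n Nn; exact: HN.
apply/cvgrPdistC_le => e e0; have [N HN] := H e e0.
by exists N => // n; exact: HN.
Qed.

Lemma cauchy_eps u :
  (forall e : R, 0 < e -> exists N, forall n k, (N <= n)%N -> (N <= k)%N ->
    `|u n - u k| <= e) -> exists l, u @ \oo --> l.
Proof.
move=> H; apply/cvg_ex; apply/cauchy_cvgP/cauchy_ballP => e e0.
have e2 : 0 < e / 2 by rewrite divr_gt0.
have [N HN] := H _ e2.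
pose S : set R := [set u n | n in [set n | (N <= n)%N]].
exists (S, S); first by split; exists N => // n Nn; exists n.
move=> [_ _] [/= [n Nn <-] [k Nk <-]]; rewrite /ball /= (le_lt_trans (HN _ _ Nn Nk))//.
by rewrite ltr_pdivrMr// ltr_pMr// ltr1n.
Qed.

End Limits.

Lemma quadform_eq (R : realType) (X : countType) (V : set (X -> R)) q q' :
  (forall f, V f -> q' f = q f) -> quadform V q -> quadform V q'.
Proof.
move=> e Q; split.
- exact: (qf_lin Q).
- by move=> f Vf; rewrite e// (qf_ge0 Q).
- by move=> r f Vf; rewrite !e ?(qf_scale Q)//; exact: (qfZ Q).
- move=> f g h Vf Vg Vh; have Vfg := qfD Q Vf Vg.
  rewrite (e _ (qfD Q Vfg Vh)) (e _ (qfB Q Vfg Vh)) (e _ (qfB Q Vf Vh)).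
  rewrite (e _ (qfD Q Vf Vh)) (e _ (qfB Q Vg Vh)) (e _ (qfD Q Vg Vh)).
  exact: (qf_polarD Q).
- move=> r f g r0 Vf Vg; have Vrf := qfZ Q r Vf.
  rewrite (e _ (qfD Q Vrf Vg)) (e _ (qfB Q Vrf Vg)) (e _ (qfB Q Vf Vg)).
  rewrite (e _ (qfD Q Vf Vg)); exact: (qf_polarZ Q).
Qed.

Section WeightedForm.
Context {R : realType} {X : countType} {T : choiceType} (w : T -> R)
  (phi : (X -> R) -> T -> R).
Hypothesis w_ge0 : forall i, 0 <= w i.
Hypothesis phi_lin : forall (r : R) f g,
  phi (fun x => r * f x + g x) = (fun i => r * phi f i + phi g i).

Definition wform f := fine (wsq w (phi f)).
Definition wdom : set (X -> R) := [set f | (wsq w (phi f) < +oo)%E].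

Lemma phiZ (r : R) f : phi (fun x => r * f x) = (fun i => r * phi f i).
Proof.
have -> : (fun x => r * f x) = (fun x => (r - 1) * f x + f x) by fext.
by rewrite phi_lin; fext.
Qed.

Lemma phiD f g : phi (f \+ g) = (fun i => phi f i + phi g i).
Proof.
have -> : f \+ g = (fun x => 1 * f x + g x) by fext.
by rewrite phi_lin; fext.
Qed.

Lemma phiB f g : phi (f \- g) = (fun i => phi f i - phi g i).
Proof.
have -> : f \- g = (fun x => (-1) * g x + f x) by fext.
by rewrite phi_lin; fext.
Qed.

Lemma wform_quadform : quadform wdom wform.
Proof.
have lin (r : R) f g : wdom f -> wdom g -> wdom (fun x => r * f x + g x).
  by move=> ? ?; rewrite /wdom /= phi_lin; exact: wsq_lin_fin.
have D f g : wdom f -> wdom g -> wdom (f \+ g).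
  by move=> ? ?; rewrite (_ : f \+ g = (fun x => 1 * f x + g x)); [exact: lin|fext].
have B f g : wdom f -> wdom g -> wdom (f \- g).
  by move=> ? ?; rewrite (_ : f \- g = (fun x => (-1) * g x + f x)); [exact: lin|fext].
have Z (r : R) f : wdom f -> wdom (fun x => r * f x).
  move=> Vf; have -> : (fun x => r * f x) = (fun x => (r - 1) * f x + f x) by fext.
  exact: lin.
have fin f : wdom f -> wsq w (phi f) = (wform f)%:E by exact: wsq_fine.
split=> //.
- by move=> f _; rewrite fine_ge0// wsq_ge0.
- by move=> r f Vf; rewrite /wform phiZ wsqZ// (fin _ Vf).
- move=> f g h Vf Vg Vh; apply: EFin_inj; rewrite !EFinD -!fin; try by auto.
  by rewrite !(phiD, phiB); exact: wsq_polarD.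
- move=> r f g r0 Vf Vg; apply: EFin_inj.
  have Vrg : wdom (fun x => r * f x - g x).
    by apply: (B (fun x => r * f x)) => //; exact: Z.
  rewrite !EFinD !EFinM -!fin; try by auto.
  have -> : (fun x => r * f x - g x) = (fun x => r * f x) \- g by [].
  by rewrite phi_lin !(phiD, phiB) phiZ; exact: wsq_polarZ.
Qed.

Lemma wform_lsc (u : nat -> X -> R) v (C : R) :
  (forall i, (fun n => phi (u n) i) @ \oo --> phi v i) ->
  (exists N, forall n, (N <= n)%N -> wdom (u n) /\ wform (u n) <= C) ->
  wdom v /\ wform v <= C.
Proof.
move=> uv [N H]; have vC : (wsq w (phi v) <= C%:E)%E.
  apply: esum_fatou (fun n i => w i * phi (u n) i ^+ 2) _ _ _ _.
    by move=> i; apply: cvgM; [exact: cvg_cst|rewrite expr2; apply: cvgM; exact: uv].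
  exists N => n /H[un uC]; rewrite -/(wsq w (phi (u n))).
  by rewrite (wsq_fine w_ge0 un) lee_fin.
have vfin : wdom v by rewrite /wdom /= (le_lt_trans vC)// ltry.
by split=> //; rewrite -lee_fin -wsq_fine.
Qed.

End WeightedForm.

Lemma Cc0 (R : realType) (X : countType) : @Cc R X (fun=> 0).
Proof.
rewrite /Cc /= (_ : [set x | _] = set0)//.
by apply/seteqP; split=> x //=; rewrite eqxx.
Qed.

Section Ell2.
Context {R : realType} {X : countType} (m : X -> R).
Hypothesis m_gt0 : forall x, 0 < m x.
Implicit Types (f g h : X -> R).

Let m_ge0 x : 0 <= m x. Proof. exact: ltW. Qed.

Lemma sqnorm_erealE f : sqnorm_ereal m f = wsq m f.
Proof. by apply: eq_esum => x _; rewrite mulrC. Qed.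

Lemma ell2E : ell2 m = wdom m id.
Proof. by apply/seteqP; split=> f; rewrite /ell2 /wdom /= sqnorm_erealE. Qed.

Lemma sqnormE : sqnorm m = wform m id.
Proof. by apply/funext => f; rewrite /sqnorm sqnorm_erealE. Qed.

Lemma sqnorm_quadform : quadform (ell2 m) (sqnorm m).
Proof. by rewrite ell2E sqnormE; exact: wform_quadform. Qed.

Lemma ell2_le f g : (forall x, `|f x| <= `|g x|) -> ell2 m g -> ell2 m f.
Proof.
by move=> fg; rewrite /ell2 /= !sqnorm_erealE; apply: le_lt_trans; exact: le_wsq.
Qed.

Lemma ell2norm_le f g : (forall x, `|f x| <= `|g x|) -> ell2 m g ->
  ell2norm m f <= ell2norm m g.
Proof.
move=> fg Vg; have Vf := ell2_le fg Vg; apply: ler_wsqrtr.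
rewrite -lee_fin /sqnorm; move: Vf Vg; rewrite /ell2 /= !sqnorm_erealE => Vf Vg.
by rewrite -!wsq_fine//; exact: le_wsq.
Qed.

Lemma sqnorm_lsc (u : nat -> X -> R) v (C : R) :
  (forall x, (fun n => u n x) @ \oo --> v x) ->
  (exists N, forall n, (N <= n)%N -> ell2 m (u n) /\ sqnorm m (u n) <= C) ->
  ell2 m v /\ sqnorm m v <= C.
Proof. by rewrite ell2E sqnormE; exact: wform_lsc. Qed.

Lemma point_le_sqnorm f x : ell2 m f -> m x * f x ^+ 2 <= sqnorm m f.
Proof.
move=> Vf; rewrite -lee_fin; rewrite /sqnorm sqnorm_erealE -wsq_fine//; last first.
  by rewrite -sqnorm_erealE.
apply: esum_ge; exists [set x]; first by split=> //; exact: finite_set1.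
by rewrite fsbig_set1.
Qed.

Lemma sqnorm_eq0 f : ell2 m f -> sqnorm m f = 0 -> f = (fun=> 0).
Proof.
move=> Vf f0; apply/funext => x; have := point_le_sqnorm x Vf.
rewrite f0 pmulr_rle0// => ?; apply/eqP; rewrite -sqrf_eq0 eq_le sqr_ge0 andbT//.
Qed.

Lemma sqnorm_cauchy_pointwise (u : nat -> X -> R) :
  (forall n, ell2 m (u n)) ->
  (forall e : R, 0 < e -> exists N, forall n k, (N <= n)%N -> (N <= k)%N ->
     sqnorm m (u n \- u k) <= e) ->
  exists v : X -> R, forall x, (fun n => u n x) @ \oo --> v x.
Proof.
move=> Vu uc; suff H x : exists l : R, (fun n => u n x : R) @ \oo --> l.
  by exists (fun x => sval (cid (H x))) => x; case: cid.
apply: cauchy_eps => e e0.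
have me : 0 < m x * e ^+ 2 by rewrite mulr_gt0// exprn_gt0.
have [N HN] := uc _ me; exists N => n k Nn Nk.
rewrite -ler_sqr ?nnegrE ?(ltW e0)// real_normK ?num_real//.
rewrite -(ler_pM2l (m_gt0 x)); apply: le_trans (HN _ _ Nn Nk).
by apply: (point_le_sqnorm x); exact: (qfB sqnorm_quadform).
Qed.

Lemma ell2_complete : qcomplete (ell2 m) (sqnorm m).
Proof.
move=> u Vu uc; have [v uv] := sqnorm_cauchy_pointwise Vu uc.
have lim (e : R) : 0 < e -> exists N, forall n, (N <= n)%N ->
    ell2 m (u n \- v) /\ sqnorm m (u n \- v) <= e.
  move=> e0; have [N HN] := uc e e0; exists N => n Nn.
  apply: (@sqnorm_lsc (fun k => u n \- u k)).
    by move=> x; apply: cvgB; [exact: cvg_cst|exact: uv].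
  by exists N => k Nk; split; [exact: (qfB sqnorm_quadform)|exact: HN].
exists v; last by move=> e /lim[N HN]; exists N => n /HN[].
have [N /(_ N (leqnn N))[? _]] := lim 1 ltr01.
have -> : v = u N \- (u N \- v) by fext.
exact: (qfB sqnorm_quadform).
Qed.

Lemma esum_finsupp (a : X -> R) : (forall x, 0 <= a x) ->
  finite_set [set x | a x != 0] -> (\esum_(x in [set: X]) (a x)%:E < +oo)%E.
Proof.
move=> a0 fa; rewrite (_ : \esum_(x in [set: X]) _ =
    \esum_(x in [set x | a x != 0]) (a x)%:E); last first.
  rewrite [RHS]esum_mkcond; apply: eq_esum => x _; case: ifPn => //.
  by rewrite notin_setE /= => /negP; rewrite negbK => /eqP ->.
by rewrite esum_fset ?fsum_EFin_fset ?ltry// => x _; rewrite lee_fin.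
Qed.

Lemma Cc_ell2 f : Cc f -> ell2 m f.
Proof.
move=> Cf; rewrite /ell2 /=; apply: esum_finsupp => [x|].
  by rewrite mulr_ge0// sqr_ge0.
apply: sub_finite_set Cf => x /=; apply: contra_neq => ->.
by rewrite expr0n mul0r.
Qed.

Lemma ell2_cutoff f (e : R) : ell2 m f -> 0 < e ->
  exists2 F : set X, finite_set F &
    forall g, (forall x, `|g x| <= `|f x|) -> (forall x, F x -> g x = 0) ->
      sqnorm m g <= e.
Proof.
move=> Vf e0; have Wf : wdom m id f by rewrite -ell2E.
have [F finF H] := esum_tail (fun x => wterm_ge0 m_ge0 x (f x)) Wf e0.
exists F => // g gf gF; have Vg := ell2_le gf Vf.
rewrite -lee_fin /sqnorm sqnorm_erealE -wsq_fine//; last by rewrite -sqnorm_erealE.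
apply: H => [x|x /gF ->]; last by rewrite expr0n mulr0.
by rewrite wterm_ge0//= ler_wpM2l// ler_norm_sqr.
Qed.

Lemma Cc_dense f (e : R) : ell2 m f -> 0 < e ->
  exists2 g, Cc g & ell2norm m (f \- g) <= e.
Proof.
move=> Vf e0; have e20 : 0 < e ^+ 2 by rewrite exprn_gt0.
have [F finF H] := ell2_cutoff Vf e20.
exists (patch (fun=> 0) F f).
  apply: sub_finite_set finF => x /=; rewrite patchE; case: ifPn; rewrite ?inE//.
  by rewrite eqxx.
rewrite -(ger0_norm (ltW e0)) -sqrtr_sqr ler_sqrt ?sqr_ge0//.
apply: H => x /=; rewrite patchE.
  by case: ifPn => _; rewrite ?subrr ?normr0 ?subr0.
by move=> Fx; rewrite mem_set// subrr.
Qed.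

End Ell2.

(** * The energy form *)

Section Energy.
Context {R : realType} {X : countType} (G : graph R X) (m : X -> R).
Hypothesis m_gt0 : forall x, 0 < m x.
Implicit Types (f g h : X -> R).

(** Indexing by edges and vertices together makes the energy a single weighted
    sum of squares, which then has bilinearity, Fatou's lemma and dominated
    convergence at once. *)
Definition energy_weight (i : (X * X) + X) : R :=
  match i with inl p => 2^-1 * edge G p.1 p.2 | inr x => killing G x end.

Definition energy_vec f (i : (X * X) + X) : R :=
  match i with inl p => f p.1 - f p.2 | inr x => f x end.

Lemma energy_weight_ge0 i : 0 <= energy_weight i.
Proof.
by case: i => [p|x] /=; [rewrite mulr_ge0 ?invr_ge0 ?edge_ge0|exact: killing_ge0].
Qed.

Lemma energy_vec_lin (r : R) f g :
  energy_vec (fun x => r * f x + g x) =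
  (fun i => r * energy_vec f i + energy_vec g i).
Proof. by apply/funext => -[p|x] //=; ring. Qed.

Lemma energy_wsq f : wsq energy_weight (energy_vec f) =
  ((2^-1)%:E * edge_energy G f + killing_energy G f)%E.
Proof.
have e0 (p : X * X) : 0 <= edge G p.1 p.2 * (f p.1 - f p.2) ^+ 2.
  by rewrite mulr_ge0 ?edge_ge0 ?sqr_ge0.
rewrite /wsq (esumID (inl @` setT)); last first.
  by move=> i _; rewrite lee_fin wterm_ge0//; exact: energy_weight_ge0.
congr (_ + _)%E.
  rewrite setTI esum_image; last by move=> p q _ _ [].
  rewrite -esumZ ?invr_ge0//; apply: eq_esum => p _.
  by rewrite /= mulrA.
rewrite setTI (_ : ~` _ = inr @` setT); last first.
  apply/seteqP; split => [[p|x] /= H|_ [x _ <-] /= [p _]//].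
    by exfalso; apply: H; exists p.
  by exists x.
by rewrite esum_image//; move=> p q _ _ [].
Qed.

Lemma edge_energy_ge0 f : (0 <= edge_energy G f)%E.
Proof.
by apply: esum_ge0 => p _; rewrite lee_fin mulr_ge0 ?edge_ge0 ?sqr_ge0.
Qed.

Lemma killing_energy_ge0 f : (0 <= killing_energy G f)%E.
Proof.
by apply: esum_ge0 => p _; rewrite lee_fin mulr_ge0 ?killing_ge0 ?sqr_ge0.
Qed.

Lemma finite_energyE : finite_energy G = wdom energy_weight energy_vec.
Proof.
have hoo : ((2^-1)%:E * +oo = +oo :> \bar R)%E.
  by rewrite gt0_muley// lte_fin invr_gt0.
apply/seteqP; split=> f; rewrite /finite_energy /wdom /= energy_wsq;
  move: (edge_energy_ge0 f) (killing_energy_ge0 f);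
  case: (edge_energy G f) (killing_energy G f) => [a||] [b||] //= _ _;
  by rewrite ?hoo // -?EFinM -?EFinD ?ltry.
Qed.

Lemma energyE f : finite_energy G f -> energy G f = wform energy_weight energy_vec f.
Proof.
rewrite /energy /wform energy_wsq /finite_energy /=.
move: (edge_energy_ge0 f) (killing_energy_ge0 f).
by case: (edge_energy G f) (killing_energy G f) => [a||] [b||] //=.
Qed.

Lemma energy_quadform : quadform (finite_energy G) (energy G).
Proof.
apply: quadform_eq energyE _; rewrite finite_energyE; apply: wform_quadform.
  exact: energy_weight_ge0.
exact: energy_vec_lin.
Qed.

Lemma energy_lsc (u : nat -> X -> R) v (C : R) :
  (forall x, (fun n => u n x) @ \oo --> v x) ->
  (exists N, forall n, (N <= n)%N -> finite_energy G (u n) /\ energy G (u n) <= C) ->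
  finite_energy G v /\ energy G v <= C.
Proof.
move=> uv [N H]; have [] : wdom energy_weight energy_vec v /\
    wform energy_weight energy_vec v <= C.
  apply: (@wform_lsc _ _ _ _ _ energy_weight_ge0 u).
    by case=> [p|x] /=; [apply: cvgB; exact: uv|exact: uv].
  by exists N => n /H[fu uC]; rewrite -finite_energyE -energyE.
by rewrite -finite_energyE => fv; rewrite energyE.
Qed.

Lemma domN_lin (r : R) f g : domN G m f -> domN G m g ->
  domN G m (fun x => r * f x + g x).
Proof.
move=> [ef lf] [eg lg]; split; first exact: (qf_lin energy_quadform).
exact: (qf_lin (sqnorm_quadform m_gt0)).
Qed.

Lemma domN_energy_quadform : quadform (domN G m) (energy G).
Proof.
by apply: quadform_sub energy_quadform _ _ => [f []//|]; exact: domN_lin.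
Qed.

Lemma domN_sqnorm_quadform : quadform (domN G m) (sqnorm m).
Proof.
by apply: quadform_sub (sqnorm_quadform m_gt0) _ _ => [f []//|]; exact: domN_lin.
Qed.

Definition scaled_form (s : R) f : R := s * energy G f + sqnorm m f.

Lemma scaled_form_quadform (s : R) : 0 <= s ->
  quadform (domN G m) (scaled_form s).
Proof.
move=> s0; apply: quadform_comb => //.
  exact: domN_energy_quadform.
exact: domN_sqnorm_quadform.
Qed.

(** A form-Cauchy sequence converges pointwise, and by lower semicontinuity of
    both parts of the form its pointwise limit is a limit in the form norm. *)
Lemma domN_complete (s : R) : 0 < s -> qcomplete (domN G m) (scaled_form s).
Proof.
move=> s0 u Vu uc; have QE := domN_energy_quadform; have QS := domN_sqnorm_quadform.
have Vu2 n : ell2 m (u n) by case: (Vu n).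
have Vuu n k : domN G m (u n \- u k) by exact: (qfB QE).
have ucS (e : R) : 0 < e -> exists N, forall n k, (N <= n)%N -> (N <= k)%N ->
    sqnorm m (u n \- u k) <= e.
  move=> /uc[N HN]; exists N => n k Nn Nk; apply: le_trans (HN _ _ Nn Nk).
  by rewrite lerDr mulr_ge0 ?(ltW s0)// (qf_ge0 QE).
have [v uv] := sqnorm_cauchy_pointwise m_gt0 Vu2 ucS.
have lim (e : R) : 0 < e -> exists N, forall n, (N <= n)%N ->
    domN G m (u n \- v) /\ scaled_form s (u n \- v) <= e.
  move=> e0; have e20 : 0 < e / 2 by rewrite divr_gt0.
  have [N HN] := uc _ e20; exists N => n Nn.
  have pw x : (fun k => (u n \- u k) x) @ \oo --> (u n \- v) x.
    by apply: cvgB; [exact: cvg_cst|exact: uv].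
  have [Ev1 Ev2] : finite_energy G (u n \- v) /\ energy G (u n \- v) <= e / 2 / s.
    apply: (@energy_lsc (fun k => u n \- u k)) => //; exists N => k Nk.
    split; first by case: (Vuu n k).
    rewrite ler_pdivlMr// mulrC; apply: le_trans (HN _ _ Nn Nk).
    by rewrite lerDl (qf_ge0 QS).
  have [Sv1 Sv2] : ell2 m (u n \- v) /\ sqnorm m (u n \- v) <= e / 2.
    apply: (sqnorm_lsc m_gt0 (u := fun k => u n \- u k)) => //; exists N => k Nk.
    split; first by case: (Vuu n k).
    apply: le_trans (HN _ _ Nn Nk).
    by rewrite lerDr mulr_ge0 ?(ltW s0)// (qf_ge0 QE).
  split=> //; rewrite /scaled_form (_ : e = s * (e / 2 / s) + e / 2).
    by rewrite lerD// ler_wpM2l// ltW.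
  by field; rewrite gt_eqF.
exists v; last by move=> e /lim[N HN]; exists N => n /HN[].
have [N /(_ N (leqnn N))[? _]] := lim 1 ltr01.
have -> : v = u N \- (u N \- v) by fext.
exact: (qfB QE).
Qed.

Lemma Cc_lin (r : R) f g : Cc f -> Cc g -> Cc (fun x => r * f x + g x).
Proof.
move=> Cf Cg; apply: (@sub_finite_set _ _ ([set x | f x != 0] `|` [set x | g x != 0])).
  move=> x /=; apply: contraNP => /not_orP[/negP/negPn/eqP-> /negP/negPn/eqP->].
  by rewrite mulr0 addr0.
by rewrite finite_setU.
Qed.

(** As [(f x - f y) ^ 2 <= 2 * f x ^ 2 + 2 * f y ^ 2], the energy is controlled by
    the finite sum of [f x ^ 2] times the weighted degree of [x]. *)
Lemma Cc_domN f : Cc f -> domN G m f.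
Proof.
move=> Cf; split; last exact: Cc_ell2.
have eb p : 0 <= edge G p.1 p.2 by exact: edge_ge0.
pose d x := fine (\esum_(y in [set: X]) (edge G x y)%:E).
have dE x : \esum_(y in [set: X]) (edge G x y)%:E = (d x)%:E.
  rewrite fineK// ge0_fin_numE ?edge_summable//.
  by apply: esum_ge0 => y _; rewrite lee_fin edge_ge0.
have d0 x : 0 <= d x.
  by rewrite -lee_fin -dE; apply: esum_ge0 => y _; rewrite lee_fin edge_ge0.
have supp : (\esum_(x in [set: X]) (f x ^+ 2 * d x)%:E < +oo)%E.
  apply: esum_finsupp => [x|]; first by rewrite mulr_ge0 ?sqr_ge0.
  by apply: sub_finite_set Cf => x /=; apply: contra_neq => ->; rewrite expr0n mul0r.
have pairs : \esum_(p in [set: X * X]) (f p.1 ^+ 2 * edge G p.1 p.2)%:E =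
    \esum_(x in [set: X]) (f x ^+ 2 * d x)%:E.
  rewrite (_ : [set: X * X] = [set: X] `*`` (fun=> [set: X])); last first.
    by apply/seteqP; split.
  rewrite -(@esum_esum _ _ _ _ _ (fun x y => (f x ^+ 2 * edge G x y)%:E)).
    by apply: eq_esum => x _; rewrite esumZ ?sqr_ge0 ?dE// => y; exact: edge_ge0.
  by move=> x y _ _; rewrite lee_fin mulr_ge0 ?sqr_ge0 ?edge_ge0.
have swap : \esum_(p in [set: X * X]) (f p.2 ^+ 2 * edge G p.1 p.2)%:E =
    \esum_(p in [set: X * X]) (f p.1 ^+ 2 * edge G p.1 p.2)%:E.
  rewrite (reindex_esum [set: X * X] _ (fun p => (p.2, p.1))).
    by apply: eq_esum => p _ /=; rewrite edge_sym.
  split=> //=; first by move=> [? ?] [? ?] _ _ [-> ->].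
  by move=> [x y] _; exists (y, x).
rewrite /finite_energy /=; apply: lte_add_pinfty; last first.
  apply: esum_finsupp => [x|]; first by rewrite mulr_ge0 ?killing_ge0 ?sqr_ge0.
  by apply: sub_finite_set Cf => x /=; apply: contra_neq => ->; rewrite expr0n mulr0.
apply: (@le_lt_trans _ _ (2%:E * (\esum_(p in [set: X * X]) (f p.1 ^+ 2 * edge G p.1 p.2)%:E) +
  2%:E * (\esum_(p in [set: X * X]) (f p.2 ^+ 2 * edge G p.1 p.2)%:E))%E); last first.
  have s0 : (0 <= \esum_(x in [set: X]) (f x ^+ 2 * d x)%:E)%E.
    by apply: esum_ge0 => x _; rewrite lee_fin mulr_ge0 ?sqr_ge0.
  rewrite swap pairs; case: (esum _ _) supp s0 => [r||]// _ _.
  by rewrite -!EFinM -EFinD ltry.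
have t0 (u : R) p : 0 <= u ^+ 2 * edge G p.1 p.2 by rewrite mulr_ge0 ?sqr_ge0.
rewrite -!esumZ// -esumD; try by move=> p _; rewrite lee_fin mulr_ge0.
apply: le_esum => p _; rewrite -EFinD lee_fin.
by have := t0 (f p.1 + f p.2) p; lra.
Qed.

(** * The Dirichlet domain *)

Lemma form_normE f : form_norm G m f = qnorm (scaled_form 1) f.
Proof. by rewrite /form_norm /qnorm /scaled_form mul1r. Qed.

Lemma domD_sub : domD G m `<=` domN G m. Proof. by move=> f []. Qed.

Lemma Cc_domD f : Cc f -> domD G m f.
Proof.
move=> Cf; split; first exact: Cc_domN.
move=> e e0; exists f => //; rewrite form_normE /qnorm.
have Q1 := scaled_form_quadform ler01.
have -> : f \- f = (fun=> 0) by fext.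
by rewrite (qf0 Q1 (Cc_domN Cf)) sqrtr0.
Qed.

Lemma domD_closed f : domN G m f ->
  (forall e : R, 0 < e -> exists2 g, domD G m g & form_norm G m (f \- g) < e) ->
  domD G m f.
Proof.
move=> Nf H; split=> // e e0; have e20 : 0 < e / 2 by rewrite divr_gt0.
have Q1 := scaled_form_quadform ler01.
have [g [Ng Hg] fg] := H _ e20; have [k Ck gk] := Hg _ e20.
exists k => //; move: fg gk; rewrite !form_normE => fg gk.
apply: le_lt_trans (qnormB Q1 Nf Ng (Cc_domN Ck)) _; lra.
Qed.

Lemma domD_lin (r : R) f g : domD G m f -> domD G m g ->
  domD G m (fun x => r * f x + g x).
Proof.
move=> [Nf Hf] [Ng Hg]; split; first exact: domN_lin.
move=> e e0; have Q1 := scaled_form_quadform ler01.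
have r1 : 0 < `|r| + 1 by rewrite ltr_wpDl.
have e1 : 0 < e / 2 / (`|r| + 1) by rewrite !divr_gt0.
have e2 : 0 < e / 2 by rewrite divr_gt0.
have [f' Cf' ff'] := Hf _ e1; have [g' Cg' gg'] := Hg _ e2.
exists (fun x => r * f' x + g' x); first exact: Cc_lin.
have Nf' := Cc_domN Cf'; have Ng' := Cc_domN Cg'.
have -> : (fun x => r * f x + g x) \- (fun x => r * f' x + g' x) =
  (fun x => r * (f \- f') x) \+ (g \- g') by fext.
move: ff' gg'; rewrite !form_normE => ff' gg'.
apply: le_lt_trans (qnormD Q1 _ _) _; [|exact: (qfB Q1)|].
  by apply: (qfZ Q1); exact: (qfB Q1).
rewrite (qnormZ Q1); last exact: (qfB Q1).
have : `|r| * qnorm (scaled_form 1) (f \- f') <= e / 2.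
  apply: (@le_trans _ _ ((`|r| + 1) * (e / 2 / (`|r| + 1)))).
    by apply: ler_pM => //; rewrite ?sqrtr_ge0 ?lerDl// ltW.
  by rewrite mulrC divfK// gt_eqF.
lra.
Qed.

Lemma domD_quadform : quadform (domD G m) (scaled_form 1).
Proof.
by apply: quadform_sub (scaled_form_quadform ler01) domD_sub _; exact: domD_lin.
Qed.

Lemma domD_complete : qcomplete (domD G m) (scaled_form 1).
Proof.
move=> u Vu uc; have [v Nv uv] := domN_complete ltr01 (fun n => domD_sub (Vu n)) uc.
exists v => //; apply: domD_closed => // e e0.
have e20 : 0 < (e / 2) ^+ 2 by rewrite exprn_gt0// divr_gt0.
have [N HN] := uv _ e20; exists (u N); first exact: Vu.
have Q1 := scaled_form_quadform ler01.
rewrite form_normE (qnormBC Q1 Nv (domD_sub (Vu N))).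
apply: (@le_lt_trans _ _ (e / 2)); last by lra.
rewrite -ler_sqr ?nnegrE ?sqrtr_ge0 ?(divr_ge0 (ltW e0))//.
by rewrite (sqr_qnorm Q1); [exact: HN|exact: (qfB Q1 (domD_sub (Vu N)))].
Qed.

End Energy.

(** * Resolvents and the implicit Euler scheme *)

Lemma inv_pow2_small (R : realType) (e : R) : 0 < e ->
  exists K, forall j, (K <= j)%N -> (2 ^ j)%:R^-1 <= e.
Proof.
move=> e0; have [K _ HK] := near_infty_natSinv_lt (PosNum e0).
exists K => j Kj; apply: le_trans (ltW (HK j Kj)).
by rewrite lef_pV2 ?posrE ?ltr0n ?expn_gt0// ler_nat ltn_expl.
Qed.

Section Accretive.
Context {R : realType} {X : countType} (m : X -> R).
Hypothesis m_gt0 : forall x, 0 < m x.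
Implicit Types (f g h u v : X -> R) (L : (X -> R) -> (X -> R) -> Prop).

Local Notation ip := (polar (sqnorm m)).
Local Notation N := (ell2norm m).
Let S := sqnorm_quadform m_gt0.

Definition ell2_cvg (u : nat -> X -> R) v := forall e : R, 0 < e ->
  exists K, forall n, (K <= n)%N -> N (u n \- v) <= e.

Lemma ell2_cvg_pow2 (u : nat -> X -> R) v (c : R) : 0 <= c ->
  (forall j, N (u j \- v) <= c / (2 ^ j)%:R) -> ell2_cvg u v.
Proof.
move=> c0 H e e0; have c1 : 0 < c + 1 by lra.
have ec : 0 < e / (c + 1) by rewrite divr_gt0.
have [K HK] := inv_pow2_small ec.
exists K => j Kj; apply: le_trans (H j) _.
apply: (@le_trans _ _ ((c + 1) * (e / (c + 1)))).
  by apply: ler_pM => //; [rewrite lerDl|exact: HK].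
by rewrite mulrC divfK// gt_eqF.
Qed.

Lemma ell2_cvg_complete (u : nat -> X -> R) : (forall n, ell2 m (u n)) ->
  (forall e : R, 0 < e -> exists K, forall n k, (K <= n)%N -> (K <= k)%N ->
     N (u n \- u k) <= e) ->
  exists2 v, ell2 m v & ell2_cvg u v.
Proof.
move=> Vu uc; have [|v Vv uv] := ell2_complete m_gt0 Vu.
  move=> e e0; have se : 0 < Num.sqrt e by rewrite sqrtr_gt0.
  have [K HK] := uc _ se; exists K => n k Kn Kk.
  have := HK _ _ Kn Kk; rewrite -ler_sqr ?nnegrE ?sqrtr_ge0//.
  by rewrite (sqr_qnorm S) ?sqr_sqrtr ?(ltW e0)//; exact: (qfB S).
exists v => // e e0; have e2 : 0 < e ^+ 2 by rewrite exprn_gt0.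
have [K HK] := uv _ e2; exists K => n Kn.
rewrite -ler_sqr ?nnegrE ?sqrtr_ge0 ?(ltW e0)// (sqr_qnorm S); first exact: HK.
exact: (qfB S).
Qed.

Lemma ell2_cvg_unique (u : nat -> X -> R) v v' : (forall n, ell2 m (u n)) ->
  ell2 m v -> ell2 m v' -> ell2_cvg u v -> ell2_cvg u v' -> v = v'.
Proof.
move=> Vu Vv Vv' uv uv'; have Vd := qfB S Vv Vv'.
suff : N (v \- v') = 0.
  move=> /eqP; rewrite sqrtr_eq0 => d0.
  have {}d0 : sqnorm m (v \- v') = 0 by apply/eqP; rewrite eq_le d0 (qf_ge0 S).
  have := sqnorm_eq0 m_gt0 Vd d0 => /(congr1 (fun k x => k x + v' x)) /= e.
  by apply/funext => x; have := congr1 (fun k => k x) e => /=; rewrite subrK add0r.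
apply/eqP; rewrite eq_le sqrtr_ge0 andbT; apply/ler_addgt0Pr => e e0; rewrite add0r.
have e20 : 0 < e / 2 by rewrite divr_gt0.
have [K1 H1] := uv _ e20; have [K2 H2] := uv' _ e20.
have := H1 _ (leq_maxl K1 K2); have := H2 _ (leq_maxr K1 K2).
set n := maxn K1 K2; rewrite /ell2norm -!/(qnorm _ _) (qnormBC S (Vu n) Vv) => h2 h1.
have := qnormB S Vv (Vu n) Vv'; lra.
Qed.

Lemma ell2_cvg_pointwise (u : nat -> X -> R) v : (forall n, ell2 m (u n)) ->
  ell2 m v -> ell2_cvg u v -> forall x, (fun n => u n x) @ \oo --> v x.
Proof.
move=> Vu Vv uv x; apply/cvg_eps => e e0.
have se : 0 < Num.sqrt (m x) * e by rewrite mulr_gt0 ?sqrtr_gt0.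
have [K HK] := uv _ se; exists K => n Kn; have Vd := qfB S (Vu n) Vv.
rewrite -ler_sqr ?nnegrE ?(ltW e0)// real_normK ?num_real//.
rewrite -(ler_pM2l (m_gt0 x)); apply: le_trans (point_le_sqnorm m_gt0 x Vd) _.
rewrite -(sqr_qnorm S Vd) -(sqr_sqrtr (ltW (m_gt0 x))) -exprMn.
by rewrite ler_sqr ?nnegrE ?sqrtr_ge0 ?(ltW se)//; exact: HK.
Qed.

(** What the Euler scheme uses of the operator [L]; symmetry is a separate
    hypothesis where it matters. *)
Record m_accretive L : Prop := MAccretive {
  acc_ell2 : forall u g, L u g -> ell2 m u /\ ell2 m g;
  acc_lin : forall (r : R) u g v h, L u g -> L v h ->
    L (fun x => r * u x + v x) (fun x => r * g x + h x);
  acc_ge0 : forall u g, L u g -> 0 <= ip g u;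
  acc_surj : forall (s : R) f, 0 < s -> ell2 m f ->
    exists2 u, ell2 m u & L u (fun x => s^-1 * (f x - u x));
  acc_dense : forall f (e : R), ell2 m f -> 0 < e ->
    exists u g, L u g /\ N (f \- u) <= e }.

Definition resolvent L (s : R) f : X -> R :=
  if pselect (exists u, L u (fun x => s^-1 * (f x - u x))) is left H
  then sval (cid H) else f.

(** [2 ^ j] steps, so that passing from [j] to [j.+1] halves every step. *)
Definition euler L (t : R) (j : nat) f : X -> R :=
  iter (2 ^ j) (resolvent L (t / (2 ^ j)%:R)) f.

Section Resolvent.
Context L (HL : m_accretive L).

Lemma resolvent_op (s : R) f : 0 < s -> ell2 m f ->
  L (resolvent L s f) (fun x => s^-1 * (f x - resolvent L s f x)).
Proof.
move=> s0 Vf; rewrite /resolvent; case: pselect => [H|].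
  by case: cid.
by case; have [u _ Lu] := acc_surj HL s0 Vf; exists u.
Qed.

Lemma acc_ell2l u g : L u g -> ell2 m u. Proof. by move=> /(acc_ell2 HL)[]. Qed.
Lemma acc_ell2r u g : L u g -> ell2 m g. Proof. by move=> /(acc_ell2 HL)[]. Qed.

Lemma resolvent_ell2 (s : R) f : 0 < s -> ell2 m f -> ell2 m (resolvent L s f).
Proof. by move=> s0 /(resolvent_op s0)/acc_ell2l. Qed.

Lemma resolvent_unique (s : R) f u g : 0 < s -> L u g ->
  f = (fun x => u x + s * g x) -> resolvent L s f = u.
Proof.
move=> s0 Lug ->; have Vu := acc_ell2l Lug; have Vg := acc_ell2r Lug.
set f' := (fun x => _); have Vf : ell2 m f'.
  have -> : f' = (fun x => s * g x + u x) by rewrite /f'; fext.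
  exact: (qf_lin S).
have := resolvent_op s0 Vf; set v := resolvent L s f' => Lv.
have Vv := acc_ell2l Lv; have Vd := qfB S Vu Vv.
have := acc_lin HL (-1) Lv Lug.
have -> : (fun x => -1 * v x + u x) = u \- v by fext.
have -> : (fun x => -1 * (s^-1 * (f' x - v x)) + g x) =
    (fun x => - s^-1 * (u \- v) x).
  by apply/funext => x /=; rewrite /f'; field; rewrite gt_eqF.
move=> /(acc_ge0 HL); rewrite (polarZl S)// (polarxx S)// mulNr oppr_ge0.
rewrite pmulr_rle0 ?invr_gt0// => d0.
have {}d0 : sqnorm m (u \- v) = 0 by apply/eqP; rewrite eq_le d0 (qf_ge0 S).
have e := sqnorm_eq0 m_gt0 Vd d0; apply/funext => x.
by have := congr1 (fun k => k x) e => /= /eqP; rewrite subr_eq0 => /eqP ->.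
Qed.

Lemma resolvent_lin (s r : R) f g : 0 < s -> ell2 m f -> ell2 m g ->
  resolvent L s (fun x => r * f x + g x) =
  (fun x => r * resolvent L s f x + resolvent L s g x).
Proof.
move=> s0 Vf Vg; apply: (resolvent_unique s0).
  exact: (acc_lin HL r (resolvent_op s0 Vf) (resolvent_op s0 Vg)).
by apply/funext => x; field; rewrite gt_eqF.
Qed.

Lemma resolventB (s : R) f g : 0 < s -> ell2 m f -> ell2 m g ->
  resolvent L s (f \- g) = resolvent L s f \- resolvent L s g.
Proof.
move=> s0 Vf Vg; have -> : f \- g = (fun x => -1 * g x + f x) by fext.
by rewrite resolvent_lin//; fext.
Qed.

Lemma resolvent_contr (s : R) f : 0 < s -> ell2 m f -> N (resolvent L s f) <= N f.
Proof.
move=> s0 Vf; have Lu := resolvent_op s0 Vf; set u := resolvent L s f in Lu *.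
have Vu := acc_ell2l Lu; have Vd := qfB S Vf Vu; have := acc_ge0 HL Lu.
have -> : (fun x => s^-1 * (f x - u x)) = (fun x => s^-1 * (f \- u) x) by [].
rewrite (polarZl S)// pmulr_rge0 ?invr_gt0// => fu.
rewrite ler_sqrt ?(qf_ge0 S)//; have {1}-> : f = (fun x => 1 * u x + (f \- u) x) by fext.
by rewrite (qf_expand S)//; have := qf_ge0 S Vd; lra.
Qed.

Lemma resolvent_graph (s : R) f g : 0 < s -> L f g ->
  resolvent L s g = (fun x => s^-1 * (f x - resolvent L s f x)).
Proof.
move=> s0 Lfg; have Vf := acc_ell2l Lfg; have Lu := resolvent_op s0 Vf.
set u := resolvent L s f in Lu *.
apply: (@resolvent_unique _ _ _ (fun x => s^-1 * (g x - s^-1 * (f x - u x))) s0).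
  have Lz : L (fun=> 0) (fun=> 0).
    have := acc_lin HL (-1) Lu Lu.
    have -> : (fun x => -1 * u x + u x) = (fun=> 0) by fext.
    by have -> : (fun x => -1 * (s^-1 * (f x - u x)) + s^-1 * (f x - u x)) = (fun=> 0) by fext.
  have := acc_lin HL (s^-1) (acc_lin HL (-1) Lu Lfg) Lz.
  have -> : (fun x => s^-1 * (-1 * u x + f x) + 0) = (fun x => s^-1 * (f x - u x)) by fext.
  by have -> : (fun x => s^-1 * (-1 * (s^-1 * (f x - u x)) + g x) + 0) =
    (fun x => s^-1 * (g x - s^-1 * (f x - u x))) by fext.
by apply/funext => x; field; rewrite gt_eqF.
Qed.

Lemma resolvent_comm (s : R) f g : 0 < s -> L f g ->
  L (resolvent L s f) (resolvent L s g).
Proof.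
move=> s0 Lfg; rewrite (resolvent_graph s0 Lfg).
by apply: resolvent_op => //; exact: acc_ell2l Lfg.
Qed.

Lemma iter_resolvent_ell2 (s : R) n f : 0 < s -> ell2 m f ->
  ell2 m (iter n (resolvent L s) f).
Proof. by move=> s0 Vf; elim: n => //= n IH; exact: resolvent_ell2. Qed.

Lemma iter_resolventB (s : R) n f g : 0 < s -> ell2 m f -> ell2 m g ->
  iter n (resolvent L s) (f \- g) =
  iter n (resolvent L s) f \- iter n (resolvent L s) g.
Proof.
move=> s0 Vf Vg; elim: n => //= n ->.
by rewrite resolventB//; exact: iter_resolvent_ell2.
Qed.

Lemma iter_resolvent_contr (s : R) n f : 0 < s -> ell2 m f ->
  N (iter n (resolvent L s) f) <= N f.
Proof.
move=> s0 Vf; elim: n => //= n IH; apply: le_trans IH.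
by apply: resolvent_contr => //; exact: iter_resolvent_ell2.
Qed.

Lemma iter_resolvent_comm (s : R) n f g : 0 < s -> L f g ->
  L (iter n (resolvent L s) f) (iter n (resolvent L s) g).
Proof. by move=> s0 Lfg; elim: n => //= n IH; exact: resolvent_comm. Qed.

(** A sequence that solves the implicit Euler recursion up to an error [r] per
    step stays close to the exact solution, the resolvent being a contraction. *)
Lemma euler_stability (s r : R) n (v g : nat -> X -> R) : 0 < s ->
  ell2 m (v 0) -> (forall j, L (v j.+1) (g j.+1)) ->
  (forall j, (j < n)%N -> N ((fun x => v j.+1 x + s * g j.+1 x) \- v j) <= r) ->
  N (v n \- iter n (resolvent L s) (v 0)) <= n%:R * r.
Proof.
move=> s0 V0 Lv; elim: n => [|n IH] Hr.
  rewrite mul0r; have -> : v 0 \- iter 0 (resolvent L s) (v 0) = (fun=> 0) by fext.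
  by rewrite /ell2norm (qf0 S V0) sqrtr0.
have Vn : ell2 m (v n) by case: n {IH Hr} => // n; exact: acc_ell2l (Lv n).
have Vg := acc_ell2r (Lv n); have VSn := acc_ell2l (Lv n).
pose b := fun x => v n.+1 x + s * g n.+1 x.
have Vb : ell2 m b.
  have -> : b = (fun x => s * g n.+1 x + v n.+1 x) by rewrite /b; fext.
  exact: (qf_lin S).
have -> : v n.+1 = resolvent L s b by rewrite (resolvent_unique s0 (Lv n)).
rewrite iterS -resolventB//; last exact: iter_resolvent_ell2.
set w := iter n _ _ in IH *; have Vw : ell2 m w by exact: iter_resolvent_ell2.
apply: le_trans (resolvent_contr s0 (qfB S Vb Vw)) _.
apply: le_trans (qnormB S Vb Vn Vw) _.
rewrite -natr1 mulrDl mul1r addrC; apply: lerD; last exact: Hr.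
by apply: IH => j jn; apply: Hr; exact: ltnW.
Qed.

(** Halving the step: with [v = resolvent s f] one has
    [(1 + (s/2) L)^2 v = f + (s^2/4) L^2 v], and [L^2] commutes with the
    resolvent. *)
Lemma resolvent_half (s : R) f g h : 0 < s -> L f g -> L g h ->
  N (resolvent L s f \- resolvent L (s / 2) (resolvent L (s / 2) f)) <=
  s ^+ 2 / 4 * N h.
Proof.
move=> s0 Lfg Lgh; have s20 : 0 < s / 2 by rewrite divr_gt0.
have Vf := acc_ell2l Lfg; have Vh := acc_ell2r Lgh.
have Lv := resolvent_comm s0 Lfg; have Lv' := resolvent_comm s0 Lgh.
have E1 := resolvent_graph s0 Lfg; have E2 := resolvent_graph s0 Lgh.
set v := resolvent L s f in Lv E1 *; set v1 := resolvent L s g in Lv Lv' E1 E2.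
have Nv2 : N (resolvent L s h) <= N h by exact: resolvent_contr.
set v2 := resolvent L s h in Lv' E2 Nv2; have Vv2 := acc_ell2r Lv'.
have s_neq0 : s != 0 by rewrite gt_eqF.
have {}E1 : f = (fun x => v x + s * v1 x) by rewrite E1; apply/funext => x; field.
have RE : resolvent L (s / 2) (resolvent L (s / 2)
    (fun x => s ^+ 2 / 4 * v2 x + f x)) = v.
  apply: (resolvent_unique s20 Lv).
  have -> : (fun x => v x + s / 2 * v1 x) = (fun x => s / 2 * v1 x + v x) by fext.
  apply: (resolvent_unique s20 (acc_lin HL (s / 2) Lv' Lv)).
  by rewrite E1; apply/funext => x; field.
have V2 k : ell2 m k -> ell2 m (resolvent L (s / 2) k) by exact: resolvent_ell2.
rewrite -RE (resolvent_lin _ s20 Vv2 Vf) (resolvent_lin _ s20 (V2 _ Vv2) (V2 _ Vf)).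
set z := resolvent L (s / 2) (resolvent L (s / 2) v2).
set y := resolvent L (s / 2) (resolvent L (s / 2) f).
have -> : (fun x => s ^+ 2 / 4 * z x + y x) \- y = (fun x => s ^+ 2 / 4 * z x) by fext.
have Vz : ell2 m z by exact: (V2 _ (V2 _ Vv2)).
have c0 : 0 <= s ^+ 2 / 4 by rewrite divr_ge0 ?sqr_ge0.
rewrite /ell2norm -/(qnorm _ _) (qnormZ S)// ger0_norm// ler_wpM2l//.
apply: le_trans Nv2; apply: le_trans (resolvent_contr s20 (V2 _ Vv2)) _.
exact: resolvent_contr.
Qed.

End Resolvent.
End Accretive.

Section EulerLimit.
Context {R : realType} {X : countType} (m : X -> R).
Hypothesis m_gt0 : forall x, 0 < m x.
Implicit Types (f g h u v : X -> R).
Context (L : (X -> R) -> (X -> R) -> Prop) (HL : m_accretive m L).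

Local Notation ip := (polar (sqnorm m)).
Local Notation N := (ell2norm m).
Let S := sqnorm_quadform m_gt0.
Let NB f g h : ell2 m f -> ell2 m g -> ell2 m h -> N (f \- h) <= N (f \- g) + N (g \- h).
Proof. exact: (qnormB S). Qed.
Let NC f g : ell2 m f -> ell2 m g -> N (f \- g) = N (g \- f).
Proof. exact: (qnormBC S). Qed.
Let N_ge0 f : 0 <= N f. Proof. exact: sqrtr_ge0. Qed.

Definition euler_limit (t : R) (P : (X -> R) -> X -> R) := forall f, ell2 m f ->
  ell2 m (P f) /\ ell2_cvg m (fun j => euler L t j f) (P f).

Let pow_gt0 j : (0 : R) < (2 ^ j)%:R. Proof. by rewrite ltr0n expn_gt0. Qed.
Let step_gt0 (t : R) j : 0 < t -> 0 < t / (2 ^ j)%:R.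
Proof. by move=> t0; rewrite divr_gt0. Qed.

Lemma euler_ell2 (t : R) j f : 0 < t -> ell2 m f -> ell2 m (euler L t j f).
Proof. by move=> t0 Vf; exact: (iter_resolvent_ell2 HL _ (step_gt0 j t0) Vf). Qed.

Lemma euler_contr (t : R) j f : 0 < t -> ell2 m f -> N (euler L t j f) <= N f.
Proof. by move=> t0 Vf; exact: (iter_resolvent_contr m_gt0 HL _ (step_gt0 j t0) Vf). Qed.

Lemma eulerB (t : R) j f g : 0 < t -> ell2 m f -> ell2 m g ->
  euler L t j (f \- g) = euler L t j f \- euler L t j g.
Proof. by move=> t0 Vf Vg; exact: (iter_resolventB m_gt0 HL _ (step_gt0 j t0) Vf Vg). Qed.

Lemma euler_half (t : R) j f g h : 0 < t -> L f g -> L g h ->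
  N (euler L t j f \- euler L t j.+1 f) <= t ^+ 2 / 4 / (2 ^ j)%:R * N h.
Proof.
move=> t0 Lfg Lgh; rewrite /euler; set s := t / (2 ^ j)%:R.
have s0 : 0 < s by exact: step_gt0.
have s20 : 0 < s / 2 by rewrite divr_gt0.
have -> : t / (2 ^ j.+1)%:R = s / 2.
  by rewrite expnSr natrM /s invfM mulrA.
rewrite expnSr iterM.
set U := iter 2 (resolvent L (s / 2)); set T := resolvent L s.
have Vf := acc_ell2l HL Lfg.
have VU k : ell2 m k -> ell2 m (U k) by exact: (iter_resolvent_ell2 HL).
have VUn n : ell2 m (iter n U f) by elim: n => //= n /VU.
have main n : N (iter n T f \- iter n U f) <= n%:R * (s ^+ 2 / 4 * N h).
  elim: n => [|n IH].
    rewrite mul0r; have -> : iter 0 T f \- iter 0 U f = (fun=> 0) by fext.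
    by rewrite /ell2norm (qf0 S Vf) sqrtr0.
  have VT : ell2 m (iter n T f) by exact: (iter_resolvent_ell2 HL).
  have VT1 : ell2 m (T (iter n T f)) by exact: (resolvent_ell2 HL).
  rewrite !iterS; apply: le_trans (NB VT1 (VU _ VT) (VU _ (VUn n))) _.
  rewrite -natr1 mulrDl mul1r addrC; apply: lerD.
    apply: le_trans IH; rewrite -(iter_resolventB m_gt0 HL)//.
    by apply: (iter_resolvent_contr m_gt0 HL) => //; exact: (qfB S).
  have L1 := iter_resolvent_comm m_gt0 HL n s0 Lfg.
  have L2 := iter_resolvent_comm m_gt0 HL n s0 Lgh.
  apply: le_trans (resolvent_half m_gt0 HL s0 L1 L2) _.
  rewrite ler_wpM2l ?divr_ge0 ?sqr_ge0//.
  by apply: (iter_resolvent_contr m_gt0 HL) => //; exact: acc_ell2r Lgh.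
apply: le_trans (main _) _; rewrite mulrA ler_wpM2r//.
rewrite /s le_eqVlt; apply/orP; left; apply/eqP; field.
by rewrite gt_eqF.
Qed.

Lemma euler_cauchy (t : R) j k f g h : 0 < t -> L f g -> L g h ->
  N (euler L t j f \- euler L t (j + k) f) <= t ^+ 2 / 2 / (2 ^ j)%:R * N h.
Proof.
move=> t0 Lfg Lgh; have Vf := acc_ell2l HL Lfg.
have VE i : ell2 m (euler L t i f) by exact: euler_ell2.
suff : N (euler L t j f \- euler L t (j + k) f) <=
    t ^+ 2 / 2 * ((2 ^ j)%:R^-1 - (2 ^ (j + k))%:R^-1) * N h.
  move/le_trans; apply; rewrite ler_wpM2r// ler_wpM2l ?divr_ge0 ?sqr_ge0//.
  by rewrite gerBl invr_ge0 ltW.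
elim: k => [|k IH].
  rewrite addn0 subrr mulr0 mul0r.
  have -> : euler L t j f \- euler L t j f = (fun=> 0) by fext.
  by rewrite /ell2norm (qf0 S Vf) sqrtr0.
apply: le_trans (NB (VE _) (VE (j + k)%N) (VE _)) _.
rewrite addnS; have := euler_half (j + k) t0 Lfg Lgh => H.
apply: le_trans (lerD IH H) _; rewrite -mulrDl ler_wpM2r// expnS natrM.
rewrite le_eqVlt; apply/orP; left; apply/eqP; field.
by rewrite !gt_eqF.
Qed.

Section Limit.
Context (t : R) (P : (X -> R) -> X -> R) (t_gt0 : 0 < t) (HP : euler_limit t P).

Lemma euler_limit_ell2 f : ell2 m f -> ell2 m (P f). Proof. by case/HP. Qed.

Lemma euler_limitB_contr f g : ell2 m f -> ell2 m g -> N (P f \- P g) <= N (f \- g).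
Proof.
move=> Vf Vg; have [VPf cf] := HP Vf; have [VPg cg] := HP Vg.
apply/ler_addgt0Pr => e e0; have e20 : 0 < e / 2 by rewrite divr_gt0.
have [K1 H1] := cf _ e20; have [K2 H2] := cg _ e20.
have {H1} := H1 _ (leq_maxl K1 K2); have {H2} := H2 _ (leq_maxr K1 K2).
set n := maxn K1 K2 => h2 h1.
have VEf := euler_ell2 n t_gt0 Vf; have VEg := euler_ell2 n t_gt0 Vg.
rewrite NC// in h1; have := NB VPf VEf VPg; have := NB VEf VEg VPg.
have := euler_contr n t_gt0 (qfB S Vf Vg); rewrite eulerB//; lra.
Qed.

Lemma euler_limit_rate j f g h : L f g -> L g h ->
  N (euler L t j f \- P f) <= t ^+ 2 / 2 / (2 ^ j)%:R * N h.
Proof.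
move=> Lfg Lgh; have Vf := acc_ell2l HL Lfg; have [VP cP] := HP Vf.
apply/ler_addgt0Pr => e e0; have [K HK] := cP _ e0.
have VE i : ell2 m (euler L t i f) by exact: euler_ell2.
apply: le_trans (NB (VE j) (VE (j + K)%N) VP) _.
by apply: lerD; [exact: (euler_cauchy _ _ t_gt0 Lfg Lgh)|apply: HK; exact: leq_addl].
Qed.

End Limit.

(** The resolvent maps the domain of [L] into that of [L ^ 2] and moves a vector
    [u] of it by at most [s * N (L u)]. *)
Lemma acc_dense2 f (e : R) : ell2 m f -> 0 < e ->
  exists u g h, [/\ L u g, L g h & N (f \- u) <= e].
Proof.
move=> Vf e0; have e20 : 0 < e / 2 by rewrite divr_gt0.
have [u [g [Lug fu]]] := acc_dense HL Vf e20.
have Vu := acc_ell2l HL Lug; have Vg := acc_ell2r HL Lug.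
have ng : 0 < N g + 1 by rewrite ltr_wpDl.
pose s := e / 2 / (N g + 1); have s0 : 0 < s by rewrite divr_gt0.
have Lr := resolvent_comm m_gt0 HL s0 Lug; have Lr2 := resolvent_op HL s0 Vg.
exists (resolvent L s u), (resolvent L s g), (fun x => s^-1 * (g x - resolvent L s g x)).
split=> //; have Vr := acc_ell2l HL Lr; have Vrg := acc_ell2r HL Lr.
apply: le_trans (NB Vf Vu Vr) _.
have -> : u \- resolvent L s u = (fun x => s * resolvent L s g x).
  by rewrite (resolvent_graph m_gt0 HL s0 Lug); apply/funext => x /=; field; rewrite gt_eqF.
rewrite {2}/ell2norm -/(qnorm _ _) (qnormZ S)// gtr0_norm//.
have : s * N (resolvent L s g) <= e / 2.
  apply: (@le_trans _ _ (s * (N g + 1))).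
    rewrite ler_wpM2l ?(ltW s0)//; apply: le_trans (resolvent_contr m_gt0 HL s0 Vg) _.
    by rewrite lerDl.
  by rewrite /s divfK// gt_eqF.
rewrite /qnorm -/(ell2norm _ _); lra.
Qed.

(** Convergence of the Euler scheme on the dense domain of [L ^ 2] extends to
    the whole space, because the scheme consists of contractions. *)
Lemma euler_limit_dense (t : R) P : 0 < t ->
  (forall f, ell2 m f -> ell2 m (P f)) ->
  (forall f g, ell2 m f -> ell2 m g -> P (f \- g) = P f \- P g) ->
  (exists C : R, forall f, ell2 m f -> N (P f) <= C * N f) ->
  (forall f g h, L f g -> L g h -> ell2_cvg m (fun j => euler L t j f) (P f)) ->
  euler_limit t P.
Proof.
move=> t0 VP PB [C PC] cP f Vf; split; first exact: VP.
move=> e e0; have C1 : 0 < `|C| + 2 by rewrite ltr_wpDl.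
have d0 : 0 < e / (`|C| + 2) by rewrite divr_gt0.
have [u [g [h [Lug Lgh fu]]]] := acc_dense2 Vf d0.
have Vu := acc_ell2l HL Lug; have [K HK] := cP _ _ _ Lug Lgh _ d0.
exists K => n Kn; have VEf := euler_ell2 n t0 Vf; have VEu := euler_ell2 n t0 Vu.
apply: le_trans (NB VEf VEu (VP _ Vf)) _.
apply: le_trans (lerD (lexx _) (NB VEu (VP _ Vu) (VP _ Vf))) _.
rewrite -eulerB// -PB//; set d := e / _ in d0 fu HK.
have h1 : N (euler L t n (f \- u)) <= d.
  by apply: le_trans fu; apply: euler_contr => //; exact: (qfB S).
have h2 : N (P (u \- f)) <= `|C| * d.
  apply: le_trans (PC _ (qfB S Vu Vf)) _; rewrite NC//.
  apply: le_trans (ler_wpM2r _ (ler_norm C)) _ => //.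
  by rewrite ler_wpM2l.
have -> : e = d + (d + `|C| * d) by rewrite /d; field; rewrite gt_eqF.
by apply: lerD => //; apply: lerD => //; exact: HK.
Qed.

End EulerLimit.

(** * Semigroups are limits of the Euler scheme *)

Lemma at_right0_eps (R : realType) (u : R -> R) :
  u t @[t --> 0^'+] --> (0 : R) -> forall e : R, 0 < e ->
  exists2 d : R, 0 < d & forall t, 0 < t -> t < d -> `|u t| <= e.
Proof.
move=> /cvgrPdistC_le H e e0; have := H _ e0.
rewrite near_withinE => /nbhs_ballP[d /= d0 Hd].
exists d => // t t0 td; have := Hd t; rewrite subr0; apply=> //.
by rewrite /ball /= sub0r normrN gtr0_norm.
Qed.

Section SemigroupEuler.
Context {R : realType} {X : countType} (m : X -> R).
Hypothesis m_gt0 : forall x, 0 < m x.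
Implicit Types (f g h u v : X -> R).
Context (L : (X -> R) -> (X -> R) -> Prop) (P : R -> (X -> R) -> X -> R).
Hypothesis HP : exp_semigroup m L P.

Local Notation N := (ell2norm m).
Let S := sqnorm_quadform m_gt0.
Let NB f g h : ell2 m f -> ell2 m g -> ell2 m h -> N (f \- h) <= N (f \- g) + N (g \- h).
Proof. exact: (qnormB S). Qed.
Let NC f g : ell2 m f -> ell2 m g -> N (f \- g) = N (g \- f).
Proof. exact: (qnormBC S). Qed.
Let N_ge0 f : 0 <= N f. Proof. exact: sqrtr_ge0. Qed.
Let ND f g : ell2 m f -> ell2 m g -> N (f \+ g) <= N f + N g.
Proof. exact: (qnormD S). Qed.
Let NZ (r : R) f : ell2 m f -> N (fun x => r * f x) = `|r| * N f.
Proof. exact: (qnormZ S). Qed.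
Let VP r f : 0 <= r -> ell2 m f -> ell2 m (P r f).
Proof. exact: (semigroup_ell2 HP). Qed.

Lemma semigroupB (t : R) f g : 0 <= t -> ell2 m f -> ell2 m g ->
  P t (f \- g) = P t f \- P t g.
Proof.
move=> t0 Vf Vg; have -> : f \- g = (fun x => -1 * g x + f x) by fext.
by rewrite (semigroup_linear HP)//; fext.
Qed.

Lemma semigroup_lin (t r : R) f g : 0 <= t -> ell2 m f -> ell2 m g ->
  P t (fun x => r * f x + g x) = (fun x => r * P t f x + P t g x).
Proof. exact: (semigroup_linear HP). Qed.

Lemma semigroupZ (t r : R) f : 0 <= t -> ell2 m f ->
  P t (fun x => r * f x) = (fun x => r * P t f x).
Proof.
move=> t0 Vf; have -> : (fun x => r * f x) = (fun x => (r - 1) * f x + f x) by fext.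
by rewrite semigroup_lin//; fext.
Qed.

(** One step of the gliding hump: near [x] there is a ball on which some [P r]
    with small [r] is large. *)
Let hump (n : nat) (x : X -> R) (rho : R) :
  (forall d M : R, 0 < d ->
    exists r f, [/\ 0 <= r <= d, ell2 m f & M * N f < N (P r f)]) ->
  ell2 m x -> 0 < rho ->
  exists x' rho' r, [/\ ell2 m x', 0 < rho' <= rho / 2, N (x' \- x) <= rho,
    0 <= r <= n.+1%:R^-1 &
    forall y, ell2 m y -> N (y \- x') <= 2 * rho' -> n%:R <= N (P r y)].
Proof.
move=> unb Vx rho0; have n0 : (0 : R) < n.+1%:R^-1 by rewrite invr_gt0.
have [r [f [/andP[r0 rn] Vf big]]] := unb _ ((n%:R + 2) / rho) n0.
have Nf : 0 < N f.
  rewrite lt_neqAle N_ge0 andbT; apply/eqP => f0.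
  have [C HC] := semigroup_bounded HP r0.
  by have := HC _ Vf; rewrite -f0 mulr0; move: big; rewrite -f0 mulr0; lra.
pose z := fun y => rho / N f * f y.
have c0 : 0 < rho / N f by rewrite divr_gt0.
have Vz : ell2 m z by exact: (qfZ S).
have Nz : N z = rho by rewrite /z NZ// gtr0_norm// divfK// gt_eqF.
have Pz : n%:R + 2 <= N (P r z).
  rewrite /z semigroupZ// NZ ?(gtr0_norm c0); last exact: VP.
  have -> : n%:R + 2 = rho / N f * ((n%:R + 2) / rho * N f).
    by field; rewrite !gt_eqF.
  by rewrite ler_pM2l// ltW.
have [x' [Vx' xx' Px']] : exists x', [/\ ell2 m x', N (x' \- x) <= rho &
    n%:R + 2 <= N (P r x')].
  have Vp := qfD S Vx Vz; have Vm := qfB S Vx Vz.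
  have [Hp|Hp] := leP (n%:R + 2) (N (P r (x \+ z))).
    exists (x \+ z); split=> //; have -> : (x \+ z) \- x = z by fext.
    by rewrite Nz.
  exists (x \- z); split=> //.
    rewrite NC//; have -> : x \- (x \- z) = z by fext.
    by rewrite Nz.
  rewrite leNgt; apply/negP => Hm.
  have e : (fun y => 2 * z y) = (x \+ z) \- (x \- z) by fext.
  have := ND (VP r0 Vp) (qfZ S (-1) (VP r0 Vm)).
  rewrite NZ ?normrN1 ?mul1r; last exact: VP.
  have -> : P r (x \+ z) \+ (fun y => -1 * P r (x \- z) y) =
      (fun y => 2 * P r z y).
    by rewrite -(semigroupZ 2 r0 Vz) e (semigroupB r0 Vp Vm); fext.
  rewrite NZ; last exact: VP.
  rewrite ger0_norm//; lra.
have [C HC] := semigroup_bounded HP r0.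
pose C' := `|C| + 1; have C'0 : 0 < C' by rewrite ltr_wpDl.
exists x', (Num.min (rho / 2) C'^-1), r; split=> //; rewrite ?r0//.
  by rewrite lt_min invr_gt0 C'0 divr_gt0//= ge_min lexx.
move=> y Vy yx'.
have : N (P r x') <= N (P r y) + N (P r x' \- P r y).
  by apply: (qnorm_leD S); exact: VP.
rewrite -semigroupB//; have := HC _ (qfB S Vx' Vy); rewrite NC// => H1 H2.
have H3 : C * N (y \- x') <= C' * (2 * C'^-1).
  apply: le_trans (ler_wpM2r (N_ge0 _) (_ : C <= C')) _.
    by rewrite (le_trans (ler_norm C))// lerDl.
  rewrite ler_pM2l//; apply: le_trans yx' _.
  by rewrite ler_pM2l// ge_min lexx orbT.
have H4 : C' * (2 * C'^-1) = 2 by field; rewrite gt_eqF.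
lra.
Qed.

(** Uniform boundedness principle: strong continuity at 0 bounds the operator
    norms near 0. *)
Lemma semigroup_bounded_near0 : exists d M : R, [/\ 0 < d, 1 <= M &
  forall r f, 0 <= r <= d -> ell2 m f -> N (P r f) <= M * N f].
Proof.
apply: contrapT => no.
have unb (d M : R) : 0 < d ->
    exists r f, [/\ 0 <= r <= d, ell2 m f & M * N f < N (P r f)].
  move=> d0; apply: contrapT => no'; apply: no.
  exists d, (`|M| + 1); split=> //; first by rewrite lerDr.
  move=> r f rd Vf; rewrite leNgt; apply/negP => big; apply: no'.
  exists r, f; split=> //; apply: le_lt_trans big.
  by rewrite ler_wpM2r// (le_trans (ler_norm M))// lerDl.
have step n (p : (X -> R) * R) : exists p' : (X -> R) * R, ell2 m p.1 -> 0 < p.2 ->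
    [/\ ell2 m p'.1, 0 < p'.2 <= p.2 / 2, N (p'.1 \- p.1) <= p.2 &
      exists2 r, 0 <= r <= n.+1%:R^-1 &
        forall y, ell2 m y -> N (y \- p'.1) <= 2 * p'.2 -> n%:R <= N (P r y)].
  have [[V p0]|no'] := pselect (ell2 m p.1 /\ 0 < p.2); last first.
    by exists p => V p0; case: no'.
  have [x' [rho' [r [? ? ? ? ?]]]] := hump n unb V p0.
  by exists (x', rho') => _ _; split=> //; exists r.
pose F n p := sval (cid (step n p)).
pose z0 : X -> R := fun=> 0.
have Vz0 : ell2 m z0.
  by apply: Cc_ell2 => //; exact: Cc0.
pose fix U n := if n is k.+1 then F k (U k) else (z0, 1).
have good n : ell2 m (U n).1 /\ 0 < (U n).2.
  elim: n => [|n [V p0]] //=; rewrite /F; case: cid => p' /= H.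
  by have [? /andP[? _] _ _] := H V p0.
have goodS n : [/\ (U n.+1).2 <= (U n).2 / 2, N ((U n.+1).1 \- (U n).1) <= (U n).2 &
      exists2 r, 0 <= r <= n.+1%:R^-1 &
        forall y, ell2 m y -> N (y \- (U n.+1).1) <= 2 * (U n.+1).2 -> n%:R <= N (P r y)].
  have [V p0] := good n; rewrite /= /F; case: cid => p' /= H.
  by have [_ /andP[_ ?] ? ?] := H V p0.
have rho_le n : (U n).2 <= (2^-1) ^+ n.
  elim: n => [|n IH]; first by rewrite expr0.
  by have [h _ _] := goodS n; rewrite exprSr; apply: le_trans h _; rewrite ler_pM2r.
have dist n k : N ((U (n + k)%N).1 \- (U n).1) <= 2 * (U n).2 - 2 * (U (n + k)%N).2.
  elim: k => [|k IH].
    rewrite addn0 subrr; have -> : (U n).1 \- (U n).1 = (fun=> 0) by fext.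
    by rewrite /ell2norm (qf0 S Vz0) sqrtr0.
  rewrite addnS; have [h1 h2 _] := goodS (n + k)%N.
  have [Va _] := good (n + k).+1; have [Vb _] := good (n + k)%N; have [Vc _] := good n.
  by have := NB Va Vb Vc; lra.
have far n k : (n <= k)%N -> N ((U k).1 \- (U n).1) <= 2 * (U n).2.
  move=> nk; have := dist n (k - n)%N; rewrite subnKC//.
  by have [_ ?] := good k; lra.
have small (e : R) : 0 < e -> exists K, forall n, (K <= n)%N -> (2^-1) ^+ n <= e.
  move=> e0; have : (fun n => (2^-1) ^+ n : R) @ \oo --> (0 : R).
    by apply: cvg_expr; rewrite ger0_norm// invf_lt1// ltr1n.
  move=> /cvg_eps/(_ _ e0)[K HK]; exists K => n /HK; rewrite subr0.
  by apply: le_trans; exact: ler_norm.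
have [x Vx cx] : exists2 x, ell2 m x & ell2_cvg m (fun n => (U n).1) x.
  apply: (ell2_cvg_complete m_gt0); first by move=> n; case: (good n).
  move=> e e0; have e4 : 0 < e / 4 by rewrite divr_gt0.
  have [K HK] := small _ e4; exists K => n k Kn Kk.
  have [Vn _] := good n; have [Vk _] := good k; have [VK _] := good K.
  have := far _ _ Kn; have := far _ _ Kk; have := rho_le K; have := HK K (leqnn K).
  by have := NB Vn VK Vk; rewrite (NC VK Vk); lra.
have xU n : N (x \- (U n).1) <= 2 * (U n).2.
  apply/ler_addgt0Pr => e e0; have [K HK] := cx _ e0.
  have [VM _] := good (maxn K n); have [Vn _] := good n.
  have := HK _ (leq_maxl K n); have := far _ _ (leq_maxr K n).
  by have := NB Vx VM Vn; rewrite (NC VM Vx); lra.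
have [d d0 Hd] := at_right0_eps (semigroup_continuous HP Vx) ltr01.
have bnd r : 0 <= r -> r < d -> N (P r x) <= N x + 1.
  rewrite le_eqVlt => /orP[/eqP<- _|r0 rd].
    by rewrite (semigroup0 HP)// lerDl.
  have := Hd _ r0 rd; rewrite ger0_norm// => h.
  by have := qnorm_leD S (VP (ltW r0) Vx) Vx; rewrite /qnorm -!/(ell2norm _ _); lra.
have [n1 _ Hn1] := near_infty_natSinv_lt (PosNum d0).
pose n := maxn n1 (Num.bound (N x + 2)).
have [_ _ [r /andP[r0 rn] Hr]] := goodS n.
have := Hr _ Vx (xU _).
have := bnd _ r0 (le_lt_trans rn (Hn1 _ (leq_maxl _ _))).
have : N x + 2 < n%:R.
  apply: lt_le_trans (archi_boundP _) _; first by rewrite addr_ge0.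
  by rewrite ler_nat leq_maxr.
lra.
Qed.

Lemma semigroup_bounded_on (T : R) : exists2 M : R, 1 <= M &
  forall r f, 0 <= r <= T -> ell2 m f -> N (P r f) <= M * N f.
Proof.
have [d [M [d0 M1 HM]]] := semigroup_bounded_near0.
have M0 : 0 <= M by lra.
pose n := (Num.bound (T / d)).
exists (M ^+ n.+1); first by rewrite exprn_ege1.
move=> r f /andP[r0 rT] Vf.
have iterM k s : 0 <= s <= d -> N (P (k%:R * s) f) <= M ^+ k * N f /\ ell2 m (P (k%:R * s) f).
  move=> /[dup] sd /andP[s0 _]; elim: k => [|k [IH V]].
    by rewrite mul0r (semigroup0 HP)// expr0 mul1r.
  have ks0 : 0 <= k%:R * s by rewrite mulr_ge0.
  have -> : k.+1%:R * s = s + k%:R * s by rewrite -natr1; ring.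
  rewrite (semigroupD HP)//; split; last exact: VP.
  by apply: le_trans (HM _ _ sd V) _; rewrite exprS -mulrA ler_wpM2l.
have n0 : (0 : R) < n.+1%:R by [].
have [] := iterM n.+1 (r / n.+1%:R).
  rewrite divr_ge0//= ler_pdivrMr//.
  have [T0|T0] := ltP T 0; first by apply: (@le_trans _ _ 0); [lra|rewrite mulr_ge0// ltW].
  have : T / d < n%:R by apply: archi_boundP; exact: (divr_ge0 T0 (ltW d0)).
  rewrite ltr_pdivrMr// => /ltW TN; rewrite -natr1 mulrDr mulr1.
  by rewrite mulrC in TN; lra.
by rewrite mulrC divfK// gt_eqF.
Qed.

Lemma semigroup_op (r : R) f g : 0 <= r -> L f g -> L (P r f) (P r g).
Proof.
move=> r0 /(semigroup_generator HP)[Vf Vg cfg].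
apply/(semigroup_generator HP); split; try exact: VP.
have [C HC] := semigroup_bounded HP r0.
apply/cvgrPdistC_le => e e0; have C0 : 0 < `|C| + 1 by rewrite ltr_wpDl.
have e1 : 0 < e / (`|C| + 1) by rewrite divr_gt0.
have [d d0 Hd] := at_right0_eps cfg e1.
rewrite near_withinE; apply/nbhs_ballP; exists d => // t /=.
rewrite /ball /= sub0r normrN => td t0; rewrite subr0 ger0_norm//.
have {}td : t < d by rewrite gtr0_norm in td.
have := Hd _ t0 td; rewrite ger0_norm// => h.
have Vq : ell2 m (fun x => t^-1 * (f x - P t f x) - g x).
  have -> : (fun x => t^-1 * (f x - P t f x) - g x) =
    (fun x => t^-1 * (f \- P t f) x) \- g by [].
  apply: (qfB S) => //; apply: (qfZ S); apply: (qfB S) => //; exact: (VP (ltW t0)).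
have -> : (fun x => t^-1 * (P r f x - P t (P r f) x) - P r g x) =
    P r (fun x => t^-1 * (f x - P t f x) - g x).
  have -> : (fun x => t^-1 * (f x - P t f x) - g x) =
    (fun x => t^-1 * (f \- P t f) x + (fun x => -1 * g x) x) by fext.
  rewrite semigroup_lin//; last 2 first.
  - by apply: (qfB S) => //; exact: (VP (ltW t0)).
  - exact: (qfZ S).
  rewrite semigroupB//; last exact: (VP (ltW t0)).
  rewrite semigroupZ// -!(semigroupD HP) ?(ltW t0)// addrC; fext.
apply: le_trans (HC _ Vq) _; apply: (@le_trans _ _ ((`|C| + 1) * (e / (`|C| + 1)))).
  apply: (@le_trans _ _ ((`|C| + 1) * N (fun x => t^-1 * (f x - P t f x) - g x))).
    by rewrite ler_wpM2r// (le_trans (ler_norm C))// lerDl.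
  by rewrite ler_wpM2l// ltW.
by rewrite mulrC divfK// gt_eqF.
Qed.

(** One step moves [f] by at most [c], and [j] steps by [j] images of that
    displacement under operators of norm at most [M]. *)
Let telescope (T M tau c : R) j f : 1 <= M ->
  (forall r f, 0 <= r <= T -> ell2 m f -> N (P r f) <= M * N f) ->
  0 <= tau -> j%:R * tau <= T -> ell2 m f -> N (P tau f \- f) <= c ->
  N (P (j%:R * tau) f \- f) <= j%:R * (M * c).
Proof.
move=> M1 HM tau0 + Vf fc; elim: j => [|j IH] jT.
  rewrite !mul0r (semigroup0 HP)//; have -> : f \- f = (fun=> 0) by fext.
  by rewrite /ell2norm (qf0 S Vf) sqrtr0.
have j0 : 0 <= j%:R * tau by rewrite mulr_ge0.
have jT' : j%:R * tau <= T.
  by apply: le_trans jT; rewrite ler_wpM2r// ler_nat.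
have -> : j.+1%:R * tau = j%:R * tau + tau by rewrite -natr1; ring.
rewrite (semigroupD HP)//.
have Vt := VP tau0 Vf; have Vd := qfB S Vt Vf.
apply: le_trans (NB (VP j0 Vt) (VP j0 Vf) Vf) _.
rewrite -natr1 mulrDl mul1r addrC; apply: lerD; first exact: IH.
rewrite -semigroupB//; apply: le_trans (HM _ _ _ Vd) _; first by rewrite j0.
by rewrite ler_wpM2l//; lra.
Qed.

Context (HL : m_accretive m L).

(** A fine subdivision of [0, a] whose mesh lies in the range where the
    difference quotient at [f] is within [e] of the generator. *)
Let fine_step (a e : R) f g : 0 < a -> 0 < e -> L f g ->
  exists n, [/\ 0 < a / n.+1%:R,
    N (P (a / n.+1%:R) f \- (fun x => f x - a / n.+1%:R * g x)) <= a / n.+1%:R * e &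
    n.+1%:R * (a / n.+1%:R) = a].
Proof.
move=> a0 e0 Lfg; have [Vf Vg cfg] := (semigroup_generator HP f g).1 Lfg.
have [d d0 Hd] := at_right0_eps cfg e0.
have da : 0 < d / a by rewrite divr_gt0.
have [n _ Hn] := near_infty_natSinv_lt (PosNum da).
have n0 : (0 : R) < n.+1%:R by [].
have s0 : 0 < a / n.+1%:R by rewrite divr_gt0.
exists n; split=> //; last by rewrite mulrC divfK// gt_eqF.
set s := a / n.+1%:R in s0 *.
have sd : s < d by have := Hn n (leqnn n); rewrite /= ltr_pdivlMr// mulrC.
have := Hd _ s0 sd; rewrite ger0_norm// => h.
have -> : P s f \- (fun x => f x - s * g x) =
    (fun x => - s * (fun x => s^-1 * (f x - P s f x) - g x) x).
  by apply/funext => x /=; field; rewrite gt_eqF.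
rewrite NZ ?normrN ?gtr0_norm ?ler_pM2l//.
have -> : (fun x => s^-1 * (f x - P s f x) - g x) =
  (fun x => s^-1 * (f \- P s f) x) \- g by [].
apply: (qfB S) => //; apply: (qfZ S); apply: (qfB S) => //; exact: (VP (ltW s0)).
Qed.

Lemma semigroup_lipschitz (T M a : R) f g : 1 <= M ->
  (forall r f, 0 <= r <= T -> ell2 m f -> N (P r f) <= M * N f) ->
  0 <= a <= T -> L f g -> N (P a f \- f) <= M * a * N g.
Proof.
move=> M1 HM /andP[a0 aT] Lfg; have Vf := acc_ell2l HL Lfg; have Vg := acc_ell2r HL Lfg.
move: a0; rewrite le_eqVlt => /orP[/eqP<-|a0].
  rewrite (semigroup0 HP)// mulr0 mul0r.
  have -> : f \- f = (fun=> 0) by fext.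
  by rewrite /ell2norm (qf0 S Vf) sqrtr0.
have M0 : 0 < M by lra.
apply/ler_addgt0Pr => e e0; have e1 : 0 < e / (M * a) by rewrite divr_gt0// mulr_gt0.
have [n [s0 Hs na]] := fine_step a0 e1 Lfg.
set s := a / n.+1%:R in s0 Hs na.
have Hc : N (P s f \- f) <= s * (N g + e / (M * a)).
  have Vk : ell2 m (fun x => f x - s * g x) by exact: (qfB S Vf (qfZ S s Vg)).
  apply: le_trans (NB (VP (ltW s0) Vf) Vk Vf) _.
  have -> : (fun x => f x - s * g x) \- f = (fun x => - s * g x) by fext.
  by rewrite NZ// normrN gtr0_norm// mulrDr addrC lerD2l.
have := telescope (j := n.+1) M1 HM (ltW s0) _ Vf Hc; rewrite na => /(_ aT).
move/le_trans; apply; rewrite le_eqVlt; apply/orP; left; apply/eqP.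
have -> : n.+1%:R * (M * (s * (N g + e / (M * a)))) =
   (n.+1%:R * s) * M * (N g + e / (M * a)) by ring.
by rewrite na; field; rewrite !gt_eqF.
Qed.

(** Only the right derivative at time 0 is given, so the interval [0, a] is cut
    into [n] steps.  Each of them contributes the error of the difference
    quotient, arbitrarily small as the mesh shrinks, and the error of replacing
    [P a g] by [P (j * s) g], of second order by [semigroup_lipschitz]. *)
Lemma semigroup_euler_residual (T M a : R) f g h : 1 <= M ->
  (forall r f, 0 <= r <= T -> ell2 m f -> N (P r f) <= M * N f) ->
  0 <= a <= T -> L f g -> L g h ->
  N ((fun x => P a f x + a * P a g x) \- f) <= M ^+ 2 * a ^+ 2 * N h.
Proof.
move=> M1 HM /andP[a0 aT] Lfg Lgh.
have Vf := acc_ell2l HL Lfg; have Vg := acc_ell2r HL Lfg.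
move: a0; rewrite le_eqVlt => /orP[/eqP<-|a0].
  rewrite (semigroup0 HP)// expr0n /= mulr0 mul0r.
  have -> : (fun x => f x + 0 * P 0 g x) \- f = (fun=> 0) by fext.
  by rewrite /ell2norm (qf0 S Vf) sqrtr0.
have M0 : 0 < M by lra.
apply/ler_addgt0Pr => e e0; have e1 : 0 < e / (M * a) by rewrite divr_gt0// mulr_gt0.
have [n [s0 Hs na]] := fine_step a0 e1 Lfg.
set s := a / n.+1%:R in s0 Hs na; set e' := e / (M * a) in e1 Hs.
have VPag := VP (ltW a0) Vg.
pose D j := (fun x => P (j%:R * s) f x + j%:R * s * P a g x) \- f.
suff HD j : (j <= n.+1)%N -> N (D j) <= j%:R * s * (M * e' + M ^+ 2 * a * N h).
  have := HD _ (leqnn _); rewrite /D na => /le_trans; apply.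
  rewrite le_eqVlt; apply/orP; left; apply/eqP; rewrite /e'.
  by field; rewrite !gt_eqF.
elim: j => [_|j IH jn].
  rewrite /D !mul0r (semigroup0 HP)//.
  have -> : (fun x => f x + 0 * P a g x) \- f = (fun=> 0) by fext.
  by rewrite /ell2norm (qf0 S Vf) sqrtr0.
set t := j%:R * s; have t0 : 0 <= t by rewrite mulr_ge0// ltW.
have ta : t <= a by rewrite -na ler_wpM2r ?(ltW s0)// ler_nat ltnW.
have tT : 0 <= t <= T by rewrite t0 (le_trans ta).
have Ej : j.+1%:R * s = t + s by rewrite -natr1 /t; ring.
have VPs := VP (ltW s0) Vf.
have Vk : ell2 m (fun x => f x - s * g x) by exact: (qfB S Vf (qfZ S s Vg)).
have Vk' := qfB S VPs Vk.
have VDj : ell2 m (D j) by exact: (qfB S (qfD S (VP t0 Vf) (qfZ S t VPag)) Vf).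
have at0 : 0 <= a - t by rewrite subr_ge0.
have Vag := VP at0 Vg.
have E : D j.+1 = D j \+ (P t (P s f \- (fun x => f x - s * g x)) \+
    (fun x => s * P t (P (a - t) g \- g) x)).
  have Pta : P t (P (a - t) g) = P a g by rewrite -(semigroupD HP)// addrC subrK.
  rewrite /D Ej -/t (semigroupB t0 Vag Vg) Pta.
  rewrite (semigroupB t0 VPs Vk) (semigroupD HP t0 (ltW s0))//.
  have -> : (fun x => f x - s * g x) = (fun x => - s * g x + f x) by fext.
  rewrite semigroup_lin//; fext.
rewrite E; have V1 := VP t0 Vk'; have V2 := VP t0 (qfB S Vag Vg).
apply: le_trans (ND VDj (qfD S V1 (qfZ S s V2))) _.
apply: le_trans (lerD (IH (ltnW jn)) (ND V1 (qfZ S s V2))) _.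
rewrite Ej mulrDl lerD2l NZ// gtr0_norm// [leRHS]mulrDr; apply: lerD.
  apply: le_trans (HM _ _ tT Vk') _.
  by apply: le_trans (ler_wpM2l (ltW M0) Hs) _; rewrite mulrCA.
rewrite ler_pM2l//; apply: le_trans (HM _ _ tT (qfB S Vag Vg)) _.
have atT : 0 <= a - t <= T by rewrite at0/=; lra.
apply: le_trans (ler_wpM2l (ltW M0) (semigroup_lipschitz M1 HM atT Lgh)) _.
have -> : M * (M * (a - t) * N h) = M ^+ 2 * N h * (a - t) by ring.
have -> : M ^+ 2 * a * N h = M ^+ 2 * N h * a by ring.
by rewrite ler_wpM2l ?mulr_ge0 ?exprn_ge0 ?(ltW M0)//; lra.
Qed.

Lemma semigroup_euler_limit (t : R) : 0 < t -> euler_limit m L t (P t).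
Proof.
move=> t0; apply: (euler_limit_dense m_gt0 HL t0) => [f|f g||f g h Lfg Lgh].
- exact: (VP (ltW t0)).
- exact: (semigroupB (ltW t0)).
- exact: (semigroup_bounded HP (ltW t0)).
have [M M1 HM] := semigroup_bounded_on t; have M0 : 0 < M by lra.
have Vf := acc_ell2l HL Lfg; have Vg := acc_ell2r HL Lfg.
pose c := M ^+ 3 * t ^+ 2 * N h.
have c0 : 0 <= c by rewrite !mulr_ge0 ?exprn_ge0 ?(ltW M0)// ltW.
have main j : N (euler L t j f \- P t f) <= c / (2 ^ j)%:R.
  set n := (2 ^ j)%N; have n0 : (0 : R) < n%:R by rewrite ltr0n expn_gt0.
  pose s := t / n%:R; have s0 : 0 < s by rewrite divr_gt0.
  have ns : n%:R * s = t by rewrite mulrC divfK// gt_eqF.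
  have is0 i : 0 <= i%:R * s by rewrite mulr_ge0// ltW.
  pose v i := P (i%:R * s) f; pose w i := P (i%:R * s) g.
  have v0 : v 0 = f by rewrite /v mul0r (semigroup0 HP).
  have vn : v n = P t f by rewrite /v ns.
  rewrite NC; last 2 first.
  - by apply: (euler_ell2 HL).
  - exact: (VP (ltW t0)).
  rewrite /euler -/n -/s -vn -v0.
  have -> : c / n%:R = n%:R * (M * (M ^+ 2 * s ^+ 2 * N h)).
    by rewrite /c /s; field; rewrite gt_eqF.
  apply: (euler_stability m_gt0 HL s0 (g := w)); first by rewrite v0.
    by move=> i; apply: semigroup_op.
  move=> i iN; have Ps := VP (ltW s0) Vf; have Pg := VP (ltW s0) Vg.
  have Vk : ell2 m ((fun x => P s f x + s * P s g x) \- f).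
    exact: (qfB S (qfD S Ps (qfZ S s Pg)) Vf).
  have -> : (fun x => v i.+1 x + s * w i.+1 x) \- v i =
      P (i%:R * s) ((fun x => P s f x + s * P s g x) \- f).
    rewrite semigroupB//; last exact: (qfD S Ps (qfZ S s Pg)).
    have -> : (fun x => P s f x + s * P s g x) = (fun x => s * P s g x + P s f x) by fext.
    rewrite semigroup_lin// /v /w.
    have -> : i.+1%:R * s = i%:R * s + s by rewrite -natr1; ring.
    by rewrite !(semigroupD HP) ?(ltW s0)//; fext.
  have st : s <= t.
    by rewrite ler_pdivrMr// ler_peMr ?(ltW t0)// ler1n expn_gt0.
  apply: le_trans (HM _ _ _ Vk) _.
    by rewrite is0 -ns ler_wpM2r ?(ltW s0)// ler_nat ltnW.
  rewrite ler_wpM2l ?(ltW M0)//; apply: (semigroup_euler_residual M1 HM _ Lfg Lgh).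
  by rewrite (ltW s0).
exact: ell2_cvg_pow2 main.
Qed.

End SemigroupEuler.

(** * The Neumann operator *)

Section Symmetric.
Context {R : realType} {X : countType} (m : X -> R).
Hypothesis m_gt0 : forall x, 0 < m x.
Implicit Types (f g h u v : X -> R).
Context (L : (X -> R) -> (X -> R) -> Prop) (HL : m_accretive m L).

Local Notation ip := (polar (sqnorm m)).
Local Notation N := (ell2norm m).
Let S := sqnorm_quadform m_gt0.

Hypothesis L_sym : forall u g v h, L u g -> L v h -> ip g v = ip u h.

Lemma resolvent_sym (s : R) f g : 0 < s -> ell2 m f -> ell2 m g ->
  ip (resolvent L s f) g = ip f (resolvent L s g).
Proof.
move=> s0 Vf Vg; have Lu := resolvent_op HL s0 Vf; have Lv := resolvent_op HL s0 Vg.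
set u := resolvent L s f in Lu *; set v := resolvent L s g in Lv *.
have Vu := acc_ell2l HL Lu; have Vv := acc_ell2l HL Lv.
have := L_sym Lu Lv.
have -> : (fun x => s^-1 * (f x - u x)) = (fun x => s^-1 * (f \- u) x) by [].
have -> : (fun x => s^-1 * (g x - v x)) = (fun x => s^-1 * (g \- v) x) by [].
have Vfu := qfB S Vf Vu; have Vgv := qfB S Vg Vv.
rewrite (polarZl S)// (polarC S (f := u))//; last exact: (qfZ S).
rewrite (polarZl S)// => /(mulfI _) -/(_ (invr_neq0 (lt0r_neq0 s0))).
rewrite (polarBl S)// (polarBl S)// (polarC S Vv Vu) => /addIr ->.
by rewrite (polarC S).
Qed.

Lemma euler_sym (t : R) j f g : 0 < t -> ell2 m f -> ell2 m g ->
  ip (euler L t j f) g = ip f (euler L t j g).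
Proof.
move=> t0 Vf Vg; rewrite /euler; set s := t / _; have s0 : 0 < s.
  by rewrite divr_gt0// ltr0n expn_gt0.
clearbody s.
elim: (2 ^ j)%N f g Vf Vg => //= n IH f g Vf Vg.
have Vn := iter_resolvent_ell2 HL n s0 Vf.
rewrite resolvent_sym// IH//; last exact: (resolvent_ell2 HL).
by rewrite -iterSr.
Qed.

Lemma euler_limit_sym (t : R) P f g : 0 < t -> euler_limit m L t P ->
  ell2 m f -> ell2 m g -> ip (P f) g = ip f (P g).
Proof.
move=> t0 HP Vf Vg; have [Vf' cf] := HP _ Vf; have [Vg' cg] := HP _ Vg.
apply/eqP; rewrite -subr_eq0 -normr_le0; apply/ler_addgt0Pr => e e0; rewrite add0r.
have Nf0 : 0 <= N f by exact: sqrtr_ge0.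
have Ng0 : 0 <= N g by exact: sqrtr_ge0.
have c0 : 0 < N f + N g + 1 by lra.
have ec : 0 < e / (N f + N g + 1) by rewrite divr_gt0.
have [K1 H1] := cf _ ec; have [K2 H2] := cg _ ec.
have {H1} := H1 _ (leq_maxl K1 K2); have {H2} := H2 _ (leq_maxr K1 K2).
set n := maxn K1 K2 => h2 h1.
have VEf := euler_ell2 HL n t0 Vf; have VEg := euler_ell2 HL n t0 Vg.
have -> : ip (P f) g - ip f (P g) =
    ip (euler L t n g \- P g) f - ip (euler L t n f \- P f) g.
  rewrite !(polarBl S)// (euler_sym n t0 Vf Vg) (polarC S VEg Vf) (polarC S Vg' Vf).
  by ring.
apply: le_trans (ler_normB _ _) _.
apply: le_trans (lerD (polar_le_qnorm S (qfB S VEg Vg') Vf)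
                      (polar_le_qnorm S (qfB S VEf Vf') Vg)) _.
apply: le_trans (lerD (ler_wpM2r Nf0 h2) (ler_wpM2r Ng0 h1)) _.
rewrite -mulrDr -mulrA ler_piMr ?(ltW e0)// mulrC ler_pdivrMr// mul1r; lra.
Qed.

End Symmetric.

Section Neumann.
Context {R : realType} {X : countType} (G : graph R X) (m : X -> R).
Hypothesis m_gt0 : forall x, 0 < m x.
Implicit Types (f g h u v : X -> R).

Local Notation ip := (polar (sqnorm m)).
Local Notation N := (ell2norm m).
Local Notation E := (polar (energy G)).
Let S := sqnorm_quadform m_gt0.
Let QE := domN_energy_quadform G m_gt0.
Let L := neumann_operator G m.

Let domN2 f : domN G m f -> ell2 m f. Proof. by case. Qed.

Lemma neumann_sym u g v h : L u g -> L v h -> ip g v = ip u h.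
Proof.
move=> [Du Vg Eu] [Dv Vh Ev]; rewrite -Eu// (polarC S (domN2 Du) Vh) -Ev//.
exact: (polarC QE).
Qed.

Lemma neumann_surj (s : R) f : 0 < s -> ell2 m f ->
  exists2 u, ell2 m u & L u (fun x => s^-1 * (f x - u x)).
Proof.
move=> s0 Vf; have Qs := scaled_form_quadform G m_gt0 (ltW s0).
have D0 : domN G m (fun=> 0).
  by apply: (Cc_domN G m_gt0); exact: Cc0.
have [||||u Du Hu] := riesz_representation Qs (l := fun h => ip f h) (C := sqnorm m f) D0.
- exact: domN_complete.
- by move=> r h k Dh Dk; rewrite (polar_linr S)//; exact: domN2.
- exact: (qf_ge0 S).
- move=> h Dh; apply: le_trans (polar_cs S Vf (domN2 Dh)) _.
  rewrite ler_wpM2l ?(qf_ge0 S)// /scaled_form lerDr mulr_ge0 ?(ltW s0)//.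
  exact: (qf_ge0 QE).
have Vu := domN2 Du; have Vd := qfB S Vf Vu.
exists u => //; split=> //; first exact: (qfZ S _ Vd).
move=> h Dh; rewrite (polarZl S _ Vd (domN2 Dh)) (polarBl S Vf Vu (domN2 Dh)).
rewrite -Hu// /scaled_form polar_comb addrK mulrA mulVf ?mul1r//.
by rewrite gt_eqF.
Qed.

(** With [v = (f - u) / s] one has [polar (energy G) u (f - u) = s |v|^2]. *)
Lemma neumann_resolvent_close (s : R) f u : 0 < s -> domN G m f ->
  L u (fun x => s^-1 * (f x - u x)) ->
  [/\ energy G u <= energy G f & sqnorm m (f \- u) <= s * energy G f].
Proof.
move=> s0 Df [Du Vg Hu]; have Dd := qfB QE Df Du.
have Vd := domN2 Dd.
have := Hu _ Dd.
have -> : (fun x => s^-1 * (f x - u x)) = (fun x => s^-1 * (f \- u) x) by [].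
rewrite (polarZl S)// (polarxx S)// (polarBr QE)// (polarxx QE)// => e.
have d0 := qf_ge0 S Vd.
have u0 := qf_ge0 QE Du; have := qf_ge0 QE Dd; rewrite (qf_expandB QE)// (polarC QE)// => H.
have sd : 0 <= s^-1 * sqnorm m (f \- u) by rewrite mulr_ge0// invr_ge0 ltW.
split; first lra.
by rewrite -ler_pdivrMl//; lra.
Qed.

Lemma neumann_accretive : m_accretive m L.
Proof.
split.
- by move=> u g [Du Vg _]; split=> //; exact: domN2.
- move=> r u g v h [Du Vg Hu] [Dv Vh Hv]; split.
  + exact: (qf_lin QE).
  + exact: (qf_lin S).
  + move=> k Dk; rewrite (polar_linl QE)// (polar_linl S)//; last exact: domN2.
    by rewrite Hu// Hv.
- by move=> u g [Du Vg Hu]; rewrite -Hu// (polarxx QE)// (qf_ge0 QE).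
- exact: neumann_surj.
- move=> f e Vf e0; have e20 : 0 < e / 2 by rewrite divr_gt0.
  have [g Cg fg] := Cc_dense m_gt0 Vf e20; have Dg := Cc_domN G m_gt0 Cg.
  have q0 := qf_ge0 QE Dg; have q1 : 0 < energy G g + 1 by lra.
  pose s := (e / 2) ^+ 2 / (energy G g + 1).
  have s0 : 0 < s by rewrite divr_gt0 ?exprn_gt0.
  have [u Vu Lu] := neumann_surj s0 (domN2 Dg); exists u; eexists; split; first exact: Lu.
  have [_ H] := neumann_resolvent_close s0 Dg Lu.
  apply: le_trans (qnormB S Vf (domN2 Dg) Vu) _.
  have : qnorm (sqnorm m) (g \- u) <= e / 2.
    rewrite -ler_sqr ?nnegrE ?sqrtr_ge0 ?(ltW e20)// (sqr_qnorm S); last first.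
      exact: (qfB S (domN2 Dg)).
    apply: le_trans H _; rewrite /s -mulrA ler_piMr ?exprn_ge0 ?(ltW e20)//.
    by rewrite mulrC ler_pdivrMr ?mul1r ?lerDl.
  by move: fg; rewrite /ell2norm -/(qnorm _ _); lra.
Qed.

Let HL := neumann_accretive.

(** Discrete form of [2 t * energy (P t f) <= sqnorm f]: the scheme loses at
    least [2 s * energy] of squared norm per step and the energy decreases. *)
Lemma iter_resolvent_energy (s : R) n f : 0 < s -> ell2 m f ->
  2 * n%:R * s * energy G (iter n (resolvent L s) f) <=
  sqnorm m f - sqnorm m (iter n (resolvent L s) f).
Proof.
move=> s0 Vf; elim: n => [|n IH]; first by rewrite mulr0 !mul0r subrr.
have Vu := iter_resolvent_ell2 HL n s0 Vf; set u := iter n _ _ in IH Vu.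
rewrite iterS -/u; have Lv := resolvent_op HL s0 Vu.
set v := resolvent L s u in Lv *; have [Dv Vg Hv] := Lv.
have Vv := domN2 Dv; have Vd := qfB S Vu Vv.
have dec : n%:R * energy G v <= n%:R * energy G u.
  case: n @u v Lv Dv {IH Vg Hv Vv Vd} Vu => [|n] u v Lv Dv Vu; first by rewrite !mul0r.
  rewrite ler_pM2l ?ltr0n//;
  have [Du _ _] : L u _ := resolvent_op HL s0 (iter_resolvent_ell2 HL n s0 Vf).
  by have [] := neumann_resolvent_close s0 Du Lv.
have := Hv _ Dv.
have -> : (fun x => s^-1 * (u x - v x)) = (fun x => s^-1 * (u \- v) x) by [].
rewrite (polarxx QE)// (polarZl S)// (polarBl S)// (polarxx S)// => ev.
have loss : 2 * (s * energy G v) <= sqnorm m u - sqnorm m v.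
  have -> : s * energy G v = ip u v - sqnorm m v.
    by rewrite ev mulrA mulfV ?mul1r ?gt_eqF.
  by have := qf_ge0 S Vd; rewrite (qf_expandB S)//; lra.
have := ler_wpM2l (ltW s0) dec; rewrite -natr1; nra.
Qed.

Lemma neumann_limit_energy (t : R) P f : 0 < t -> euler_limit m L t P ->
  ell2 m f -> domN G m (P f) /\ 2 * t * energy G (P f) <= sqnorm m f.
Proof.
move=> t0 HP Vf; have [VP cP] := HP _ Vf; have t20 : 0 < 2 * t by lra.
have VE j := euler_ell2 HL j t0 Vf.
have [fE fE'] : finite_energy G (P f) /\ energy G (P f) <= sqnorm m f / (2 * t).
  apply: (@energy_lsc _ _ _ (fun j => euler L t j f)).
    exact: (ell2_cvg_pointwise m_gt0 VE VP cP).
  exists 0%N => j _; rewrite /euler; have p0 : (0 : R) < (2 ^ j)%:R by rewrite ltr0n expn_gt0.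
  have s0 : 0 < t / (2 ^ j)%:R by rewrite divr_gt0.
  split.
    have : (0 < 2 ^ j)%N by rewrite expn_gt0.
    case: (2 ^ j)%N s0 => // n s0 _; rewrite iterS.
    have [[]] : L _ _ := resolvent_op HL s0 (iter_resolvent_ell2 HL n s0 Vf).
    by [].
  rewrite ler_pdivlMr//; have := iter_resolvent_energy (2 ^ j) s0 Vf.
  have -> : 2 * (2 ^ j)%:R * (t / (2 ^ j)%:R) = 2 * t by field; rewrite gt_eqF.
  rewrite mulrC => /le_trans; apply; rewrite gerBl.
  by apply: (qf_ge0 S); exact: (iter_resolvent_ell2 HL).
by split=> //; rewrite mulrC -ler_pdivlMr.
Qed.

End Neumann.

(** * The Feller property forces the two domains to agree *)

Section Truncation.
Context {R : realType}.

Definition clip (d r : R) : R := if d < r then d else if r < - d then - d else r.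

Lemma clip_le (d r : R) : 0 < d -> `|clip d r| <= d.
Proof.
move=> d0; rewrite /clip ler_norml; case: (ltP d r) => ?; first by lra.
by case: (ltP r (- d)) => ?; lra.
Qed.

Lemma clip_contr (d r r' : R) : 0 < d -> `|clip d r - clip d r'| <= `|r - r'|.
Proof.
move=> d0; rewrite /clip; case: (ltP d r) => ?; case: (ltP d r') => ?;
  case: (ltP r (- d)) => ?; case: (ltP r' (- d)) => ?;
  case: (ger0P (r - r')) => ?; rewrite ?ler_norml; lra.
Qed.

Lemma clip_id (d r : R) : `|r| <= d -> clip d r = r.
Proof.
rewrite ler_norml /clip => /andP[? ?]; case: (ltP d r) => ?; first by lra.
by case: (ltP r (- d)) => ?; lra.
Qed.

End Truncation.

Section FellerDomain.
Context {R : realType} {X : countType} (G : graph R X) (m : X -> R).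
Hypothesis m_gt0 : forall x, 0 < m x.
Implicit Types (f g h u v : X -> R).

Local Notation ip := (polar (sqnorm m)).
Local Notation N := (ell2norm m).
Local Notation E := (polar (energy G)).
Let S := sqnorm_quadform m_gt0.
Let QE := domN_energy_quadform G m_gt0.
Let Q1 := scaled_form_quadform G m_gt0 ler01.
Let L := neumann_operator G m.
Let HL := neumann_accretive G m_gt0.

Let domN2 f : domN G m f -> ell2 m f. Proof. by case. Qed.

(** Subtracting from [u] its truncation at a small height leaves a finitely
    supported function; the truncation is a normal contraction of [u] and
    uniformly small, so its form norm is small. *)
Lemma C0_domN_domD u : C0 u -> domN G m u -> domD G m u.
Proof.
move=> C0u Du; split=> // e e0; have [Eu Vu] := Du.
have w0 := @energy_weight_ge0 _ _ G.
have e1 : 0 < e ^+ 2 / 4 by rewrite divr_gt0 ?exprn_gt0.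
have Wu : (wsq (energy_weight G) (energy_vec u) < +oo)%E.
  by move: Eu; rewrite finite_energyE.
have Wu2 : (wsq m u < +oo)%E by move: Vu; rewrite /ell2 /= sqnorm_erealE.
have [d1 d10 H1] := wsq_small w0 Wu e1.
have [d2 d20 H2] := wsq_small (fun x => ltW (m_gt0 x)) Wu2 e1.
pose d := Num.min (d1 / 2) d2.
have d0 : 0 < d by rewrite lt_min d20 divr_gt0.
have dd1 : d <= d1 / 2 by rewrite ge_min lexx.
have dd2 : d <= d2 by rewrite ge_min lexx orbT.
pose k x := clip d (u x); pose g := u \- k.
have kd x : `|k x| <= d by exact: clip_le.
have ku x : `|k x| <= `|u x|.
  have := clip_contr (u x) 0 d0; rewrite (_ : clip d 0 = 0) ?subr0//.
  by rewrite clip_id// normr0 ltW.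
have Wk : (wsq (energy_weight G) (energy_vec k) <= (e ^+ 2 / 4)%:E)%E.
  apply: H1 => -[p|x] //=; first exact: clip_contr.
    by apply: le_trans (ler_normB _ _) _; have := kd p.1; have := kd p.2; lra.
  by have := kd x; lra.
have Wk2 : (wsq m k <= (e ^+ 2 / 4)%:E)%E.
  by apply: H2 => // x; apply: le_trans (kd x) _.
have Dk : domN G m k.
  split; last by apply: ell2_le Vu.
  by rewrite finite_energyE /wdom /= (le_lt_trans Wk)// ltry.
have Ek : energy G k <= e ^+ 2 / 4.
  case: Dk => fk _; rewrite energyE// -lee_fin /wform -wsq_fine//.
  by rewrite (le_lt_trans Wk)// ltry.
have Nk : sqnorm m k <= e ^+ 2 / 4.
  rewrite -lee_fin /sqnorm sqnorm_erealE -wsq_fine// ?(le_lt_trans Wk2) ?ltry//.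
  by move=> x; exact: ltW.
exists g.
  have [h Ch uh] := C0u _ d0; apply: sub_finite_set Ch => x /=.
  apply: contra_neq => hx; have := uh x; rewrite hx subr0 => ud.
  by rewrite /g /k /= clip_id// subrr.
have -> : u \- g = k by rewrite /g; fext.
rewrite form_normE; apply: (@le_lt_trans _ _ (Num.sqrt (e ^+ 2 / 2))).
  by rewrite /qnorm ler_wsqrtr// /scaled_form mul1r; lra.
rewrite -[ltRHS]ger0_norm ?(ltW e0)// -sqrtr_sqr ltr_sqrt ?exprn_gt0//.
by have := exprn_gt0 2 e0; lra.
Qed.

Context (P : R -> (X -> R) -> X -> R) (HP : exp_semigroup m L P).

Let lim t : 0 < t -> euler_limit m L t (P t).
Proof. exact: (semigroup_euler_limit m_gt0 HP HL). Qed.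

(** The smoothing estimate makes [P t] continuous from l^2(X, m) to the form
    norm, in which the Dirichlet domain is closed. *)
Lemma semigroup_Cc_domD (t : R) : 0 < t ->
  (forall f, Cc f -> domD G m (P t f)) -> forall f, ell2 m f -> domD G m (P t f).
Proof.
move=> t0 H f Vf; have [DPf _] := neumann_limit_energy m_gt0 t0 (lim t0) Vf.
apply: (domD_closed m_gt0 DPf) => e e0; pose c := (2 * t)^-1 + 1.
have c0 : 0 < c by rewrite addr_gt0 ?invr_gt0//; lra.
pose d := e / 2 / Num.sqrt c; have sc : 0 < Num.sqrt c by rewrite sqrtr_gt0.
have d0 : 0 < d by rewrite !divr_gt0.
have [g Cg fg] := Cc_dense m_gt0 Vf d0; have Vg := Cc_ell2 m_gt0 Cg.
exists (P t g); first exact: H.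
have Vfg := qfB S Vf Vg; rewrite -(semigroupB HP (ltW t0) Vf Vg).
have [DPd Ed] := neumann_limit_energy m_gt0 t0 (lim t0) Vfg.
have Nd : N (P t (f \- g)) <= N (f \- g).
  rewrite (semigroupB HP (ltW t0) Vf Vg).
  exact: (euler_limitB_contr m_gt0 HL t0 (lim t0)).
rewrite form_normE; apply: (@le_lt_trans _ _ (e / 2)); last by lra.
rewrite -ler_sqr ?nnegrE ?sqrtr_ge0 ?(divr_ge0 (ltW e0))// (sqr_qnorm Q1)//.
have Nd2 : sqnorm m (P t (f \- g)) <= sqnorm m (f \- g).
  by rewrite -!(sqr_qnorm S) ?ler_sqr ?nnegrE ?sqrtr_ge0//; exact: domN2.
apply: (@le_trans _ _ (c * sqnorm m (f \- g))).
  rewrite /scaled_form mul1r /c mulrDl mul1r lerD//.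
  by rewrite ler_pdivlMl//; lra.
rewrite -(sqr_qnorm S Vfg) -(sqr_sqrtr (ltW c0)) -exprMn.
have e20 : 0 <= e / 2 by rewrite divr_ge0// ltW.
rewrite ler_sqr ?nnegrE//; last by rewrite mulr_ge0 ?sqrtr_ge0.
by rewrite mulrC -ler_pdivlMr.
Qed.

(** [P t] is injective for symmetric semigroups: [<P t h, h>] is the squared
    norm of [P (t / 2) h]. *)
Lemma semigroup_injective (t : R) h : 0 < t -> ell2 m h ->
  ip (P t h) h = 0 -> h = (fun=> 0).
Proof.
move=> t0 Vh Ph.
have half (s : R) : 0 < s -> ip (P s h) h = 0 -> P (s / 2) h = (fun=> 0).
  move=> s0; have s20 : 0 < s / 2 by rewrite divr_gt0.
  have V2 := euler_limit_ell2 (lim s20) Vh.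
  have {1}-> : s = s / 2 + s / 2 by lra.
  rewrite (semigroupD HP) ?(ltW s20)//.
  rewrite (euler_limit_sym m_gt0 HL (@neumann_sym _ _ G _ m_gt0) s20 (lim s20) V2 Vh).
  by rewrite (polarxx S V2); exact: sqnorm_eq0.
have z n : ip (P (t / 2 ^+ n) h) h = 0.
  elim: n => [|n IH]; first by rewrite expr0 divr1.
  have p0 : 0 < t / 2 ^+ n by rewrite divr_gt0// exprn_gt0.
  rewrite exprSr invfM mulrA (half _ p0 IH).
  have -> : (fun=> 0 : R) = (fun x => 0 * h x) :> (X -> R) by fext.
  by rewrite (polarZl S)// mul0r.
apply: (sqnorm_eq0 m_gt0 Vh); rewrite -(sqr_qnorm S Vh).
suff -> : qnorm (sqnorm m) h = 0 by rewrite expr0n.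
apply/eqP; rewrite eq_le sqrtr_ge0 andbT; apply/ler_addgt0Pr => e e0; rewrite add0r.
have [d d0 Hd] := at_right0_eps (semigroup_continuous HP Vh) e0.
have : (fun n => (2^-1) ^+ n : R) @ \oo --> (0 : R).
  by apply: cvg_expr; rewrite ger0_norm// invf_lt1// ltr1n.
have dt : 0 < d / t / 2 by rewrite !divr_gt0.
move=> /cvg_eps/(_ _ dt)[K /(_ K (leqnn K))]; rewrite subr0 ger0_norm ?exprn_ge0//.
move=> hK; have p0 : 0 < t / 2 ^+ K by rewrite divr_gt0// exprn_gt0.
have p20 : 0 < t / 2 ^+ K / 2 by rewrite divr_gt0.
have : N (P (t / 2 ^+ K / 2) h \- h) <= e.
  have := Hd _ p20; rewrite ger0_norm ?sqrtr_ge0//; apply.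
  have : t * (2^-1) ^+ K <= t * (d / t / 2) by rewrite ler_pM2l.
  rewrite exprVn => ?; apply: (@le_lt_trans _ _ (t * (d / t / 2) / 2)).
    by rewrite ler_pM2r.
  have -> : t * (d / t / 2) / 2 = d / 4 by field; rewrite gt_eqF.
  lra.
rewrite (half _ p0 (z K)).
have -> : (fun=> 0) \- h = (fun x => -1 * h x) by fext.
by rewrite /ell2norm -/(qnorm _ _) (qnormZ S)// normrN1 mul1r.
Qed.

(** A vector that is form-orthogonal to [domD G m] annihilates the range of
    [P t], hence vanishes. *)
Lemma feller_domN_sub_domD : feller P -> domN G m `<=` domD G m.
Proof.
move=> [t t0 CcC0] u Du.
have range f : ell2 m f -> domD G m (P t f).
  apply: semigroup_Cc_domD => // k Ck; apply: C0_domN_domD; first exact: CcC0.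
  by have [] := neumann_limit_energy m_gt0 t0 (lim t0) (Cc_ell2 m_gt0 Ck).
have QD := domD_quadform G m_gt0.
have D0 : domD G m (fun=> 0).
  by apply: (Cc_domD G m_gt0); exact: Cc0.
have [||||p Dp Hp] := riesz_representation QD
    (l := fun h => polar (scaled_form G m 1) u h) (C := scaled_form G m 1 u) D0.
- exact: domD_complete.
- by move=> r f g [Df _] [Dg _]; rewrite (polar_linr Q1).
- exact: (qf_ge0 Q1).
- by move=> h [Dh _]; exact: (polar_cs Q1).
have Np := domD_sub Dp; have Dd := qfB Q1 Du Np; have Vd := domN2 Dd.
have orth h : domD G m h -> polar (scaled_form G m 1) h (u \- p) = 0.
  move=> Dh; have Nh := domD_sub Dh.
  by rewrite (polarC Q1)// (polarBl Q1)// Hp// subrr.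
suff zero : u \- p = (fun=> 0).
  have -> : u = p; last by [].
  apply/funext => x; have := congr1 (fun k => k x) zero => /= /eqP.
  by rewrite subr_eq0 => /eqP.
apply: (semigroup_injective t0 Vd).
have Lf := resolvent_op HL ltr01 Vd; set f := resolvent _ _ _ in Lf.
set g := (fun x => _) in Lf; have Vf := acc_ell2l HL Lf; have Vg := acc_ell2r HL Lf.
have fg : u \- p = (fun x => 1 * f x + g x).
  by rewrite /g; apply/funext => x; field.
have [_ _ EP] := semigroup_op m_gt0 HP (ltW t0) Lf.
have := orth _ (range _ Vf); rewrite /scaled_form polar_comb mul1r EP//.
rewrite {3}fg (semigroup_lin HP)// ?ltW// => <-.
have Vf' := euler_limit_ell2 (lim t0) Vf; have Vg' := euler_limit_ell2 (lim t0) Vg.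
by rewrite (polar_linl S)// mul1r addrC.
Qed.

End FellerDomain.

(** * Convergence along increasing graphs *)

Section TrotterKato.
Context {R : realType} {X : countType} (m : X -> R).
Hypothesis m_gt0 : forall x, 0 < m x.
Implicit Types (f g h u v : X -> R).
Context (Ln : nat -> (X -> R) -> (X -> R) -> Prop)
  (L : (X -> R) -> (X -> R) -> Prop)
  (HLn : forall k, m_accretive m (Ln k)) (HL : m_accretive m L).
Hypothesis res_cvg : forall (s : R) f, 0 < s -> ell2 m f ->
  ell2_cvg m (fun k => resolvent (Ln k) s f) (resolvent L s f).

Local Notation N := (ell2norm m).
Let S := sqnorm_quadform m_gt0.
Let NB f g h : ell2 m f -> ell2 m g -> ell2 m h -> N (f \- h) <= N (f \- g) + N (g \- h).
Proof. exact: (qnormB S). Qed.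
Let NC f g : ell2 m f -> ell2 m g -> N (f \- g) = N (g \- f).
Proof. exact: (qnormBC S). Qed.

Lemma resolvent_cvg_seq (s : R) (u : nat -> X -> R) v : 0 < s ->
  (forall k, ell2 m (u k)) -> ell2 m v -> ell2_cvg m u v ->
  ell2_cvg m (fun k => resolvent (Ln k) s (u k)) (resolvent L s v).
Proof.
move=> s0 Vu Vv uv e e0; have e20 : 0 < e / 2 by rewrite divr_gt0.
have [K1 H1] := uv _ e20; have [K2 H2] := res_cvg s0 Vv e20.
exists (maxn K1 K2) => k; rewrite geq_max => /andP[/H1 h1 /H2 h2].
have V1 := resolvent_ell2 (HLn k) s0 (Vu k); have V2 := resolvent_ell2 (HLn k) s0 Vv.
have V3 := resolvent_ell2 HL s0 Vv.
apply: le_trans (NB V1 V2 V3) _; rewrite -(resolventB m_gt0 (HLn k))//.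
have := resolvent_contr m_gt0 (HLn k) s0 (qfB S (Vu k) Vv); lra.
Qed.

Lemma euler_cvg (t : R) j f : 0 < t -> ell2 m f ->
  ell2_cvg m (fun k => euler (Ln k) t j f) (euler L t j f).
Proof.
move=> t0 Vf; rewrite /euler; set s := t / _; have s0 : 0 < s.
  by rewrite divr_gt0// ltr0n expn_gt0.
elim: (2 ^ j)%N => [|n IH].
  move=> e e0; exists 0%N => k _ /=; have -> : f \- f = (fun=> 0) by fext.
  by rewrite /ell2norm (qf0 S Vf) sqrtr0 ltW.
apply: resolvent_cvg_seq IH => //.
  by move=> k; exact: (iter_resolvent_ell2 (HLn k)).
exact: (iter_resolvent_ell2 HL).
Qed.

(** Trotter-Kato: convergence of the resolvents implies convergence of the
    semigroups.  A vector [f0] of the domain of [L ^ 2] is approximated by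
    [(1 + Ln k)^-2 (1 + L)^2 f0], on which [Ln k ^ 2] is bounded in [k], so that
    the Euler scheme converges uniformly in [k]. *)
Lemma trotter_kato (t : R) Pn P f : 0 < t ->
  (forall k, euler_limit m (Ln k) t (Pn k)) -> euler_limit m L t P ->
  ell2 m f -> ell2_cvg m (fun k => Pn k f) (P f).
Proof.
move=> t0 HPn HP Vf e e0; have e8 : 0 < e / 8 by rewrite divr_gt0.
have [f0 [g0 [h0 [Lfg Lgh ff0]]]] := acc_dense2 m_gt0 HL Vf e8.
have V0 := acc_ell2l HL Lfg; have Vg0 := acc_ell2l HL Lgh; have Vh0 := acc_ell2r HL Lgh.
pose p0 := f0 \+ g0; pose q := p0 \+ (g0 \+ h0).
have Vp0 := qfD S V0 Vg0; have Vq : ell2 m q := qfD S Vp0 (qfD S Vg0 Vh0).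
have Rp : resolvent L 1 p0 = f0.
  by apply: (resolvent_unique m_gt0 HL ltr01 Lfg); rewrite /p0; fext.
have Rq : resolvent L 1 q = p0.
  have := acc_lin HL 1 Lfg Lgh.
  have -> : (fun x => 1 * f0 x + g0 x) = p0 by rewrite /p0; fext.
  move=> Lp; apply: (resolvent_unique m_gt0 HL ltr01 Lp); rewrite /q; fext.
pose fk k := resolvent (Ln k) 1 (resolvent (Ln k) 1 q).
have Vr k : ell2 m (resolvent (Ln k) 1 q) by exact: (resolvent_ell2 (HLn k)).
have Vfk k : ell2 m (fk k) by exact: (resolvent_ell2 (HLn k)).
have cfk : ell2_cvg m fk f0.
  by rewrite -Rp -Rq; apply: resolvent_cvg_seq => //; [rewrite Rq|apply: res_cvg].
have Lk k : exists g h, [/\ Ln k (fk k) g, Ln k g h & N h <= 4 * N q].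
  have L1 := resolvent_op (HLn k) ltr01 Vq; have L2 := resolvent_op (HLn k) ltr01 (Vr k).
  set r := resolvent (Ln k) 1 q in L1 L2; rewrite -/(fk k) in L2.
  have Nr : N r <= N q by exact: (resolvent_contr m_gt0 (HLn k) ltr01 Vq).
  have Nf : N (fk k) <= N q.
    by apply: le_trans Nr; exact: (resolvent_contr m_gt0 (HLn k) ltr01 (Vr k)).
  have e1 : (fun x => 1^-1 * (r x - fk k x)) = r \- fk k.
    by apply/funext => x /=; rewrite invr1 mul1r.
  have e2 : (fun x => 1^-1 * (q x - r x)) = q \- r.
    by apply/funext => x /=; rewrite invr1 mul1r.
  rewrite e1 in L2; rewrite e2 in L1.
  exists (r \- fk k), ((q \- r) \- (r \- fk k)); split=> //.
    have := acc_lin (HLn k) (-1) L2 L1.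
    have -> : (fun x => -1 * fk k x + r x) = r \- fk k by fext.
    by have -> : (fun x => -1 * (r \- fk k) x + (q \- r) x) = (q \- r) \- (r \- fk k) by fext.
  have sub a b : ell2 m a -> ell2 m b -> N (a \- b) <= N a + N b.
    move=> Va Vb; have -> : a \- b = a \+ (fun x => -1 * b x) by fext.
    apply: le_trans (qnormD S Va (qfZ S _ Vb)) _.
    by rewrite (qnormZ S)// normrN1 mul1r.
  have := sub _ _ (qfB S Vq (Vr k)) (qfB S (Vr k) (Vfk k)).
  by have := sub _ _ Vq (Vr k); have := sub _ _ (Vr k) (Vfk k); rewrite -/r; lra.
pose c := t ^+ 2 / 2 * (4 * N q + N h0).
have Nq : 0 <= N q by exact: sqrtr_ge0.
have Nh : 0 <= N h0 by exact: sqrtr_ge0.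
have c0 : 0 <= c by rewrite mulr_ge0 ?divr_ge0 ?sqr_ge0//; lra.
have ec : 0 < e / 8 / (c + 1) by rewrite divr_gt0//; lra.
have [j /(_ j (leqnn j)) hj] := inv_pow2_small ec.
have {}hj : c / (2 ^ j)%:R <= e / 8.
  move: hj; rewrite ler_pdivlMr; last by lra.
  have : 0 <= (2 ^ j)%:R^-1 :> R by rewrite invr_ge0.
  by move=> *; lra.
have pj : 0 <= (2 ^ j)%:R^-1 :> R by rewrite invr_ge0.
have cle a : a <= 4 * N q + N h0 -> t ^+ 2 / 2 / (2 ^ j)%:R * a <= e / 8.
  move=> ha; apply: le_trans hj; rewrite mulrAC ler_wpM2r// /c.
  by rewrite ler_wpM2l ?divr_ge0 ?sqr_ge0.
have [K1 H1] := cfk _ e8; have [K2 H2] := euler_cvg j t0 V0 e8.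
exists (maxn K1 K2) => k; rewrite geq_max => /andP[/H1 h1 /H2 h2].
have VE1 := euler_ell2 (HLn k) j t0 (Vfk k); have VE2 := euler_ell2 (HLn k) j t0 V0.
have VE3 := euler_ell2 HL j t0 V0.
have VP1 := euler_limit_ell2 (HPn k) Vf; have VP2 := euler_limit_ell2 (HPn k) (Vfk k).
have VP3 := euler_limit_ell2 HP V0; have VP4 := euler_limit_ell2 HP Vf.
apply: le_trans (NB VP1 VP2 VP4) _.
have := NB VP2 VE1 VP4; have := NB VE1 VE2 VP4; have := NB VE2 VE3 VP4.
have := NB VE3 VP3 VP4.
have := euler_limitB_contr m_gt0 (HLn k) t0 (HPn k) Vf (Vfk k).
have := NB Vf V0 (Vfk k); rewrite (NC V0 (Vfk k)).
have := euler_limitB_contr m_gt0 HL t0 HP V0 Vf; rewrite (NC V0 Vf).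
have := euler_contr m_gt0 (HLn k) j t0 (qfB S (Vfk k) V0).
rewrite (eulerB m_gt0 (HLn k) j t0 (Vfk k) V0) (NC VP2 VE1).
have [g [h [Lg Lh Nh4]]] := Lk k.
have := euler_limit_rate m_gt0 (HLn k) t0 (HPn k) j Lg Lh.
have := euler_limit_rate m_gt0 HL t0 HP j Lfg Lgh.
have := cle (N h); have := cle (N h0) => c1 c2.
have {}c1 : t ^+ 2 / 2 / (2 ^ j)%:R * N h0 <= e / 8 by apply: c1; lra.
have {}c2 : t ^+ 2 / 2 / (2 ^ j)%:R * N h <= e / 8 by apply: c2; lra.
move=> i1 i2 i3 i4 i5 i6 i7 i8 i9 i10.
have {}i1 := le_trans i1 c1; have {}i2 := le_trans i2 c2.
by clear -h1 h2 ff0 i1 i2 i3 i4 i5 i6 i7 i8 i9 i10 e0; lra.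
Qed.

End TrotterKato.

Section MonotoneGraphs.
Context {R : realType} {X : countType} (m : X -> R).
Hypothesis m_gt0 : forall x, 0 < m x.
Implicit Types (f g h u v : X -> R) (G : graph R X).

Local Notation ip := (polar (sqnorm m)).
Local Notation N := (ell2norm m).
Let S := sqnorm_quadform m_gt0.

(** [u] minimizes the right-hand side over [v]; the inequality also measures how
    far a competitor is from [u]. *)
Lemma neumann_minimizer G (s : R) f u v : 0 < s -> ell2 m f -> domN G m v ->
  neumann_operator G m u (fun x => s^-1 * (f x - u x)) ->
  s * energy G u + sqnorm m (u \- f) + sqnorm m (v \- u) <=
  s * energy G v + sqnorm m (v \- f).
Proof.
move=> s0 Vf Dv [Du Vg Hu]; have QE := domN_energy_quadform G m_gt0.
have [_ Vu] := Du; have [_ Vv] := Dv; have Dw := qfB QE Dv Du; have [_ Vw] := Dw.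
have Vuf := qfB S Vu Vf.
have ev : energy G v = energy G u + 2 * polar (energy G) u (v \- u) + energy G (v \- u).
  have {1}-> : v = (fun x => 1 * (v \- u) x + u x) by fext.
  by rewrite (qf_expand QE)//; ring.
have nv : sqnorm m (v \- f) =
    sqnorm m (u \- f) + 2 * ip (u \- f) (v \- u) + sqnorm m (v \- u).
  have -> : v \- f = (fun x => 1 * (v \- u) x + (u \- f) x) by fext.
  by rewrite (qf_expand S)//; ring.
have := Hu _ Dw.
have -> : (fun x => s^-1 * (f x - u x)) = (fun x => - s^-1 * (u \- f) x) by fext.
rewrite (polarZl S)// => eu.
have {}eu : s * polar (energy G) u (v \- u) = - ip (u \- f) (v \- u).
  by rewrite eu mulNr mulrN mulrA mulfV ?mul1r// gt_eqF.
have := mulr_ge0 (ltW s0) (qf_ge0 QE Dw).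
rewrite ev nv; lra.
Qed.

Lemma energy_mono G G' f :
  (forall x y, edge G x y <= edge G' x y) ->
  (forall x, killing G x <= killing G' x) ->
  finite_energy G' f -> finite_energy G f /\ energy G f <= energy G' f.
Proof.
move=> eG kG ff.
have W : (wsq (energy_weight G) (energy_vec f) <= wsq (energy_weight G') (energy_vec f))%E.
  apply: le_esum => i _; rewrite lee_fin ler_wpM2r ?sqr_ge0//.
  by case: i => [p|x] //=; rewrite ler_wpM2l ?invr_ge0.
have ff' : finite_energy G f.
  by move: ff; rewrite !finite_energyE; exact: le_lt_trans.
split=> //; rewrite !energyE// -lee_fin /wform -!wsq_fine//; try exact: energy_weight_ge0.
  by move: ff; rewrite finite_energyE.
by move: ff'; rewrite finite_energyE.
Qed.

Context (G : graph R X) (Gn : nat -> graph R X).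
Hypothesis edge_mono : forall k l x y, (k <= l)%N -> edge (Gn k) x y <= edge (Gn l) x y.
Hypothesis killing_mono : forall k l x, (k <= l)%N -> killing (Gn k) x <= killing (Gn l) x.
Hypothesis edge_le : forall k x y, edge (Gn k) x y <= edge G x y.
Hypothesis killing_le : forall k x, killing (Gn k) x <= killing G x.
Hypothesis edge_lim : forall x y, exists K, forall k, (K <= k)%N ->
  edge (Gn k) x y = edge G x y.
Hypothesis killing_lim : forall x, exists K, forall k, (K <= k)%N ->
  killing (Gn k) x = killing G x.

Lemma energy_sup f (C : R) :
  (forall k, finite_energy (Gn k) f /\ energy (Gn k) f <= C) ->
  finite_energy G f /\ energy G f <= C.
Proof.
move=> H; have W : (wsq (energy_weight G) (energy_vec f) <= C%:E)%E.
  apply: esum_fatou (fun k i => energy_weight (Gn k) i * energy_vec f i ^+ 2) _ _ _ _.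
    move=> i; apply: cvgM; last exact: cvg_cst.
    apply/cvg_eps => e e0; case: i => [p|x] /=.
      have [K HK] := edge_lim p.1 p.2; exists K => k /HK ->.
      by rewrite subrr normr0 ltW.
    by have [K HK] := killing_lim x; exists K => k /HK ->; rewrite subrr normr0 ltW.
  exists 0%N => k _; have [fk Ck] := H k.
  rewrite -/(wsq _ _) wsq_fine; last by move: fk; rewrite finite_energyE.
    by move: Ck; rewrite energyE// lee_fin.
  exact: energy_weight_ge0.
have ff : finite_energy G f.
  by rewrite finite_energyE /wdom /= (le_lt_trans W)// ltry.
split=> //; rewrite energyE// -lee_fin /wform -wsq_fine//; first exact: energy_weight_ge0.
by rewrite (le_lt_trans W)// ltry.
Qed.

Lemma sqnorm_cvg (u : nat -> X -> R) v f : (forall n, ell2 m (u n)) -> ell2 m v ->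
  ell2 m f -> ell2_cvg m u v ->
  (fun n => sqnorm m (u n \- f)) @ \oo --> sqnorm m (v \- f).
Proof.
move=> Vu Vv Vf uv.
have c : (fun n => N (u n \- f)) @ \oo --> N (v \- f).
  apply/cvg_eps => e e0; have [K HK] := uv _ e0; exists K => n Kn.
  apply: le_trans (HK _ Kn); rewrite ler_norml.
  have := qnormB S (Vu n) Vv Vf; have := qnormB S Vv (Vu n) Vf.
  rewrite (qnormBC S Vv (Vu n)) /ell2norm -!/(qnorm _ _); lra.
have e g : ell2 m g -> sqnorm m g = N g * N g by move=> Vg; rewrite -expr2 (sqr_qnorm S).
rewrite e; last exact: (qfB S).
under eq_fun do rewrite (e _ (qfB S (Vu _) Vf)).
exact: cvgM.
Qed.

(** The minimal values of [s * energy (Gn k) v + sqnorm (v \- f)] increase with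
    [k] and are bounded, so the minimizers form a Cauchy sequence; the limit
    minimizes the functional of [G]. *)
Lemma monotone_resolvent_cvg (s : R) f : 0 < s -> ell2 m f ->
  ell2_cvg m (fun k => resolvent (neumann_operator (Gn k) m) s f)
             (resolvent (neumann_operator G m) s f).
Proof.
move=> s0 Vf.
pose u k := resolvent (neumann_operator (Gn k) m) s f.
have Lu k := resolvent_op (neumann_accretive (Gn k) m_gt0) s0 Vf; rewrite -/(u _) in Lu.
have LU := resolvent_op (neumann_accretive G m_gt0) s0 Vf.
set U := resolvent _ s f in LU *.
have Du k : domN (Gn k) m (u k) by case: (Lu k).
have DU : domN G m U by case: LU.
have Vu k : ell2 m (u k) by case: (Du k).
have VU : ell2 m U by case: DU.
pose a k := s * energy (Gn k) (u k) + sqnorm m (u k \- f).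
pose J := s * energy G U + sqnorm m (U \- f).
have aJ k : a k <= J.
  have [F1 F2] := energy_mono (edge_le k) (killing_le k) (proj1 DU).
  have := neumann_minimizer s0 Vf (conj F1 VU) (Lu k).
  have := qf_ge0 S (qfB S VU (Vu k)); have := ler_wpM2l (ltW s0) F2.
  rewrite /a /J; lra.
have akl k l : (k <= l)%N -> sqnorm m (u l \- u k) <= a l - a k.
  move=> kl; have [F1 F2] := energy_mono (fun x y => edge_mono x y kl)
    (fun x => killing_mono x kl) (proj1 (Du l)).
  have := neumann_minimizer s0 Vf (conj F1 (Vu l)) (Lu k).
  have := ler_wpM2l (ltW s0) F2; rewrite /a; lra.
have anondec : nondecreasing_seq a.
  move=> k l kl; have := akl _ _ kl; have := qf_ge0 S (qfB S (Vu l) (Vu k)); lra.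
have acvg : cvgn a.
  by apply: nondecreasing_is_cvgn => //; exists J => _ [k _ <-].
have a_le k : a k <= limn a by exact: nondecreasing_cvgn_le.
have lim_leJ : limn a <= J by apply: limr_le => //; exact: nearW.
have [w Vw cw] : exists2 w, ell2 m w & ell2_cvg m u w.
  apply: (ell2_cvg_complete m_gt0 Vu) => e e0.
  have e2 : 0 < (e / 2) ^+ 2 by rewrite exprn_gt0// divr_gt0.
  have [K HK] := (cvg_eps _ _).1 acvg _ e2.
  have H k : (K <= k)%N -> N (u k \- u K) <= e / 2.
    move=> Kk; rewrite -ler_sqr ?nnegrE ?sqrtr_ge0 ?(divr_ge0 (ltW e0))//.
    rewrite (sqr_qnorm S (qfB S (Vu k) (Vu K))); apply: le_trans (akl _ _ Kk) _.
    have := HK K (leqnn K); rewrite distrC => /(le_trans (ler_norm _)).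
    by have := a_le k; lra.
  exists K => n k Kn Kk; have := H n Kn; have := H k Kk.
  have := qnormB S (Vu n) (Vu K) (Vu k); rewrite (qnormBC S (Vu K) (Vu k)).
  rewrite /ell2norm -!/(qnorm _ _); lra.
have low (e : R) : 0 < e -> finite_energy G w /\
    energy G w <= s^-1 * (limn a - sqnorm m (w \- f) + e).
  move=> e0; apply: energy_sup => k.
  apply: (@energy_lsc _ _ (Gn k) u).
    exact: (ell2_cvg_pointwise m_gt0 Vu Vw cw).
  have [K HK] := (cvg_eps _ _).1 (sqnorm_cvg Vu Vw Vf cw) _ e0.
  exists (maxn K k) => l; rewrite geq_max => /andP[/HK hl kl].
  have [F1 F2] := energy_mono (fun x y => edge_mono x y kl)
    (fun x => killing_mono x kl) (proj1 (Du l)).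
  split=> //; apply: le_trans F2 _; rewrite ler_pdivlMl//.
  have := a_le l; move: hl; rewrite distrC => /(le_trans (ler_norm _)).
  rewrite /a; lra.
have Dw : domN G m w by split=> //; case: (low 1 ltr01).
have Jw : s * energy G w + sqnorm m (w \- f) <= limn a.
  apply/ler_addgt0Pr => e e0; have [_] := low _ e0.
  by rewrite ler_pdivlMl//; lra.
have wU : sqnorm m (w \- U) <= 0.
  by have := neumann_minimizer s0 Vf Dw LU; move: lim_leJ; rewrite /J; lra.
suff <- : w = U by [].
have Vd := qfB S Vw VU; have d0 : sqnorm m (w \- U) = 0.
  by apply/eqP; rewrite eq_le wU (qf_ge0 S).
apply/funext => x; have := congr1 (fun k => k x) (sqnorm_eq0 m_gt0 Vd d0) => /= /eqP.
by rewrite subr_eq0 => /eqP.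
Qed.

End MonotoneGraphs.

(** * Exponential series *)

Section ExpSeries.
Context {R : realType}.
Implicit Types (a b : nat -> R) (z C M : R).

Definition exp_series a z : R := limn (series (fun n => exp_coeff z n * a n)).

Definition geometric_bound a M C := forall n, `|a n| <= M * C ^+ n.

Let term_le a M C z n : 0 <= C -> geometric_bound a M C ->
  `|exp_coeff z n * a n| <= M * exp_coeff (C * `|z|) n.
Proof.
move=> C0 aMC; rewrite /exp_coeff /= normrM normrM normrX normfV normr_nat.
rewrite exprMn mulrC; apply: le_trans (ler_wpM2r _ (aMC n)) _.
  by rewrite divr_ge0 ?exprn_ge0.
by rewrite !mulrA.
Qed.

Let lim_dom M C z : series (fun n => M * exp_coeff (C * `|z|) n) @ \oo -->
  M * expR (C * `|z|).
Proof.
have -> : series (fun n => M * exp_coeff (C * `|z|) n) =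
    (fun k => M * series (exp_coeff (C * `|z|)) k).
  by apply/funext => k; rewrite /series /= mulr_sumr.
by apply: cvgM; [exact: cvg_cst|exact: (is_cvg_series_exp_coeff (C * `|z|))].
Qed.

Let cvg_dom M C z : cvgn (series (fun n => M * exp_coeff (C * `|z|) n)).
Proof. by apply/cvg_ex; exists (M * expR (C * `|z|)). Qed.

Let cvg_normed a M C z : 0 <= C -> geometric_bound a M C ->
  cvgn (series (fun n => `|exp_coeff z n * a n|)).
Proof.
move=> C0 aMC; have h3 n := term_le z n C0 aMC.
have h1 n : 0 <= `|exp_coeff z n * a n| by [].
have h2 n : 0 <= M * exp_coeff (C * `|z|) n by exact: le_trans (h1 n) (h3 n).
exact: (series_le_cvg h1 h2 h3 (@cvg_dom M C z)).
Qed.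

Lemma exp_series_cvg a M C z : 0 <= C -> geometric_bound a M C ->
  cvgn (series (fun n => exp_coeff z n * a n)).
Proof.
move=> C0 aMC.
exact: (@normed_cvg _ R^o (fun n => exp_coeff z n * a n) (@cvg_normed _ _ _ z C0 aMC)).
Qed.

Lemma exp_series_le a M C z : 0 <= C -> geometric_bound a M C ->
  `|exp_series a z| <= M * expR (C * `|z|).
Proof.
move=> C0 aMC; have cn := @cvg_normed _ _ _ z C0 aMC.
apply: le_trans (@lim_series_norm _ R^o (fun n => exp_coeff z n * a n) cn) _.
have -> : M * expR (C * `|z|) = limn (series (fun n => M * exp_coeff (C * `|z|) n)).
  by apply/esym/cvg_lim.
by apply: lim_series_le cn (@cvg_dom M C z) _ => n; exact: term_le.
Qed.

Lemma exp_series_head a z : (forall n, exp_coeff z n.+1 * a n.+1 = 0) ->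
  series (fun n => exp_coeff z n * a n) @ \oo --> a 0%N.
Proof.
move=> a0; apply/cvg_eps => e e0; exists 1%N => -[//|n] _.
rewrite /series /= big_nat_recl// big1 ?addr0; last by move=> i _; exact: a0.
by rewrite /exp_coeff /= expr0 fact0 divr1 mul1r subrr normr0 ltW.
Qed.

Lemma exp_series_const a z : (forall n, a n.+1 = 0) -> exp_series a z = a 0%N.
Proof.
by move=> a0; apply: cvg_lim => //; apply: exp_series_head => n; rewrite a0 mulr0.
Qed.

Lemma exp_series0 a : exp_series a 0 = a 0%N.
Proof.
apply: cvg_lim => //; apply: exp_series_head => n.
by rewrite /exp_coeff /= expr0n mul0r mul0r.
Qed.

Lemma geometric_bound_shift a M C : geometric_bound a M C ->
  geometric_bound (fun n => a n.+1) (M * C) C.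
Proof. by move=> H n; apply: le_trans (H n.+1) _; rewrite exprS mulrA. Qed.

Lemma exp_series_derive a M C z : 0 <= C -> geometric_bound a M C ->
  is_derive z (1 : R) (exp_series a) (exp_series (fun n => a n.+1) z).
Proof.
move=> C0 aMC; pose c n := a n / n`!%:R.
have pE b y : pseries (fun n => b n / n`!%:R) y = series (fun n => exp_coeff y n * b n).
  rewrite /pseries; congr series; apply/funext => n.
  by rewrite /exp_coeff /= mulrAC [RHS]mulrAC [b n * _]mulrC.
have dE b : pseries_diffs (fun n => b n / n`!%:R) = (fun n => b n.+1 / n`!%:R).
  apply/funext => n; rewrite /pseries_diffs factS natrM invfM mulrCA.
  by rewrite (mulrA n.+1%:R) mulfV ?mul1r// pnatr_eq0.
have -> : exp_series a = (fun y => limn (pseries c y)).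
  by apply/funext => y; rewrite /c pE.
have -> : exp_series (fun n => a n.+1) z = limn (pseries (pseries_diffs c) z).
  by rewrite /c dE pE.
apply: (@pseries_snd_diffs _ _ (`|z| + 1)); rewrite /c ?dE ?pE.
- exact: exp_series_cvg aMC.
- exact: (@exp_series_cvg _ _ _ _ C0 (geometric_bound_shift aMC)).
- exact: (@exp_series_cvg _ _ _ _ C0 (geometric_bound_shift (geometric_bound_shift aMC))).
- by rewrite [ltRHS]ger0_norm ?ltrDl// addr_ge0.
Qed.

Let mvt a M C (p q : R) : 0 <= C -> geometric_bound a M C -> p <= q ->
  exists2 c, p <= c <= q &
    exp_series a q - exp_series a p = exp_series (fun n => a n.+1) c * (q - p).
Proof.
move=> C0 aMC pq; have d z := exp_series_derive z C0 aMC.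
have [|c cpq e] := MVT_segment pq (fun z _ => d z).
  by apply: derivable_within_continuous => z _; exact: (@ex_derive _ _ _ _ _ _ _ (d z)).
by exists c => //; move: cpq; rewrite in_itv.
Qed.

(** Residual of [t |-> exp_series a (- t)], the solution of [v' = - v1] where
    [v1] has the shifted coefficients, in one implicit Euler step from [p] to
    [q]: a second-order Taylor remainder. *)
Lemma exp_series_residual a M C (p q T : R) : 0 <= C -> geometric_bound a M C ->
  0 <= p -> p <= q -> q <= T ->
  `|exp_series a (- q) - exp_series a (- p) +
    (q - p) * exp_series (fun n => a n.+1) (- q)| <=
  M * C * C * expR (C * T) * (q - p) ^+ 2.
Proof.
move=> C0 aMC p0 pq qT.
have a1 := geometric_bound_shift aMC; have a2 := geometric_bound_shift a1.
have pq' : - q <= - p by rewrite lerN2.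
have [c /andP[c1 c2] e1] := mvt C0 aMC pq'.
have [d /andP[d1 d2] e2] := mvt C0 a1 c1.
have -> : exp_series a (- q) - exp_series a (- p) +
    (q - p) * exp_series (fun n => a n.+1) (- q) =
    - ((q - p) * (exp_series (fun n => a n.+2) d * (c - - q))).
  by rewrite -e2 mulrBr -(opprB (exp_series a (- p))) e1; ring.
rewrite normrN !normrM.
have M0 : 0 <= M * C * C.
  by have := a2 0%N; rewrite expr0 mulr1; apply: le_trans.
have B : `|exp_series (fun n => a n.+2) d| <= M * C * C * expR (C * T).
  apply: le_trans (exp_series_le d C0 a2) _; rewrite ler_wpM2l//.
  rewrite ler_expR ler_wpM2l// ler_norml; lra.
have qp : 0 <= q - p by lra.
have cq : 0 <= c - - q by lra.
rewrite (ger0_norm qp) (ger0_norm cq).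
have -> : M * C * C * expR (C * T) * (q - p) ^+ 2 =
   (q - p) * (M * C * C * expR (C * T) * (q - p)) by ring.
by rewrite ler_wpM2l//; apply: ler_pM => //; lra.
Qed.

End ExpSeries.

(** * Restriction of a graph to a finite set *)

Section Restriction.
Context {R : realType} {X : countType} (G : graph R X) (m : X -> R).
Hypothesis m_gt0 : forall x, 0 < m x.
Context (A : set X) (finA : finite_set A).
Implicit Types (f g h u v : X -> R).

Local Notation ip := (polar (sqnorm m)).
Local Notation N := (ell2norm m).
Let S := sqnorm_quadform m_gt0.
Let As : seq X := fset_set A.

Definition restricted_edge x y : R :=
  if (x \in A) && (y \in A) then edge G x y else 0.
Definition restricted_killing x : R := if x \in A then killing G x else 0.

Lemma restricted_edge_le x y : restricted_edge x y <= edge G x y.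
Proof. by rewrite /restricted_edge; case: ifP => // _; exact: edge_ge0. Qed.

Lemma restricted_edge_ge0 x y : 0 <= restricted_edge x y.
Proof. by rewrite /restricted_edge; case: ifP => // _; exact: edge_ge0. Qed.

Lemma restricted_edge_sym x y : restricted_edge x y = restricted_edge y x.
Proof. by rewrite /restricted_edge andbC edge_sym. Qed.

Lemma restricted_edge_diag x : restricted_edge x x = 0.
Proof. by rewrite /restricted_edge edge_diag; case: ifP. Qed.

Lemma restricted_edge_summable x :
  (\esum_(y in [set: X]) (restricted_edge x y)%:E < +oo)%E.
Proof.
apply: le_lt_trans (edge_summable G x); apply: le_esum => y _.
by rewrite lee_fin restricted_edge_le.
Qed.

Lemma restricted_killing_ge0 x : 0 <= restricted_killing x.
Proof. by rewrite /restricted_killing; case: ifP => // _; exact: killing_ge0. Qed.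

(** The vertices outside [A] stay as isolated points, so that the graphs of an
    exhaustion all live on the same space l^2(X, m) and their forms increase. *)
Definition restricted_graph : graph R X :=
  Graph restricted_edge_ge0 restricted_edge_sym restricted_edge_diag
    restricted_edge_summable restricted_killing_ge0.

Local Notation L := (neumann_operator restricted_graph m).
Local Notation B := (restricted_operator G m A).

Let mem_As x : (x \in As) = (x \in A).
Proof. by rewrite /As in_fset_set. Qed.

Lemma esum_supp (a : X -> R) : (forall x, 0 <= a x) ->
  (forall x, x \notin A -> a x = 0) ->
  \esum_(x in [set: X]) (a x)%:E = (\sum_(x <- As) a x)%:E.
Proof.
move=> a0 aA.
rewrite /As -fsum_EFin_fset// -esum_fset//; last by move=> x _; rewrite lee_fin.
rewrite [RHS]esum_mkcond; apply: eq_esum => x _.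
by case: ifPn => // /aA ->.
Qed.

Lemma restricted_edge_energy f : edge_energy restricted_graph f =
  (\sum_(x <- As) \sum_(y <- As) edge G x y * (f x - f y) ^+ 2)%:E.
Proof.
have t0 x y : 0 <= restricted_edge x y * (f x - f y) ^+ 2.
  by rewrite mulr_ge0 ?sqr_ge0// restricted_edge_ge0.
rewrite /edge_energy (_ : [set: X * X] = [set: X] `*`` (fun=> [set: X])); last first.
  by apply/seteqP; split.
rewrite -(@esum_esum _ _ _ _ _
  (fun x y => (restricted_edge x y * (f x - f y) ^+ 2)%:E)); last first.
  by move=> x y _ _; rewrite lee_fin.
have inner x : \esum_(y in [set: X]) (restricted_edge x y * (f x - f y) ^+ 2)%:E =
    (\sum_(y <- As) restricted_edge x y * (f x - f y) ^+ 2)%:E.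
  apply: esum_supp => // y yA.
  by rewrite /restricted_edge (negbTE yA) andbF mul0r.
under eq_esum do rewrite inner.
rewrite esum_supp.
- congr EFin; apply: eq_big_seq => x; rewrite mem_As => xA.
  apply: eq_big_seq => y; rewrite mem_As => yA.
  by rewrite /restricted_edge xA yA.
- by move=> x; apply: sumr_ge0.
- move=> x xA; apply: big1 => y _.
  by rewrite /restricted_edge (negbTE xA) mul0r.
Qed.

Lemma restricted_killing_energy f : killing_energy restricted_graph f =
  (\sum_(x <- As) killing G x * f x ^+ 2)%:E.
Proof.
rewrite /killing_energy esum_supp /=.
- by congr EFin; apply: eq_big_seq => x; rewrite mem_As /restricted_killing => ->.
- by move=> x; rewrite mulr_ge0 ?sqr_ge0// restricted_killing_ge0.
- by move=> x xA; rewrite /restricted_killing (negbTE xA) mul0r.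
Qed.

Lemma restricted_finite_energy f : finite_energy restricted_graph f.
Proof.
by rewrite /finite_energy /= restricted_edge_energy restricted_killing_energy -EFinD ltry.
Qed.

Lemma restricted_operator_in f x : x \in A ->
  B f x = (m x)^-1 * (\sum_(y <- As) edge G x y * (f x - f y))
    + killing G x / m x * f x.
Proof. by move=> xA; rewrite /restricted_operator patchE xA fsbig_finite. Qed.

Lemma restricted_operator_out f x : x \notin A -> B f x = 0.
Proof. by move=> xA; rewrite /restricted_operator patchE (negbTE xA). Qed.

Lemma polar_sqnorm_supp g h : (forall x, x \notin A -> g x = 0) -> ell2 m h ->
  ip g h = \sum_(x <- As) m x * g x * h x.
Proof.
move=> gA Vh; have m0 x : 0 <= m x by exact: ltW.
pose T := \esum_(x in ~` A) (m x * h x ^+ 2)%:E.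
have T0 : (0 <= T)%E by apply: esum_ge0 => x _; rewrite lee_fin wterm_ge0.
have Tfin : T \is a fin_num.
  rewrite ge0_fin_numE//; move: Vh; rewrite /ell2 /= sqnorm_erealE; apply: le_lt_trans.
  rewrite /T esum_mkcond; apply: le_esum => x _; case: ifP => // _.
  by rewrite lee_fin wterm_ge0.
have sq k : (forall x, x \notin A -> k x ^+ 2 = h x ^+ 2) ->
    sqnorm m k = \sum_(x <- As) m x * k x ^+ 2 + fine T.
  move=> kh; rewrite /sqnorm sqnorm_erealE /wsq (esumID A); last first.
    by move=> x _; rewrite lee_fin wterm_ge0.
  rewrite !setTI esum_fset//; last by move=> x _; rewrite lee_fin wterm_ge0.
  rewrite fsum_EFin_fset// (_ : \esum_(x in ~` A) _ = T); last first.
    by apply: eq_esum => x xA; rewrite kh// notin_setE.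
  by rewrite fineD.
rewrite /polar !sq.
- rewrite opprD addrACA subrr addr0 -sumrB mulr_suml; apply: eq_bigr => x _ /=.
  by field.
- by move=> x xA /=; rewrite gA// sub0r sqrrN.
- by move=> x xA /=; rewrite gA// add0r.
Qed.

Lemma restricted_energyE f : energy restricted_graph f =
  2^-1 * (\sum_(x <- As) \sum_(y <- As) edge G x y * (f x - f y) ^+ 2) +
  \sum_(x <- As) killing G x * f x ^+ 2.
Proof. by rewrite /energy restricted_edge_energy restricted_killing_energy. Qed.

Lemma restricted_green f h : polar (energy restricted_graph) f h =
  \sum_(x <- As) ((\sum_(y <- As) edge G x y * (f x - f y)) + killing G x * f x) * h x.
Proof.
pose D := \sum_(x <- As) \sum_(y <- As) edge G x y * (f x - f y) * h x.
have swap : \sum_(x <- As) \sum_(y <- As) edge G x y * (f x - f y) * h y = - D.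
  rewrite exchange_big /= /D -sumrN; apply: eq_bigr => x _.
  by rewrite -sumrN; apply: eq_bigr => y _; rewrite edge_sym; ring.
have e1 : \sum_(x <- As) \sum_(y <- As) edge G x y * ((f \+ h) x - (f \+ h) y) ^+ 2 -
    \sum_(x <- As) \sum_(y <- As) edge G x y * ((f \- h) x - (f \- h) y) ^+ 2 = 8 * D.
  have -> : 8 * D = 4 * D - 4 * - D by ring.
  rewrite -swap /D !mulr_sumr -!sumrB; apply: eq_bigr => x _.
  by rewrite !mulr_sumr -!sumrB; apply: eq_bigr => y _ /=; ring.
have e2 : \sum_(x <- As) killing G x * (f \+ h) x ^+ 2 -
    \sum_(x <- As) killing G x * (f \- h) x ^+ 2 =
    4 * \sum_(x <- As) killing G x * f x * h x.
  by rewrite -sumrB mulr_sumr; apply: eq_bigr => x _ /=; ring.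
have -> : \sum_(x <- As) (\sum_(y <- As) edge G x y * (f x - f y) + killing G x * f x) * h x =
    D + \sum_(x <- As) killing G x * f x * h x.
  rewrite /D -big_split /=; apply: eq_bigr => x _.
  by rewrite mulrDl mulr_suml.
rewrite /polar !restricted_energyE; lra.
Qed.

Lemma restricted_operator_ell2 f : ell2 m (B f).
Proof.
apply: Cc_ell2 => //; apply: sub_finite_set finA => x /=.
by apply: contraNP => xA; apply/eqP/restricted_operator_out; rewrite notin_setE.
Qed.

Lemma restricted_neumann f : ell2 m f -> L f (B f).
Proof.
move=> Vf; split; first by split=> //; exact: restricted_finite_energy.
  exact: restricted_operator_ell2.
move=> h [_ Vh]; rewrite restricted_green polar_sqnorm_supp//; last first.
  by move=> x; exact: restricted_operator_out.
apply: eq_big_seq => x; rewrite mem_As => xA.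
by rewrite restricted_operator_in//; field; rewrite gt_eqF.
Qed.

Lemma restricted_operator_lin (r : R) f g :
  B (fun x => r * f x + g x) = (fun x => r * B f x + B g x).
Proof.
apply/funext => x; have [xA|xA] := boolP (x \in A); last first.
  by rewrite !restricted_operator_out// mulr0 addr0.
rewrite !restricted_operator_in//.
have -> : \sum_(y <- As) edge G x y * (r * f x + g x - (r * f y + g y)) =
    r * (\sum_(y <- As) edge G x y * (f x - f y)) + \sum_(y <- As) edge G x y * (g x - g y).
  by rewrite mulr_sumr -big_split /=; apply: eq_bigr => y _; ring.
by ring.
Qed.

Lemma restricted_operator_cvg (u : nat -> X -> R) v x :
  (forall y, (fun n => u n y) @ \oo --> v y) -> (fun n => B (u n) x) @ \oo --> B v x.
Proof.
move=> uv; have [xA|xA] := boolP (x \in A); last first.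
  rewrite restricted_operator_out//; under eq_fun do rewrite restricted_operator_out//.
  exact: cvg_cst.
rewrite restricted_operator_in//; under eq_fun do rewrite restricted_operator_in//.
apply: cvgD; apply: cvgM; try exact: cvg_cst; last exact: uv.
elim: As => [|y s IH].
  by rewrite big_nil; under eq_fun do rewrite big_nil; exact: cvg_cst.
rewrite big_cons; under eq_fun do rewrite big_cons.
by apply: cvgD => //; apply: cvgM; [exact: cvg_cst|apply: cvgB; exact: uv].
Qed.

(** The operator is bounded for the l^1 norm of the restriction to [A]. *)
Let n1 f := \sum_(x <- As) `|f x|.
Let Cx x := (m x)^-1 * (\sum_(y <- As) 2 * edge G x y) + killing G x / m x.
Let C := \sum_(x <- As) Cx x.

Let n1_ge0 f : 0 <= n1 f. Proof. exact: sumr_ge0. Qed.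

Let Cx_ge0 x : 0 <= Cx x.
Proof.
have mx := m_gt0 x; rewrite addr_ge0 ?mulr_ge0 ?invr_ge0 ?killing_ge0 ?(ltW mx)//.
by apply: sumr_ge0 => y _; rewrite mulr_ge0 ?edge_ge0.
Qed.

Let C_ge0 : 0 <= C. Proof. exact: sumr_ge0. Qed.

Let le_n1 f x : x \in A -> `|f x| <= n1 f.
Proof.
by move=> xA; rewrite /n1 (bigD1_seq x) ?mem_As ?fset_uniq//= lerDl sumr_ge0.
Qed.

Let B_le f x : x \in A -> `|B f x| <= Cx x * n1 f.
Proof.
move=> xA; rewrite restricted_operator_in//; have mx := m_gt0 x.
apply: le_trans (ler_normD _ _) _; rewrite /Cx mulrDl; apply: lerD.
  rewrite normrM gtr0_norm ?invr_gt0// -mulrA ler_wpM2l ?invr_ge0 ?(ltW mx)//.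
  apply: le_trans (ler_norm_sum _ _ _) _; rewrite mulr_suml.
  rewrite big_seq [leRHS]big_seq; apply: ler_sum => y; rewrite mem_As => yA.
  rewrite normrM (ger0_norm (edge_ge0 _ _ _)) mulrAC [leLHS]mulrC ler_wpM2r ?edge_ge0//.
  by apply: le_trans (ler_normB _ _) _; have := le_n1 f xA; have := le_n1 f yA; lra.
rewrite normrM ger0_norm; last by rewrite divr_ge0 ?killing_ge0 ?(ltW mx).
by rewrite ler_wpM2l ?le_n1// divr_ge0 ?killing_ge0 ?(ltW mx).
Qed.

Let n1_iter f n : n1 (iter n B f) <= n1 f * C ^+ n.
Proof.
elim: n => [|n IH]; first by rewrite expr0 mulr1.
rewrite exprSr mulrA [leRHS]mulrC; apply: (@le_trans _ _ (C * n1 (iter n B f))).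
  rewrite {1}/n1 /C mulr_suml big_seq [leRHS]big_seq; apply: ler_sum => x.
  by rewrite mem_As => xA; exact: B_le.
by rewrite ler_wpM2l.
Qed.

Let iter_bound f x : x \in A ->
  geometric_bound (fun n => iter n B f x) (n1 f) C.
Proof. by move=> xA n; apply: le_trans (n1_iter f n); exact: le_n1. Qed.

(** The semigroup of [restricted_graph] on the whole of l^2(X, m).  It is the
    identity on functions that vanish on [A], whereas [restricted_semigroup]
    kills them. *)
Definition restricted_exp (t : R) f x : R :=
  exp_series (fun n => iter n B f x) (- t).

Lemma restricted_exp_out t f x : x \notin A -> restricted_exp t f x = f x.
Proof.
move=> xA; rewrite /restricted_exp exp_series_const//.
by move=> n; rewrite iterS restricted_operator_out.
Qed.

Lemma restricted_exp0 f : restricted_exp 0 f = f.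
Proof. by apply/funext => x; rewrite /restricted_exp oppr0 exp_series0. Qed.

Lemma restricted_exp_ell2 t f : ell2 m f -> ell2 m (restricted_exp t f).
Proof.
move=> Vf; have -> : restricted_exp t f = (restricted_exp t f \- f) \+ f by fext.
apply: (qfD S) => //; apply: Cc_ell2 => //; apply: sub_finite_set finA => x /=.
apply: contraNP => xA; rewrite restricted_exp_out ?subrr//.
by rewrite notin_setE.
Qed.

Lemma restricted_exp_comm t f : B (restricted_exp t f) = restricted_exp t (B f).
Proof.
apply/funext => x; have [xA|xA] := boolP (x \in A); last first.
  by rewrite restricted_exp_out// !restricted_operator_out.
apply/esym/cvg_lim => //.
pose u k y := series (fun n => exp_coeff (- t) n * iter n B f y) k.
have uB k : series (fun n => exp_coeff (- t) n * iter n B (B f) x) k = B (u k) x.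
  elim: k => [|k IH].
    rewrite /series /= big_geq//.
    have -> : u 0%N = (fun y => 0 * f y + 0 * f y).
      by apply/funext => y; rewrite /u /series /= big_geq//; ring.
    have -> : (fun y => 0 * f y + 0 * f y) = (fun y => (-1) * f y + f y) by fext.
    by rewrite restricted_operator_lin; ring.
  have -> : u k.+1 = (fun y => exp_coeff (- t) k * iter k B f y + u k y).
    by apply/funext => y; rewrite /u /series /= big_nat_recr//= addrC.
  rewrite restricted_operator_lin -IH /series /= big_nat_recr//= addrC.
  by rewrite -iterSr.
rewrite (_ : series _ = (fun k => B (u k) x)); last exact/funext.
apply: restricted_operator_cvg => y; rewrite /u.
have [yA|yA] := boolP (y \in A).
  exact: (@exp_series_cvg _ _ _ _ (- t) C_ge0 (iter_bound f yA)).
rewrite restricted_exp_out//.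
apply: (@exp_series_head _ (fun n => iter n B f y)) => n.
by rewrite iterS restricted_operator_out ?mulr0.
Qed.

Lemma restricted_euler_limit (t : R) : 0 < t ->
  euler_limit m L t (restricted_exp t).
Proof.
move=> t0 f Vf; split; first exact: restricted_exp_ell2.
pose HL := neumann_accretive restricted_graph m_gt0.
pose K := n1 f * C * C * expR (C * t).
pose k x := if x \in A then K else 0.
have K0 : 0 <= K by rewrite !mulr_ge0 ?expR_ge0.
have Vk : ell2 m k.
  apply: Cc_ell2 => //; apply: sub_finite_set finA => x /=; rewrite /k.
  by case: ifPn; rewrite ?inE// eqxx.
have Nk : 0 <= N k by exact: sqrtr_ge0.
apply: (@ell2_cvg_pow2 _ _ _ _ _ (t ^+ 2 * N k)).
  exact: mulr_ge0 (sqr_ge0 t) Nk.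
move=> j; set n := (2 ^ j)%N; have n0 : (0 : R) < n%:R by rewrite ltr0n expn_gt0.
pose s := t / n%:R; have s0 : 0 < s by rewrite divr_gt0.
have ns : n%:R * s = t by rewrite mulrC divfK// gt_eqF.
pose v i := restricted_exp (i%:R * s) f.
have v0 : v 0%N = f by rewrite /v mul0r restricted_exp0.
have Vv i : ell2 m (v i) by exact: restricted_exp_ell2.
have Vn : ell2 m (restricted_exp t f) by exact: restricted_exp_ell2.
rewrite /ell2norm -/(qnorm _ _) (qnormBC S (euler_ell2 HL j t0 Vf) Vn).
have -> : t ^+ 2 * N k / n%:R = n%:R * (s ^+ 2 * N k).
  by rewrite /s; field; rewrite gt_eqF.
rewrite /euler -/n -/s -{1}ns -/(v n) -[X in iter _ _ X]v0.
apply: (euler_stability m_gt0 HL s0 (g := fun i => B (v i)) (Vv 0%N)).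
  by move=> i; exact: restricted_neumann.
move=> i iN; rewrite -/(qnorm _ _).
have Vr : ell2 m ((fun x => v i.+1 x + s * B (v i.+1) x) \- v i).
  exact: (qfB S (qfD S (Vv _) (qfZ S s (restricted_operator_ell2 _))) (Vv _)).
have -> : s ^+ 2 * N k = N (fun x => s ^+ 2 * k x).
  by rewrite /ell2norm -!/(qnorm _ _) (qnormZ S)// (ger0_norm (sqr_ge0 s)).
have Vsk := qfZ S (s ^+ 2) Vk.
apply: (ell2norm_le m_gt0 _ Vsk) => x /=; rewrite /k.
have [xA|xA] := boolP (x \in A); last first.
  by rewrite restricted_operator_out// /v !restricted_exp_out// mulr0 addr0 subrr normr0.
rewrite restricted_exp_comm [leRHS](ger0_norm (mulr_ge0 (sqr_ge0 _) K0)).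
have is0 : 0 <= i%:R * s by rewrite mulr_ge0// ltW.
have le1 : i%:R * s <= i.+1%:R * s by rewrite ler_wpM2r ?(ltW s0)// ler_nat.
have le2 : i.+1%:R * s <= t by rewrite -ns ler_wpM2r ?(ltW s0)// ler_nat.
have := exp_series_residual C_ge0 (iter_bound f xA) is0 le1 le2.
have -> : i.+1%:R * s - i%:R * s = s by rewrite -natr1; ring.
rewrite -/K [K * _]mulrC; apply: le_trans.
rewrite /v /restricted_exp.
have -> : (fun n => iter n B (B f) x) = (fun n => iter n.+1 B f x).
  by apply/funext => l; rewrite iterSr.
by rewrite addrAC.
Qed.

Lemma restricted_semigroupE (t : R) f :
  restricted_semigroup G m A t f = patch (fun=> 0) A (restricted_exp t f).
Proof.
have iterE n : iter n.+1 B (patch (fun=> 0) A f) = iter n.+1 B f.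
  elim: n => [|n IH]; last by rewrite iterS IH.
  apply/funext => x /=; have [xA|xA] := boolP (x \in A); last first.
    by rewrite !restricted_operator_out.
  rewrite !restricted_operator_in// patchE xA; congr (_ * _ + _).
  by apply: eq_big_seq => y; rewrite mem_As => yA; rewrite patchE yA.
apply/funext => x.
transitivity (exp_series (fun n => iter n B (patch (fun=> 0) A f) x) (- t)); first by [].
rewrite patchE; case: ifPn => xA.
  rewrite /restricted_exp; congr (exp_series _ _); apply/funext => -[|n].
    by rewrite /= patchE xA.
  by rewrite iterE.
rewrite exp_series_const; first by rewrite /= patchE (negbTE xA).
by move=> n; rewrite iterS restricted_operator_out.
Qed.

End Restriction.

(** * Exhaustions *)

Section Exhaustion.
Context {R : realType} {X : countType} (G : graph R X) (A : nat -> set X).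
Hypothesis HA : exhaustion G A.

Lemma exhaustion_le k l : (k <= l)%N -> A k `<=` A l.
Proof.
case: HA => _ Ainc _ _ kl; rewrite -(subnKC kl).
elim: (l - k)%N => [|n IH]; first by rewrite addn0.
by rewrite addnS; exact: subset_trans IH (Ainc _).
Qed.

Lemma exhaustion_point x : exists K, forall k, (K <= k)%N -> A k x.
Proof.
case: HA => _ _ cov _; have [K _ AKx] : (\bigcup_k A k) x by rewrite cov.
by exists K => k /exhaustion_le; exact.
Qed.

Lemma exhaustion_finite (F : set X) : finite_set F ->
  exists K, forall k, (K <= k)%N -> F `<=` A k.
Proof.
move=> finF; pose K x := sval (cid (exhaustion_point x)).
exists (\max_(x <- fset_set F) K x)%N => k Kk x Fx.
apply: (svalP (cid (exhaustion_point x))); apply: leq_trans Kk.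
by apply: (@leq_bigmax_seq _ _ xpredT K) => //; rewrite in_fset_set// inE.
Qed.

End Exhaustion.

Lemma exp_semigroup_unique (R : realType) (X : countType) (m : X -> R) L P P'
    (t : R) f : (forall x, 0 < m x) -> m_accretive m L ->
  exp_semigroup m L P -> exp_semigroup m L P' -> 0 < t -> ell2 m f -> P t f = P' t f.
Proof.
move=> m_gt0 HL HP HP' t0 Vf.
have [V c] := semigroup_euler_limit m_gt0 HP HL t0 Vf.
have [V' c'] := semigroup_euler_limit m_gt0 HP' HL t0 Vf.
apply: (ell2_cvg_unique m_gt0 _ V V' c c').
by move=> j; exact: (euler_ell2 HL).
Qed.

(** On [A k] the restricted semigroup is the semigroup of the restricted graph;
    off [A k] it vanishes, and there [P t f] has small norm. *)
Lemma restricted_semigroup_cvg (R : realType) (X : countType) (G : graph R X)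
    (m : X -> R) P (A : nat -> set X) (t : R) f :
  (forall x, 0 < m x) -> exp_semigroup m (neumann_operator G m) P ->
  exhaustion G A -> 0 <= t -> ell2 m f ->
  ell2_cvg m (fun k => restricted_semigroup G m (A k) t f) (P t f).
Proof.
move=> m_gt0 HP HA t0 Vf; have S := sqnorm_quadform m_gt0.
have finA k : finite_set (A k) by case: HA.
have VPf : ell2 m (P t f) by exact: (semigroup_ell2 HP).
have Vexp k : ell2 m (restricted_exp G m (A k) t f).
  exact: (restricted_exp_ell2 G m_gt0 (finA k)).
have inA x : exists K, forall k, (K <= k)%N -> x \in A k.
  by have [K HK] := exhaustion_point HA x; exists K => k /HK; rewrite inE.
have subA k l x : (k <= l)%N -> x \in A k -> x \in A l.
  by move=> kl; rewrite !inE; exact: (exhaustion_le HA kl).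
have cexp : ell2_cvg m (fun k => restricted_exp G m (A k) t f) (P t f).
  move: t0; rewrite le_eqVlt => /orP[/eqP<-|t0].
    rewrite (semigroup0 HP)// => e e0; exists 0%N => k _; rewrite restricted_exp0.
    have -> : f \- f = (fun=> 0) by fext.
    by rewrite /ell2norm (qf0 S Vf) sqrtr0 ltW.
  have HL := neumann_accretive G m_gt0.
  pose Gn k := restricted_graph G (A k).
  have HLn k := neumann_accretive (Gn k) m_gt0.
  have lim_n k := restricted_euler_limit G m_gt0 (finA k) t0.
  apply: (trotter_kato m_gt0 HLn HL _ t0 lim_n (semigroup_euler_limit m_gt0 HP HL t0) Vf).
  move=> s g s0 Vg; apply: (monotone_resolvent_cvg m_gt0 _ _ _ _ _ _ s0 Vg).
  - move=> k l x y kl /=; rewrite /restricted_edge.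
    case: ifPn => [/andP[xA yA]|_]; first by rewrite !(subA _ _ _ kl).
    exact: restricted_edge_ge0.
  - move=> k l x kl /=; rewrite /restricted_killing.
    case: ifPn => [xA|_]; first by rewrite !(subA _ _ _ kl).
    exact: restricted_killing_ge0.
  - by move=> k x y; exact: restricted_edge_le.
  - by move=> k x /=; rewrite /restricted_killing; case: ifP => // _; exact: killing_ge0.
  - move=> x y; have [K1 H1] := inA x; have [K2 H2] := inA y.
    exists (maxn K1 K2) => k; rewrite geq_max => /andP[/H1 xA /H2 yA] /=.
    by rewrite /restricted_edge xA yA.
  - by move=> x; have [K H] := inA x; exists K => k /H xA /=; rewrite /restricted_killing xA.
move=> e e0; have e20 : 0 < e / 2 by rewrite divr_gt0.
have [K1 H1] := cexp _ e20.
have e24 : 0 < (e / 2) ^+ 2 by rewrite exprn_gt0.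
have [F finF HF] := ell2_cutoff m_gt0 VPf e24.
have [K2 H2] := exhaustion_finite HA finF.
exists (maxn K1 K2) => k; rewrite geq_max => /andP[/H1 h1 /H2 FA].
rewrite restricted_semigroupE//.
pose a := patch (fun=> 0) (A k) (restricted_exp G m (A k) t f \- P t f).
pose b x := if x \in A k then 0 else - P t f x.
have -> : patch (fun=> 0) (A k) (restricted_exp G m (A k) t f) \- P t f = a \+ b.
  apply/funext => x /=; rewrite /a /b !patchE.
  by case: ifP => _ /=; rewrite ?addr0 ?add0r ?sub0r.
have Vd := qfB S (Vexp k) VPf.
have a_le x : `|a x| <= `|(restricted_exp G m (A k) t f \- P t f) x|.
  by rewrite /a patchE; case: ifP => // _; rewrite normr0.
have b_le x : `|b x| <= `|P t f x|.
  by rewrite /b; case: ifP => _; rewrite ?normr0// normrN.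
have Va := ell2_le m_gt0 a_le Vd; have Vb := ell2_le m_gt0 b_le VPf.
apply: le_trans (qnormD S Va Vb) _.
have Na := le_trans (ell2norm_le m_gt0 a_le Vd) h1.
have Nb : qnorm (sqnorm m) b <= e / 2.
  rewrite -ler_sqr ?nnegrE ?sqrtr_ge0 ?(ltW e20)// (sqr_qnorm S)//.
  apply: HF => // x Fx; rewrite /b ifT// inE; exact: FA.
by rewrite /ell2norm in Na; rewrite /qnorm in Nb *; lra.
Qed.

Theorem corollary5p2 (R : realType) (X : countType) (G : graph R X)
  (m : X -> R) (m_gt0 : forall x, 0 < m x) (G_connected : connected_graph G)
  (PD PN : R -> (X -> R) -> (X -> R))
  (PD_exp : exp_semigroup m (dirichlet_operator G m) PD)
  (PN_exp : exp_semigroup m (neumann_operator G m) PN) :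
  (feller PN <-> feller PD /\ domD G m = domN G m) /\
  (feller PN ->
   forall A : nat -> set X, exhaustion G A ->
   forall (t : R) (f : X -> R), 0 <= t -> ell2 m f ->
     ell2norm m (restricted_semigroup G m (A k) t f \- PD t f)
       @[k --> \oo] --> (0 : R)).
Proof.
have HL := neumann_accretive G m_gt0.
have domE : feller PN -> domD G m = domN G m.
  move=> FN; apply/seteqP; split; first exact: domD_sub.
  exact: (feller_domN_sub_domD m_gt0 PN_exp FN).
have PD_neumann : domD G m = domN G m -> exp_semigroup m (neumann_operator G m) PD.
  by move=> e; move: PD_exp; rewrite /dirichlet_operator e.
have PE : domD G m = domN G m -> forall t f, 0 < t -> Cc f -> PD t f = PN t f.
  move=> e t f t0 Cf; apply: (exp_semigroup_unique m_gt0 HL (PD_neumann e) PN_exp t0).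
  exact: Cc_ell2.
split; first split.
- move=> FN; have e := domE FN; split=> //; case: FN => t t0 H; exists t => // f Cf.
  by rewrite PE//; exact: H.
- by move=> [[t t0 H] e]; exists t => // f Cf; rewrite -PE//; exact: H.
move=> FN A HA t f t0 Vf; apply/cvg_eps => e e0.
have [K HK] := restricted_semigroup_cvg m_gt0 (PD_neumann (domE FN)) HA t0 Vf e0.
by exists K => k Kk; rewrite subr0 ger0_norm ?sqrtr_ge0//; exact: HK.
Qed.
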